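(* Let $\alpha_0>0$ and let $B_0\in\mathcal{E}_{\alpha_0}$. Then for each $\alpha\in(0,\alpha_0)$ there is a $T>0$ (which depends on $\alpha,\alpha_0$) such that there is a unique solution $B_t$, $t\in[0,T)$, in the space $\mathcal{E}_\alpha$ to the initial value problem $$\frac{\partial B_t}{\partial t}=\tilde L B_t,\qquad B_t|_{t=0}=B_0,$$ where $$(\tilde LB)(\theta)= -\int_{\mathbb{R}^d} dx\,\theta(x)\Bigl( \delta B(\theta;x) - zB\bigl(\theta e^{-\phi (x -\cdot )}+e^{-\phi (x-\cdot )}-1\bigr)\Bigr),\quad \theta\in L^1 .$$
   Context: $L^1:=L^1(\mathbb{R}^d,dx)$ denotes the space of complex-valued integrable functions, $d\in\mathbb{N}$. A functional $B:L^1\to\mathbb{C}$ is entire on $L^1$ if it is locally bounded and for all $\theta_0,\theta\in L^1$ the map $\mathbb{C}\ni w\mapsto B(\theta_0+w\theta)\in\mathbb{C}$ is entire. For an entire $B$ and $\theta\in L^1$, the first variational derivative $\delta B(\theta;\cdot)\in L^\infty(\mathbb{R}^d)$ is the function determined by $\frac{\partial}{\partial w}B(\theta+w h)\big|_{w=0}=\int_{\mathbb{R}^d}dx\,\delta B(\theta;x)h(x)$ for all $h\in L^1$. For $\alpha>0$, $\mathcal{E}_\alpha$ is the Banach space of all entire functionals $B$ on $L^1$ with $\|B\|_\alpha:=\sup_{\theta\in L^1}\bigl(|B(\theta)|e^{-\frac1\alpha\|\theta\|_{L^1}}\bigr)<\infty$. For $0<\alpha'<\alpha''$ one has $\mathcal{E}_{\alpha''}\subseteq\mathcal{E}_{\alpha'}$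 and $\|\cdot\|_{\alpha'}\le\|\cdot\|_{\alpha''}$. Standing assumptions: $z>0$ is a constant, and $\phi:\mathbb{R}^d\to\mathbb{R}\cup\{+\infty\}$ is Borel measurable with $\phi(-x)=\phi(x)\in\mathbb{R}$ for all $x\neq0$, non-negative and integrable. A solution in $\mathcal{E}_\alpha$ on $[0,T)$ is a function $[0,T)\ni t\mapsto B_t\in\mathcal{E}_\alpha$, continuous on $[0,T)$ and continuously differentiable on $(0,T)$ in the norm of $\mathcal{E}_\alpha$, such that $\tilde LB_t\in\mathcal{E}_\alpha$ and which satisfies the equation and the initial condition. *)

(* Defs.v *)
From HB Require Import structures.
From mathcomp Require Import all_boot all_order all_algebra.
From mathcomp Require Import complex.
From mathcomp Require Import all_classical all_reals all_analysis.
From mathcomp Require Import measurable_realfun.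

Set Implicit Arguments.
Unset Strict Implicit.
Unset Printing Implicit Defensive.
Import Order.TTheory GRing.Theory Num.Theory.
Import numFieldNormedType.Exports.

Local Open Scope classical_set_scope.
Local Open Scope ring_scope.
Local Open Scope complex_scope.

(* R^d is the type of d-tuples of reals, with the product (= Borel)
   sigma-algebra. *)
Notation Rd R d := (d.-tuple (measurableTypeR R)).

Section euclidean.
Context {R : realType}.
Implicit Types (d : nat).

Definition rd0 d : Rd R d := [tuple (0 : R) | i < d].
Definition rdopp d (x : Rd R d) : Rd R d := [tuple - (tnth x i : R) | i < d].
Definition rdsub d (x y : Rd R d) : Rd R d :=
  [tuple (tnth x i : R) - tnth y i | i < d].

Definition rdcons d (p : measurableTypeR R * Rd R d) : Rd R d.+1 :=
  [tuple of p.1 :: p.2].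

Definition rduncons d (x : Rd R d.+1) : measurableTypeR R * Rd R d :=
  (thead x, [tuple of behead x]).

Lemma rdunconsK d : cancel (@rduncons d) (@rdcons d).
Proof. by move=> x; rewrite /rdcons /= -tuple_eta. Qed.

Lemma rdconsK d : cancel (@rdcons d) (@rduncons d).
Proof. by move=> [a x]; congr pair; apply/val_inj. Qed.

Lemma measurable_rdcons d : measurable_fun setT (@rdcons d).
Proof. exact: measurable_cons. Qed.

Lemma measurable_rduncons d : measurable_fun setT (@rduncons d).
Proof.
apply: measurable_fun_pair; last exact: measurable_behead.
exact: (@measurable_tnth _ (measurableTypeR R) d.+1 ord0).
Qed.

Section lebesgue_step.
Context d (m : {sigma_finite_measure set (Rd R d) -> \bar R}).

Definition lebesgue_step : set (Rd R d.+1) -> \bar R :=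
  pushforward (lebesgue_measure \x m)%E (@rdcons d).

Let step := measure_function_pushforward__canonical__measure_function_Measure
  (lebesgue_measure \x m)%E (@measurable_rdcons d).

Let step0 : lebesgue_step set0 = 0%E. Proof. exact: (measure0 step). Qed.

Let step_ge0 A : (0 <= lebesgue_step A)%E.
Proof. exact: (measure_ge0 step). Qed.

Let step_sigma_additive : semi_sigma_additive lebesgue_step.
Proof. exact: (@measure_semi_sigma_additive _ _ _ step). Qed.

HB.instance Definition _ := isMeasure.Build _ _ _
  lebesgue_step step0 step_ge0 step_sigma_additive.

Lemma lebesgue_step_sigma_finite : sigma_finite setT lebesgue_step.
Proof.
have [F FT mF] : sigma_finite setT (lebesgue_measure \x m)%E.
  have /sigma_finiteP[F [TF ndF Foo]] := sigma_finiteT (@lebesgue_measure R).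
  have /sigma_finiteP[G [TG ndG Goo]] := sigma_finiteT m.
  exists (fun n => F n `*` G n).
    rewrite -setXTT TF TG predeqE => -[x y]; split.
      move=> [/= [n _ Fnx] [k _ Gky]]; exists (maxn n k) => //; split.
      - by move: x Fnx; exact/subsetPset/ndF/leq_maxl.
      - by move: y Gky; exact/subsetPset/ndG/leq_maxr.
    by move=> [n _ []/= ? ?]; split; exists n.
  move=> k; have [? ?] := Foo k; have [? ?] := Goo k.
  split; first exact: measurableX.
  by rewrite product_measure1E// lte_mul_pinfty// ge0_fin_numE.
exists (fun k => @rduncons d @^-1` F k).
  by rewrite -preimage_bigcup -FT preimage_setT.
move=> k; have [mFk Fkoo] := mF k; split.
  by rewrite -[X in measurable X]setTI; exact: measurable_rduncons.
rewrite /lebesgue_step /pushforward [X in (_ X < _)%E](_ : _ = F k)//.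
by apply/seteqP; split => p /=; rewrite rdconsK.
Qed.

HB.instance Definition _ :=
  Measure_isSigmaFinite.Build _ _ _ lebesgue_step lebesgue_step_sigma_finite.

End lebesgue_step.

(* Lebesgue measure on R^d: unit mass for d = 0, and the image of
   lebesgue_measure \x lebesgue_Rd d under (a, x) |-> a :: x for d.+1. *)
Fixpoint lebesgue_Rd d : {sigma_finite_measure set (Rd R d) -> \bar R} :=
  match d with
  | 0 => \d_([tuple] : Rd R 0)
  | d'.+1 => lebesgue_step (lebesgue_Rd d')
  end.

End euclidean.

Section functionals.
Context {R : realType} {d : nat}.

Local Notation C := (R[i]).
Local Notation X := (Rd R d).
Local Notation mu := (@lebesgue_Rd R d).
Local Notation abs := (@Normc.normc R).

Definition cintegrable (f : X -> C) :=
  mu.-integrable setT (fun x => (complex.Re (f x))%:E) /\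
  mu.-integrable setT (fun x => (complex.Im (f x))%:E).

Definition cintegral (f : X -> C) : C :=
  (\int[mu]_x complex.Re (f x)) +i* (\int[mu]_x complex.Im (f x)).

Definition aeq (f g : X -> C) := {ae mu, forall x, f x = g x}.

(* Elements of L^1 are handled through representatives: L1 is the set of
   integrable functions, and a functional on L^1 is a function on X -> C that
   takes the same value at a.e. equal elements of L1; its values outside L1
   are irrelevant. *)
Definition L1 : set (X -> C) := [set f | cintegrable f].

Definition L1norm (f : X -> C) : R := \int[mu]_x abs (f x).

Definition L1functional (B : (X -> C) -> C) :=
  forall f g, L1 f -> L1 g -> aeq f g -> B f = B g.

Definition locally_bounded (B : (X -> C) -> C) :=
  forall f0, L1 f0 -> exists r M : R, 0 < r /\
    forall f, L1 f -> L1norm (fun x => f x - f0 x) < r -> abs (B f) <= M.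

(* w |-> B (f + w h), typed on the regular module so that derivable and
   is_derive in direction 1 mean complex differentiability. *)
Definition along (B : (X -> C) -> C) (f h : X -> C) : C^o -> C^o :=
  fun w => B (fun x => f x + w * h x).

Definition entire (B : (X -> C) -> C) :=
  [/\ L1functional B, locally_bounded B &
      forall f h, L1 f -> L1 h -> forall w : C^o, derivable (along B f h) w 1].

Definition Linfty : set (X -> C) := [set g |
  [/\ measurable_fun setT (fun x => complex.Re (g x) : measurableTypeR R),
      measurable_fun setT (fun x => complex.Im (g x) : measurableTypeR R) &
      exists M : R, {ae mu, forall x, abs (g x) <= M}]].

Definition is_vderiv (B : (X -> C) -> C) (f g : X -> C) :=
  Linfty g /\ forall h, L1 h ->
    is_derive (0 : C^o) 1 (along B f h) (cintegral (fun x => g x * h x)).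

(* A representative of the a.e. class determined by is_vderiv. *)
Definition vderiv (B : (X -> C) -> C) (f : X -> C) : X -> C :=
  xget (fun=> 0) [set g | is_vderiv B f g].

Definition Enorm (alpha : R) (B : (X -> C) -> C) : \bar R :=
  ereal_sup [set (abs (B f) * expR (- (L1norm f / alpha)))%:E | f in L1].

Definition calE (alpha : R) : set ((X -> C) -> C) :=
  [set B | entire B /\ (Enorm alpha B < +oo)%E].

(* exp (- phi (x - y)), equal to 0 where phi (x - y) = +oo *)
Definition boltzmann (phi : X -> \bar R) (x y : X) : C :=
  (fine (expeR (- phi (rdsub x y))))%:C.

Definition Ltilde (z : R) (phi : X -> \bar R) (B : (X -> C) -> C)
    (f : X -> C) : C :=
  - cintegral (fun x => f x * (vderiv B f x -
      z%:C * B (fun y => f y * boltzmann phi x y + boltzmann phi x y - 1))).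

Definition potential (phi : X -> \bar R) :=
  [/\ measurable_fun setT phi,
      forall x, x <> rd0 d -> phi (rdopp x) = phi x /\ phi x \is a fin_num,
      forall x, (0 <= phi x)%E &
      mu.-integrable setT phi].

(* B solves dB/dt = Ltilde B, B 0 = B0 in calE alpha on [0, T[; dB t is the
   derivative of B at t in the norm of calE alpha. *)
Definition is_solution (z : R) (phi : X -> \bar R) (alpha T : R)
    (B0 : (X -> C) -> C) (B : R -> (X -> C) -> C) :=
  [/\ forall t, 0 <= t < T -> calE alpha (B t) /\ calE alpha (Ltilde z phi (B t)),
      forall t, 0 <= t < T ->
        Enorm alpha (fun f => B s f - B t f)
          @[s --> within [set s | 0 <= s < T] (nbhs t)] --> 0%E,
      exists dB : R -> (X -> C) -> C,
        [/\ forall t, 0 < t < T -> calE alpha (dB t),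
            forall t, 0 < t < T ->
              Enorm alpha (fun f =>
                (h^-1)%:C * (B (t + h) f - B t f) - dB t f)
                @[h --> 0^'] --> 0%E,
            forall t, 0 < t < T ->
              Enorm alpha (fun f => dB s f - dB t f) @[s --> t] --> 0%E &
            forall t, 0 < t < T -> forall f, L1 f ->
              dB t f = Ltilde z phi (B t) f] &
      forall f, L1 f -> B 0 f = B0 f].

End functionals.

(* Main.v *)
(** The scale of spaces [calE alpha] makes [Ltilde z phi] an Ovsyannikov operator.
    Cauchy's estimate on complex lines bounds the variational derivative, and
    [|theta e^{-phi} + e^{-phi} - 1|_1 <= |theta|_1 + int (1 - e^{-phi})] bounds the
    nonlocal term, so [Ltilde] maps [calE alpha''] to [calE alpha'] with norm at most
    [M / (alpha'' - alpha')]. Splitting [alpha0 - alpha'] into [n] equal steps gives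
    [|Ltilde^n B0| <= K (e M)^n n! / (alpha0 - alpha')^n], hence the exponential
    series of [t Ltilde] applied to [B0] converges for small complex [t], uniformly in
    the norm of an intermediate scale; its Taylor remainders in [t] are again
    controlled by Cauchy's estimate. For uniqueness, the difference of two solutions
    vanishing at [t1] is integrated [n] times through the scales between [alpha / 2]
    and [alpha], which bounds it by a multiple of [(e M (t - t1) / (alpha / 2))^n], so
    it vanishes on an interval whose length does not depend on [t1]. *)

Require Import Defs.
From HB Require Import structures.
From mathcomp Require Import all_boot all_order all_algebra.
From mathcomp Require Import complex.
From mathcomp Require Import all_classical all_reals all_analysis.
From mathcomp Require Import measurable_realfun ring lra.

Set Implicit Arguments.
Unset Strict Implicit.
Unset Printing Implicit Defensive.
Import Order.TTheory GRing.Theory Num.Theory.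
Import numFieldNormedType.Exports.
Import HBNNSimple.

Local Open Scope classical_set_scope.
Local Open Scope ring_scope.
Local Open Scope complex_scope.

(** * Complex differentiation and line integrals *)

Notation abs := (@Normc.normc _).

(** Complex differentiability is given pointwise and along complex lines, without continuity of the
    derivative, so all estimates start from Goursat's theorem for rectangles. Contours are squares
    and integrals are bounded part by part, which accounts for constants such as 16 and 2048. The
    same lack of joint regularity shapes the study of [B]: additivity of the derivative in its
    direction and its holomorphy in the base point are drawn from increment estimates that are
    uniform on bounded sets. [Ltilde] then rests on two facts: the derivative is represented by a
    function of [Linfty], by duality with L^1, and [B] at the shifted argument is measurable in [x],
    because [B] is continuous on L^1 and the shifted arguments form a separable family. The
    prefactor theta(x) costs a factor |theta|_1, which is absorbed only by lowering alpha; this is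
    the source of the loss [1 / (alpha'' - alpha')]. The solution is summed at the midpoint [beta]
    of [alpha] and [alpha0], which leaves room for one more application of [Ltilde] inside
    [calE alpha]. *)

Lemma le_eq disp (T : porderType disp) (x y : T) : x = y -> (x <= y)%O.
Proof. by move=> ->. Qed.

Section modulus.
Context {R : realType}.
Implicit Types (x y : R[i]) (a : R).

Lemma absE x : `|x| = (abs x)%:C.
Proof. by []. Qed.

Lemma abs_ge0 x : 0 <= abs x.
Proof. by case: x => a b /=; exact: sqrtr_ge0. Qed.

Lemma absM x y : abs (x * y) = abs x * abs y.
Proof. exact: Normc.normcM. Qed.

Lemma absV x : abs x^-1 = (abs x)^-1.
Proof. exact: Normc.normcV. Qed.

Lemma absX x n : abs (x ^+ n) = abs x ^+ n.
Proof.
elim: n => [|n IH]; first by rewrite !expr0 Normc.normc1.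
by rewrite !exprS absM IH.
Qed.

Lemma abs0 : abs (0 : R[i]) = 0. Proof. exact: Normc.normc0. Qed.
Lemma abs1 : abs (1 : R[i]) = 1. Proof. exact: Normc.normc1. Qed.

Lemma absN x : abs (- x) = abs x.
Proof. exact: (@normcN R x). Qed.

Lemma absD x y : abs (x + y) <= abs x + abs y.
Proof. exact: (@le_normcD R x y). Qed.

Lemma absB x y : abs (x - y) <= abs x + abs y.
Proof. by rewrite -(absN y) absD. Qed.

Lemma abs_subC x y : abs (x - y) = abs (y - x).
Proof. by rewrite -absN opprB. Qed.

Lemma abs_eq0 x : (abs x == 0) = (x == 0).
Proof.
by apply/eqP/eqP => [/Normc.eq0_normc//|->]; rewrite abs0.
Qed.

Lemma abs_gt0 x : (0 < abs x) = (x != 0).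
Proof. by rewrite lt_def abs_eq0 abs_ge0 andbT. Qed.

Lemma abs_real a : abs (a%:C) = `|a|.
Proof. by rewrite /= expr0n addr0 sqrtr_sqr. Qed.

Lemma absi : abs ('i : R[i]) = 1.
Proof. by rewrite /= expr0n add0r expr1n sqrtr1. Qed.

Lemma ler_Re_abs x : `|complex.Re x| <= abs x.
Proof.
case: x => a b /=; rewrite -sqrtr_sqr ler_wsqrtr// lerDl sqr_ge0 //.
Qed.

Lemma ler_Im_abs x : `|complex.Im x| <= abs x.
Proof.
case: x => a b /=; rewrite -sqrtr_sqr ler_wsqrtr// lerDr sqr_ge0 //.
Qed.

Lemma complexE x : x = (complex.Re x)%:C + 'i * (complex.Im x)%:C.
Proof. by case: x => a b; apply/eqP; rewrite eq_complex /=; apply/andP; split; apply/eqP; ring. Qed.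

Lemma abs_le_ReIm x : abs x <= `|complex.Re x| + `|complex.Im x|.
Proof.
by rewrite {1}(complexE x); apply: (le_trans (absD _ _)); rewrite absM absi mul1r !abs_real.
Qed.

Lemma cReD x y : complex.Re (x + y) = complex.Re x + complex.Re y.
Proof. by case: x; case: y. Qed.
Lemma cImD x y : complex.Im (x + y) = complex.Im x + complex.Im y.
Proof. by case: x; case: y. Qed.
Lemma cReN x : complex.Re (- x) = - complex.Re x. Proof. by case: x. Qed.
Lemma cImN x : complex.Im (- x) = - complex.Im x. Proof. by case: x. Qed.
Lemma cReM x y : complex.Re (x * y) =
  complex.Re x * complex.Re y - complex.Im x * complex.Im y.
Proof. by case: x; case: y. Qed.
Lemma cImM x y : complex.Im (x * y) =
  complex.Re x * complex.Im y + complex.Im x * complex.Re y.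
Proof. by case: x; case: y. Qed.

Lemma abs_le_small x : (forall e : R, 0 < e -> abs x <= e) -> x = 0.
Proof.
move=> h; apply/eqP; rewrite -abs_eq0 eq_le abs_ge0 andbT.
by apply/ler_addgt0Pr => e e0; rewrite add0r h.
Qed.

End modulus.

Section complex_derivative.
Context {R : realType}.
Local Notation C := R[i].
Implicit Types (g : C -> C) (a l s : C).

(** Division-free form of complex differentiability: the increment [s = 0] needs no separate
    treatment, and the inequality can be integrated and passed to limits. *)
Definition cderiv g a l := forall e : R, 0 < e ->
  exists2 dl : R, 0 < dl & forall s, abs s < dl ->
    abs (g (a + s) - g a - s * l) <= e * abs s.

Lemma is_derive_cderiv (g : C^o -> C^o) (a l : C^o) :
  is_derive a 1 g l <-> cderiv g a l.
Proof.
have key : ((fun h : C^o => h^-1 *: (g (h *: 1 + a) - g a)) @ 0^' --> l) <->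
    cderiv g a l.
  split.
    move=> /cvgrPdist_le h e e0.
    have e0' : 0 < e%:C by rewrite ltcR.
    have := h _ e0'; rewrite /nbhs/= /dnbhs/= /within/=.
    (* The radius of a complex ball is itself a complex number; being positive forces its imaginary
       part to vanish. *)
    move=> /nbhs_ballP; move=> [[dr di]] /=; rewrite ltcE/=. move=> /andP[/eqP di0 dr0].
    rewrite {}di0 => H.
    exists dr => // s sd.
    have [->|s0] := eqVneq s 0.
      by rewrite addr0 subrr mul0r subrr abs0 mulr0.
    have /= := H s; rewrite /ball/= sub0r normrN absE ltcR => /(_ sd s0).
    rewrite absE lecR => Hs.
    have -> : g (a + s) - g a - s * l = - (s * (l - s^-1 * (g (s * 1 + a) - g a))).
      by rewrite mulrBr mulrA divff// mul1r mulr1 (addrC s a); ring.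
    by rewrite absN absM mulrC ler_wpM2r ?abs_ge0.
  move=> h; apply/cvgrPdist_le => -[er ei]; rewrite ltcE/= => /andP[/eqP -> e0].
  have [dl dl0 H] := h _ e0.
  rewrite /nbhs/= /dnbhs/= /within/=; apply/nbhs_ballP; exists dl%:C.
    by rewrite /= ltcR.
  move=> s /=; rewrite /ball/= sub0r normrN absE ltcR => sd s0.
  rewrite absE lecR.
  rewrite -(ler_pM2r (_ : 0 < abs s)) ?abs_gt0//.
  rewrite -absM; apply: le_trans (H s sd).
  rewrite -absN; apply: le_eq; congr abs.
  rewrite /GRing.scale/= mulr1 (addrC s a) mulrBl mulrAC mulVf// mul1r.
  by ring.
split.
  move=> [dg dl]; apply/key; rewrite -dl.
  by move: dg => /cvg_ex [l' cl]; rewrite /derive (cvg_lim _ cl).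
move=> /key cl; split; first by apply/cvg_ex; exists l.
by rewrite /derive (cvg_lim _ cl).
Qed.

Lemma derivable_cderiv (g : C^o -> C^o) (a : C^o) :
  derivable g a 1 <-> exists l, cderiv g a l.
Proof.
split=> [dg|[l]]; last by move=> /is_derive_cderiv[].
by exists ('D_1 g a); apply/is_derive_cderiv.
Qed.

Lemma cderiv_uniq g a l l' : cderiv g a l -> cderiv g a l' -> l = l'.
Proof.
move=> /(is_derive_cderiv g) [_ <-] /(is_derive_cderiv g) [_ <-] //.
Qed.

End complex_derivative.

(** * Integrals of complex functions, taken part by part *)

Section complex_integral.
Context d (T : measurableType d) {R : realType}.
Variables (mu : {measure set T -> \bar R}) (D : set T) (mD : measurable D).
Local Notation C := R[i].
Implicit Types (f g : T -> C).

Definition cintg f :=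
  mu.-integrable D (fun x => (complex.Re (f x))%:E) /\
  mu.-integrable D (fun x => (complex.Im (f x))%:E).

Definition cI f : C :=
  (\int[mu]_(x in D) complex.Re (f x)) +i* (\int[mu]_(x in D) complex.Im (f x)).

Lemma eq_cI f g : (forall x, D x -> f x = g x) -> cI f = cI g.
Proof.
move=> fg; rewrite /cI; congr (_ +i* _); apply: eq_Rintegral => x;
  by rewrite inE => /fg ->.
Qed.

Lemma eq_cintg f g : (forall x, D x -> f x = g x) -> cintg f -> cintg g.
Proof.
by move=> fg [h1 h2]; split; [move: h1|move: h2]; apply: eq_integrable => //;
  move=> x; rewrite inE => /fg ->.
Qed.

Lemma cintgD f g : cintg f -> cintg g -> cintg (fun x => f x + g x).
Proof.
move=> [f1 f2] [g1 g2]; split.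
  apply: (eq_integrable mD _ _ _ (integrableD mD f1 g1)) => x _ /=.
  by rewrite cReD EFinD.
apply: (eq_integrable mD _ _ _ (integrableD mD f2 g2)) => x _ /=.
by rewrite cImD EFinD.
Qed.

Lemma cID f g : cintg f -> cintg g ->
  cI (fun x => f x + g x) = cI f + cI g.
Proof.
move=> [f1 f2] [g1 g2]; rewrite /cI.
under eq_Rintegral do rewrite cReD.
rewrite RintegralD//.
by under [X in _ +i* X]eq_Rintegral do rewrite cImD; rewrite RintegralD//.
Qed.

Lemma cintgZ c f : cintg f -> cintg (fun x => c * f x).
Proof.
move=> [f1 f2]; split.
  apply: (eq_integrable mD _ _ _ (integrableB mD (integrableZl mD (complex.Re c) f1)
    (integrableZl mD (complex.Im c) f2))) => x _ /=.
  by rewrite cReM.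
apply: (eq_integrable mD _ _ _ (integrableD mD (integrableZl mD (complex.Re c) f2)
  (integrableZl mD (complex.Im c) f1))) => x _ /=.
by rewrite cImM.
Qed.

Lemma cIZ c f : cintg f -> cI (fun x => c * f x) = c * cI f.
Proof.
move=> [f1 f2]; rewrite /cI.
have i1 k : mu.-integrable D (EFin \o (fun x => k * complex.Re (f x))).
  by apply: (eq_integrable mD _ _ _ (integrableZl mD k f1)).
have i2 k : mu.-integrable D (EFin \o (fun x => k * complex.Im (f x))).
  by apply: (eq_integrable mD _ _ _ (integrableZl mD k f2)).
under eq_Rintegral do rewrite cReM.
rewrite RintegralB//.
under [X in _ +i* X]eq_Rintegral do rewrite cImM.
rewrite RintegralD// !RintegralZl//.
by case: c => a b /=.
Qed.

Lemma cintgN f : cintg f -> cintg (fun x => - f x).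
Proof. by move=> /(cintgZ (-1)); apply: eq_cintg => x _; rewrite mulN1r. Qed.

Lemma cintgB f g : cintg f -> cintg g -> cintg (fun x => f x - g x).
Proof. by move=> cf /cintgN; exact: cintgD. Qed.

Lemma cIN f : cintg f -> cI (fun x => - f x) = - cI f.
Proof.
by move=> cf; rewrite -mulN1r -cIZ//; apply: eq_cI => x _; rewrite mulN1r.
Qed.

Lemma cIB f g : cintg f -> cintg g ->
  cI (fun x => f x - g x) = cI f - cI g.
Proof. by move=> cf cg; rewrite cID ?cIN//; exact: cintgN. Qed.

Lemma cintg_measurable f : cintg f ->
  measurable_fun D (fun x => complex.Re (f x)) /\
  measurable_fun D (fun x => complex.Im (f x)).
Proof.
by move=> [/measurable_int/measurable_EFinP ? /measurable_int/measurable_EFinP ?].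
Qed.

Lemma measurable_abs (E : set T) f :
  measurable_fun E (fun x => complex.Re (f x)) ->
  measurable_fun E (fun x => complex.Im (f x)) ->
  measurable_fun E (fun x => abs (f x)).
Proof.
move=> m1 m2.
have -> : (fun x => abs (f x)) = Num.sqrt \o
   (fun x => complex.Re (f x) ^+ 2 + complex.Im (f x) ^+ 2).
  by apply/funext => x /=; case: (f x).
apply: measurableT_comp => //.
  by apply: continuous_measurable_fun; exact: sqrt_continuous.
by apply: measurable_funD; apply: measurable_funX.
Qed.

Lemma integrable_abs f : cintg f -> mu.-integrable D (fun x => (abs (f x))%:E).
Proof.
move=> cf; have [m1 m2] := cintg_measurable cf; move: cf => [f1 f2].
apply: (@le_integrable _ _ _ mu D _ _
   (fun x => (`|complex.Re (f x)| + `|complex.Im (f x)|)%:E)) => //.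
- by apply/measurable_EFinP; exact: measurable_abs.
- move=> x Dx; rewrite !abse_EFin lee_fin ger0_norm ?abs_ge0//.
  by rewrite ger0_norm ?addr_ge0// abs_le_ReIm.
- by apply: (integrableD mD (integrable_norm f1) (integrable_norm f2)).
Qed.

(** Real and imaginary parts are bounded separately, which costs the factor 2 that reappears in the
    contour estimates and in the bound of the nonlocal term. *)
Lemma abs_cI_le f (G : T -> R) : cintg f -> mu.-integrable D (EFin \o G) ->
  (forall x, D x -> abs (f x) <= G x) ->
  abs (cI f) <= 2 * \int[mu]_(x in D) G x.
Proof.
move=> [f1 f2] iG fG; apply: (le_trans (abs_le_ReIm _)) => /=.
rewrite mulr_natl mulr2n; apply: lerD.
  apply: (le_trans (le_normr_Rintegral _ _)) => //.
  apply: le_Rintegral => // [|x Dx]; first exact: integrable_norm.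
  by rewrite (le_trans (ler_Re_abs _))// fG.
apply: (le_trans (le_normr_Rintegral _ _)) => //.
apply: le_Rintegral => // [|x Dx]; first exact: integrable_norm.
by rewrite (le_trans (ler_Im_abs _))// fG.
Qed.

End complex_integral.

(** * Integrals over real segments *)

Section segment_integral.
Context {R : realType}.
Local Notation C := R[i].
Local Notation leb := (@lebesgue_measure R).
Implicit Types (u v : R -> C) (a b c : R) (F : C -> C) (p l : C).

Definition ccont F p := forall e : R, 0 < e ->
  exists2 dl : R, 0 < dl & forall s, abs s < dl -> abs (F (p + s) - F p) <= e.

Lemma cderiv_ccont F p l : cderiv F p l -> ccont F p.
Proof.
move=> dF e e0; have [dl dl0 H] := dF 1 ltr01.
have K0 : 0 < 1 + abs l by rewrite ltr_pwDl// abs_ge0.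
exists (Num.min dl (e / (1 + abs l))); first by rewrite lt_min dl0 divr_gt0.
move=> s; rewrite lt_min => /andP[sd se].
have -> : F (p + s) - F p = (F (p + s) - F p - s * l) + s * l by ring.
apply: (le_trans (absD _ _)).
apply: (@le_trans _ _ (abs s * (1 + abs l))).
  by rewrite absM mulrDr mulr1 lerD2r (le_trans (H _ sd))// mul1r.
by rewrite -ler_pdivlMr// ltW.
Qed.

Definition seg a b := cI leb `[a, b].
Definition segint a b := cintg leb `[a, b].

Lemma segint_cont u a b :
  (forall t, a <= t <= b -> forall e : R, 0 < e -> exists2 dl : R, 0 < dl &
     forall s : R, `|s| < dl -> abs (u (t + s) - u t) <= e) ->
  segint a b u.
Proof.
move=> H.
have key (f : C -> R) : (forall x y, `|f x - f y| <= abs (x - y)) ->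
    leb.-integrable `[a, b] (EFin \o (f \o u)).
  move=> fL; apply: continuous_compact_integrable; first exact: segment_compact.
  apply: continuous_in_subspaceT => t; rewrite inE/= in_itv/= => tab.
  apply/cvgrPdist_le => e e0; have [dl dl0 K] := H t tab e e0.
  apply/nbhs_ballP; exists dl => // s /=; rewrite /ball/= => ts.
  rewrite distrC; apply: le_trans (fL _ _) _.
  by have := K (s - t); rewrite (_ : t + (s - t) = s); [apply; rewrite distrC|ring].
split; apply: key => x y.
  by rewrite -cReN -cReD ler_Re_abs.
by rewrite -cImN -cImD ler_Im_abs.
Qed.

Lemma seg_split u a b c : a <= c -> c <= b -> segint a b u ->
  seg a b u = seg a c u + seg c b u.
Proof.
move=> ac cb [u1 u2].
have key (f : R -> R) : leb.-integrable `[a, b] (EFin \o f) ->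
   \int[leb]_(x in `[a, b]) f x =
   \int[leb]_(x in `[a, c]) f x + \int[leb]_(x in `[c, b]) f x.
  move=> fi; have := @Rintegral_itvB R f (BLeft a) (BRight b) c fi.
  rewrite !bnd_simp => /(_ ac cb).
  rewrite (@Rintegral_itv_obnd_cbnd R c (BRight b)).
    by move=> <-; rewrite addrC subrK.
  apply: integrableS fi => //; apply: subset_itv; rewrite bnd_simp//.
by rewrite /seg /cI (key _ u1) (key _ u2).
Qed.

Lemma fine_lebesgue_seg a b : a <= b -> fine (leb `[a, b]%classic) = b - a.
Proof.
move=> ab; rewrite lebesgue_measure_itv/= lte_fin.
by case: ltP => // ba; rewrite (le_anti (_ : a <= b <= a)) ?ab// subrr.
Qed.

Lemma seg_cst a b (k : C) : a <= b -> seg a b (fun=> k) = k * (b - a)%:C.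
Proof.
move=> ab; rewrite /seg /cI !Rintegral_cst//= fine_lebesgue_seg//.
case: k => x y; apply/eqP; rewrite eq_complex /=; apply/andP; split; apply/eqP; ring.
Qed.

Lemma segint_cst a b (k : C) : segint a b (fun=> k).
Proof.
by apply: segint_cont => t _ e e0; exists 1 => // s _; rewrite subrr abs0 ltW.
Qed.

Lemma integrable_seg_cst a b (M : R) : leb.-integrable `[a, b] (EFin \o (fun=> M)).
Proof. by have [] := segint_cst a b M%:C. Qed.

Lemma abs_seg_le u a b (M : R) : a <= b -> segint a b u ->
  (forall t, a <= t <= b -> abs (u t) <= M) ->
  abs (seg a b u) <= 2 * M * (b - a).
Proof.
move=> ab iu H; rewrite /seg.
apply: (@le_trans _ _ (2 * \int[leb]_(x in `[a, b]) M)).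
  apply: (@abs_cI_le _ _ _ leb _ _ u (fun=> M)) => //.
    exact: integrable_seg_cst.
by rewrite Rintegral_cst// fine_lebesgue_seg// mulrA.
Qed.

End segment_integral.

(** * Goursat's theorem and Cauchy's estimate *)

Section rectangles.
Context {R : realType}.
Local Notation C := R[i].
Implicit Types (F G : C -> C) (a b c x y : R) (p l : C).

Lemma complex_eqP (x y : C) :
  complex.Re x = complex.Re y -> complex.Im x = complex.Im y -> x = y.
Proof. by move=> e1 e2; apply/eqP; rewrite eq_complex e1 e2 !eqxx. Qed.

Lemma ccontD F G p : ccont F p -> ccont G p -> ccont (fun w => F w + G w) p.
Proof.
move=> cF cG e e0; have e2 : 0 < e / 2 by rewrite divr_gt0.
have [d1 d10 H1] := cF _ e2; have [d2 d20 H2] := cG _ e2.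
exists (Num.min d1 d2); first by rewrite lt_min d10.
move=> s; rewrite lt_min => /andP[s1 s2].
rewrite [X in abs X](_ : _ = (F (p + s) - F p) + (G (p + s) - G p)); last by ring.
by rewrite (le_trans (absD _ _))// (splitr e) lerD ?H1 ?H2.
Qed.

Lemma ccontZ F (k : C) p : ccont F p -> ccont (fun w => k * F w) p.
Proof.
move=> cF e e0; have K0 : 0 < 1 + abs k by rewrite ltr_pwDl// abs_ge0.
have [dl dl0 H] := cF _ (divr_gt0 e0 K0); exists dl => // s sd.
rewrite -mulrBr absM; apply: (@le_trans _ _ ((1 + abs k) * (e / (1 + abs k)))).
  by rewrite ler_pM ?abs_ge0 ?H// lerDr.
by rewrite mulrC divfK// gt_eqF.
Qed.

Lemma ccont_id p : ccont id p.
Proof. by move=> e e0; exists e => // s /ltW; rewrite addrAC subrr add0r. Qed.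

Lemma ccont_cst (k : C) p : ccont (fun=> k) p.
Proof. by move=> e e0; exists 1 => // s _; rewrite subrr abs0 ltW. Qed.

Definition hseg a b y F := seg a b (fun t => F (t +i* y)).
Definition vseg a b x F := seg a b (fun t => F (x +i* t)).

Lemma hseg_int a b y F : (forall t, a <= t <= b -> ccont F (t +i* y)) ->
  segint a b (fun t => F (t +i* y)).
Proof.
move=> cF; apply: segint_cont => t tab e e0; have [dl dl0 H] := cF t tab e e0.
exists dl => // s sd; have := H s%:C; rewrite abs_real => /(_ sd).
rewrite (_ : (t +i* y) + s%:C = (t + s) +i* y)//.
by apply: complex_eqP => /=; rewrite ?addr0.
Qed.

Lemma vseg_int a b x F : (forall t, a <= t <= b -> ccont F (x +i* t)) ->
  segint a b (fun t => F (x +i* t)).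
Proof.
move=> cF; apply: segint_cont => t tab e e0; have [dl dl0 H] := cF t tab e e0.
exists dl => // s sd; have := H (0 +i* s); rewrite /= expr0n add0r sqrtr_sqr => /(_ sd).
rewrite (_ : (x +i* t) + (0 +i* s) = x +i* (t + s))//.
by apply: complex_eqP => /=; rewrite ?addr0.
Qed.

(** The counterclockwise contour integral around a rectangle: dz is dt on horizontal edges and i dt
    on vertical ones. *)
Definition rint F x0 x1 y0 y1 : C :=
  hseg x0 x1 y0 F - hseg x0 x1 y1 F + 'i * (vseg y0 y1 x1 F - vseg y0 y1 x0 F).

Definition rcont F x0 x1 y0 y1 :=
  (forall t, x0 <= t <= x1 -> ccont F (t +i* y0) /\ ccont F (t +i* y1)) /\
  (forall t, y0 <= t <= y1 -> ccont F (x0 +i* t) /\ ccont F (x1 +i* t)).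

Lemma rcont_edges F x0 x1 y0 y1 : rcont F x0 x1 y0 y1 ->
  [/\ segint x0 x1 (fun t => F (t +i* y0)), segint x0 x1 (fun t => F (t +i* y1)),
      segint y0 y1 (fun t => F (x0 +i* t)) & segint y0 y1 (fun t => F (x1 +i* t))].
Proof.
by move=> [h v]; split; [apply: hseg_int|apply: hseg_int|apply: vseg_int
  |apply: vseg_int] => t tab; [case: (h t)|case: (h t)|case: (v t)|case: (v t)].
Qed.

(** The two integrals over the new common edge cancel whatever their value, so only the edges that
    are cut must be integrable. *)
Lemma rint_splitx F x0 x1 y0 y1 c : x0 <= c <= x1 -> rcont F x0 x1 y0 y1 ->
  rint F x0 x1 y0 y1 = rint F x0 c y0 y1 + rint F c x1 y0 y1.
Proof.
move=> /andP[c0 c1] /rcont_edges[h0 h1 v0 v1].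
rewrite /rint /hseg (seg_split c0 c1 h0) (seg_split c0 c1 h1); ring.
Qed.

Lemma rint_splity F x0 x1 y0 y1 c : y0 <= c <= y1 -> rcont F x0 x1 y0 y1 ->
  rint F x0 x1 y0 y1 = rint F x0 x1 y0 c + rint F x0 x1 c y1.
Proof.
move=> /andP[c0 c1] /rcont_edges[h0 h1 v0 v1].
rewrite /rint /vseg (seg_split c0 c1 v0) (seg_split c0 c1 v1); ring.
Qed.

Lemma rintD F G x0 x1 y0 y1 : rcont F x0 x1 y0 y1 -> rcont G x0 x1 y0 y1 ->
  rint (fun w => F w + G w) x0 x1 y0 y1 = rint F x0 x1 y0 y1 + rint G x0 x1 y0 y1.
Proof.
move=> /rcont_edges[f1 f2 f3 f4] /rcont_edges[g1 g2 g3 g4].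
by rewrite /rint /hseg /vseg /seg !cID//; ring.
Qed.

Lemma rintZ F k x0 x1 y0 y1 : rcont F x0 x1 y0 y1 ->
  rint (fun w => k * F w) x0 x1 y0 y1 = k * rint F x0 x1 y0 y1.
Proof.
by move=> /rcont_edges[f1 f2 f3 f4]; rewrite /rint /hseg /vseg /seg !cIZ//; ring.
Qed.

Lemma rintE F x0 x1 y0 y1 : rcont F x0 x1 y0 y1 ->
  rint F x0 x1 y0 y1 = seg x0 x1 (fun t => F (t +i* y0) - F (t +i* y1)) +
    'i * seg y0 y1 (fun t => F (x1 +i* t) - F (x0 +i* t)).
Proof.
by move=> /rcont_edges[f1 f2 f3 f4]; rewrite /rint /hseg /vseg /seg !cIB.
Qed.

Lemma ccont_affine (A B p q : C) : ccont (fun w => A + (w - p) * B) q.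
Proof.
apply: ccontD; first exact: ccont_cst.
have -> : (fun w => (w - p) * B) = (fun w : C => B * (w + - p)).
  by apply/funext => w; rewrite mulrC.
by apply: ccontZ; apply: ccontD; [exact: ccont_id|exact: ccont_cst].
Qed.

(** On opposite edges an affine function differs by a constant. Both differences integrate
    explicitly and the results cancel, so no primitive is involved. *)
Lemma rint_affine (A B p : C) x0 x1 y0 y1 : x0 <= x1 -> y0 <= y1 ->
  rint (fun w => A + (w - p) * B) x0 x1 y0 y1 = 0.
Proof.
move=> x01 y01; rewrite rintE; last by split=> t _; split; exact: ccont_affine.
have -> : (fun t => A + (t +i* y0 - p) * B - (A + (t +i* y1 - p) * B)) =
    (fun=> 'i * (y0 - y1)%:C * B).
  apply/funext => t; rewrite (complexE (t +i* y0)) (complexE (t +i* y1)) /=.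
  by rewrite (rmorphB (@real_complex R)) /=; ring.
have -> : (fun t => A + (x1 +i* t - p) * B - (A + (x0 +i* t - p) * B)) =
    (fun=> (x1 - x0)%:C * B).
  apply/funext => t; rewrite (complexE (x0 +i* t)) (complexE (x1 +i* t)) /=.
  by rewrite (rmorphB (@real_complex R)) /=; ring.
rewrite !seg_cst// !(rmorphB (@real_complex R)) /=; ring.
Qed.

Lemma rint_le F x0 x1 y0 y1 (M : R) : x0 <= x1 -> y0 <= y1 ->
  rcont F x0 x1 y0 y1 ->
  (forall t, x0 <= t <= x1 -> abs (F (t +i* y0)) <= M /\ abs (F (t +i* y1)) <= M) ->
  (forall t, y0 <= t <= y1 -> abs (F (x0 +i* t)) <= M /\ abs (F (x1 +i* t)) <= M) ->
  abs (rint F x0 x1 y0 y1) <= 4 * M * ((x1 - x0) + (y1 - y0)).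
Proof.
move=> x01 y01 /rcont_edges[f1 f2 f3 f4] h v.
rewrite (le_trans (absD _ _))// absM absi mul1r.
have b1 : abs (hseg x0 x1 y0 F) <= 2 * M * (x1 - x0).
  by apply: abs_seg_le => // t /h[].
have b2 : abs (hseg x0 x1 y1 F) <= 2 * M * (x1 - x0).
  by apply: abs_seg_le => // t /h[].
have b3 : abs (vseg y0 y1 x0 F) <= 2 * M * (y1 - y0).
  by apply: abs_seg_le => // t /v[].
have b4 : abs (vseg y0 y1 x1 F) <= 2 * M * (y1 - y0).
  by apply: abs_seg_le => // t /v[].
have := absB (hseg x0 x1 y0 F) (hseg x0 x1 y1 F).
have := absB (vseg y0 y1 x1 F) (vseg y0 y1 x0 F).
lra.
Qed.

Lemma nested_intervals (lo hi : nat -> R) :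
  (forall n, lo n <= lo n.+1) -> (forall n, hi n.+1 <= hi n) ->
  (forall n, lo n <= hi n) -> exists q, forall n, lo n <= q <= hi n.
Proof.
move=> loS hiS lohi.
have lomono m n : lo m <= lo (m + n)%N.
  by elim: n => [|n IH]; rewrite ?addn0// addnS (le_trans IH).
have himono m n : hi (m + n)%N <= hi m.
  by elim: n => [|n IH]; rewrite ?addn0// addnS (le_trans _ IH).
have ub m n : lo n <= hi m.
  by rewrite (le_trans (lomono n m))// (le_trans (lohi _))// addnC himono.
have hs : has_sup (range lo).
  by split; [exists (lo 0%N), 0%N|exists (hi 0%N) => _ [n _ <-]].
exists (sup (range lo)) => n; apply/andP; split.
  by apply: sup_upper_bound => //; exists n.
by apply: sup_le_ub; [exists (lo 0%N), 0%N|move=> _ [m _ <-]].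
Qed.

Lemma dyadic_half (K : R) n : K / 2 ^+ n = K / 2 ^+ n.+1 + K / 2 ^+ n.+1.
Proof. by rewrite exprS invfM; field; rewrite expf_neq0. Qed.

(** A rectangle is encoded by its lower left corner and its level [n], with sides [W / 2 ^+ n] and
    [H / 2 ^+ n]. The limit point is found in each coordinate separately, from nested intervals. *)
Lemma nested_rectangles (P : R -> R -> nat -> Prop) (x0 y0 W H : R) :
  0 <= W -> 0 <= H -> P x0 y0 0%N ->
  (forall x y n, P x y n -> exists x' y',
     [/\ x' = x \/ x' = x + W / 2 ^+ n.+1, y' = y \/ y' = y + H / 2 ^+ n.+1 &
         P x' y' n.+1]) ->
  exists px py, forall n, exists x y,
    [/\ x <= px <= x + W / 2 ^+ n, y <= py <= y + H / 2 ^+ n & P x y n].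
Proof.
move=> W0 H0 P0 step.
have step' (q : R * R) (n : nat) : {q' : R * R | P q.1 q.2 n ->
    [/\ q'.1 = q.1 \/ q'.1 = q.1 + W / 2 ^+ n.+1,
        q'.2 = q.2 \/ q'.2 = q.2 + H / 2 ^+ n.+1 & P q'.1 q'.2 n.+1]}.
  (* The corner is kept when [P] fails, so that the choice is total and the recursion can be written
     before [P] is known along it. *)
  apply/cid; have [Pq|nPq] := pselect (P q.1 q.2 n); last by exists q.
  by have [x' [y' h]] := step _ _ _ Pq; exists (x', y').
pose fix z (n : nat) : R * R :=
  match n with 0%N => (x0, y0) | S m => sval (step' (z m) m) end.
have zP n : P (z n).1 (z n).2 n.
  by elim: n => // n IH /=; case: (step' (z n) n) => q' /= /(_ IH)[].
have zS n : ((z n.+1).1 = (z n).1 \/ (z n.+1).1 = (z n).1 + W / 2 ^+ n.+1) /\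
    ((z n.+1).2 = (z n).2 \/ (z n.+1).2 = (z n).2 + H / 2 ^+ n.+1).
  by rewrite /=; case: (step' (z n) n) => q' /= /(_ (zP n))[].
have key (u : nat -> R) (K : R) : 0 <= K ->
    (forall n, u n.+1 = u n \/ u n.+1 = u n + K / 2 ^+ n.+1) ->
    exists q, forall n, u n <= q <= u n + K / 2 ^+ n.
  move=> K0 uS.
  have KSn n : 0 <= K / 2 ^+ n by rewrite divr_ge0// exprn_ge0.
  apply: nested_intervals => n.
  - by case: (uS n) => ->//; rewrite lerDl.
  - by rewrite (dyadic_half K n); have := KSn n.+1; case: (uS n) => ->; lra.
  - by rewrite lerDl.
have [px Px] := key (fun n => (z n).1) W W0 (fun n => (zS n).1).
have [py Py] := key (fun n => (z n).2) H H0 (fun n => (zS n).2).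
by exists px, py => n; exists (z n).1, (z n).2.
Qed.

Lemma rint_quarter F x y w h : 0 <= w -> 0 <= h ->
  (forall x' y', x <= x' <= x + (w + w) -> y <= y' <= y + (h + h) ->
    ccont F (x' +i* y')) ->
  rint F x (x + (w + w)) y (y + (h + h)) =
    rint F x (x + w) y (y + h) + rint F (x + w) (x + w + w) y (y + h) +
    rint F x (x + w) (y + h) (y + h + h) +
    rint F (x + w) (x + w + w) (y + h) (y + h + h).
Proof.
rewrite (addrA x) (addrA y) => w0 h0 cF.
have xw : x <= x + w by rewrite lerDl.
have yh : y <= y + h by rewrite lerDl.
have xww : x + w <= x + w + w by rewrite lerDl.
have yhh : y + h <= y + h + h by rewrite lerDl.
have rF a b c e : x <= a -> a <= b -> b <= x + w + w -> y <= c -> c <= e ->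
    e <= y + h + h -> rcont F a b c e.
  move=> xa ab bx yc ce ey.
  split=> t /andP[t1 t2]; split; apply: cF; apply/andP; split => //;
    by [apply: le_trans t1|apply: (le_trans t2)|apply: le_trans ce
       |apply: (le_trans ce)|apply: le_trans ab|apply: (le_trans ab)].
have xx : x <= x + w + w := le_trans xw xww.
have yy : y <= y + h + h := le_trans yh yhh.
rewrite (@rint_splitx F x (x + w + w) y (y + h + h) (x + w)) ?xw//;
  last exact: rF.
rewrite (@rint_splity F x (x + w) y (y + h + h) (y + h)) ?yh//; last exact: rF.
rewrite (@rint_splity F (x + w) (x + w + w) y (y + h + h) (y + h)) ?yh//;
  last exact: rF.
set r1 := rint F _ _ _ _; set r2 := rint F _ _ _ _.
set r3 := rint F _ _ _ _; set r4 := rint F _ _ _ _.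
by clear; clearbody r1 r2 r3 r4; ring.
Qed.

Lemma abs_sum4_ge (q : R) (u1 u2 u3 u4 : C) : 4 * q <= abs (u1 + u2 + u3 + u4) ->
  [\/ q <= abs u1, q <= abs u2, q <= abs u3 | q <= abs u4].
Proof.
move=> Q; have T : abs (u1 + u2 + u3 + u4) <= abs u1 + abs u2 + abs u3 + abs u4.
  rewrite (le_trans (absD _ _))// lerD2r (le_trans (absD _ _))// lerD2r.
  exact: absD.
have [?|Q1] := lerP q (abs u1); first by constructor 1.
have [?|Q2] := lerP q (abs u2); first by constructor 2.
have [?|Q3] := lerP q (abs u3); first by constructor 3.
constructor 4; lra.
Qed.

(** The affine part of [F] at [p] integrates to zero. The remainder is at most [e * (w + h)] on the
    rectangle, and the perimeter gives the second factor [w + h]. *)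
Lemma rint_cderiv F p l : cderiv F p l -> forall e : R, 0 < e ->
  exists2 dl : R, 0 < dl & forall x y w h,
    x <= complex.Re p <= x + w -> y <= complex.Im p <= y + h -> w + h < dl ->
    (forall x' y', x <= x' <= x + w -> y <= y' <= y + h -> ccont F (x' +i* y')) ->
    abs (rint F x (x + w) y (y + h)) <= 4 * e * (w + h) ^+ 2.
Proof.
move=> dp e e0; have [dl dl0 Hp] := dp e e0; exists dl => // x y w h.
move=> /andP[x1 x2] /andP[y1 y2] whd cF.
have xw := le_trans x1 x2; have yh := le_trans y1 y2.
pose A w := F p + (w - p) * l; pose Rm w := F w - A w.
have cA q : ccont A q by exact: ccont_affine.
have FR : Rm = fun w => F w + (-1) * A w by apply/funext => ?; rewrite mulN1r.
have cR x' y' : x <= x' <= x + w -> y <= y' <= y + h -> ccont Rm (x' +i* y').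
  by move=> *; rewrite FR; apply: ccontD; [exact: cF|exact: ccontZ].
have bR x' y' : x <= x' <= x + w -> y <= y' <= y + h ->
    abs (Rm (x' +i* y')) <= e * (w + h).
  move=> /andP[x3 x4] /andP[y3 y4].
  have ds : abs ((x' +i* y') - p) <= w + h.
    rewrite (le_trans (abs_le_ReIm _))//=.
    rewrite cReD cImD cReN cImN /=; clear -x1 x2 y1 y2 x3 x4 y3 y4.
    by apply: lerD; rewrite ler_norml; apply/andP; split; lra.
  have := Hp _ (le_lt_trans ds whd); rewrite [p + _]addrC subrK /Rm /A.
  by rewrite opprD addrA => /le_trans; apply; rewrite ler_wpM2l// ltW.
have x'x : x <= x <= x + w by rewrite lexx.
have y'y : y <= y <= y + h by rewrite lexx.
have xx' : x <= x + w <= x + w by rewrite lexx xw.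
have yy' : y <= y + h <= y + h by rewrite lexx yh.
have Rcont : rcont Rm x (x + w) y (y + h) by split => t tx; split; apply: cR.
have FE : F = (fun w => Rm w + A w) by apply/funext => ?; rewrite /Rm subrK.
have Acont : rcont A x (x + w) y (y + h) by split => t _; split; exact: cA.
rewrite FE (rintD Rcont Acont).
rewrite rint_affine// addr0.
apply: (le_trans (@rint_le Rm x (x + w) y (y + h) (e * (w + h)) xw yh Rcont _ _)).
- by move=> t tx; split; apply: bR.
- by move=> t tx; split; apply: bR.
- by apply: le_eq; clear; ring.
Qed.

Lemma small_dyadic (K dl : R) : 0 < dl -> exists n, K / 2 ^+ n < dl.
Proof.
move=> dl0; exists (Num.truncn (K / dl)).+1.
rewrite ltr_pdivrMr ?exprn_gt0// mulrC -ltr_pdivrMr//.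
by rewrite (lt_le_trans (truncnS_gt _))// -natrX ler_nat ltnW// ltn_expl.
Qed.

Lemma goursat F x0 x1 y0 y1 : x0 <= x1 -> y0 <= y1 ->
  (forall x y, x0 <= x <= x1 -> y0 <= y <= y1 -> exists l, cderiv F (x +i* y) l) ->
  rint F x0 x1 y0 y1 = 0.
Proof.
move=> x01 y01 dF.
have cF x y : x0 <= x <= x1 -> y0 <= y <= y1 -> ccont F (x +i* y).
  by move=> xx yy; have [l /cderiv_ccont] := dF _ _ xx yy.
have cFs x y w h : x0 <= x -> x + w <= x1 -> y0 <= y -> y + h <= y1 ->
    forall x' y', x <= x' <= x + w -> y <= y' <= y + h -> ccont F (x' +i* y').
  move=> xl xr yl yr x' y' /andP[? ?] /andP[? ?].
  by apply: cF; apply/andP; split;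
    by [apply: le_trans xl _|apply: le_trans yl _|apply: le_trans _ xr
       |apply: le_trans _ yr].
pose W := x1 - x0; pose H := y1 - y0.
have W0 : 0 <= W by rewrite subr_ge0.
have H0 : 0 <= H by rewrite subr_ge0.
pose eta := abs (rint F x0 x1 y0 y1).
have [|eta0] := eqVneq eta 0; first by move/eqP; rewrite abs_eq0 => /eqP.
have {}eta0 : 0 < eta by rewrite lt_def eta0 abs_ge0.
pose P x y (n : nat) := [/\ x0 <= x /\ x + W / 2 ^+ n <= x1,
  y0 <= y /\ y + H / 2 ^+ n <= y1 &
  eta / 4 ^+ n <= abs (rint F x (x + W / 2 ^+ n) y (y + H / 2 ^+ n))].
have ge0h (K : R) n : 0 <= K -> 0 <= K / 2 ^+ n.
  by move=> K0; rewrite divr_ge0// exprn_ge0.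
have [|x y n [[xl xr] [yl yr]]|px [py near_p]] :=
    @nested_rectangles P x0 y0 W H W0 H0.
- by rewrite /P !expr0 !divr1 !(addrC _ (_ - _)) !subrK; split => //; split.
- rewrite (dyadic_half W) (dyadic_half H).
  rewrite (dyadic_half W) in xr; rewrite (dyadic_half H) in yr.
  move: xr yr; rewrite /P; have := ge0h W n.+1 W0; have := ge0h H n.+1 H0.
  have -> : eta / 4 ^+ n = 4 * (eta / 4 ^+ n.+1).
    by rewrite exprS invfM; field; rewrite expf_neq0.
  move: (W / 2 ^+ n.+1) (H / 2 ^+ n.+1) (eta / 4 ^+ n.+1) => w h q h0 w0 xr yr.
  rewrite rint_quarter//; last by apply: cFs.
  have ge1 : x0 <= x + w by rewrite (le_trans xl)// lerDl.
  have ge2 : y0 <= y + h by rewrite (le_trans yl)// lerDl.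
  rewrite !addrA in xr yr.
  have le1 : x + w <= x1 by rewrite (le_trans _ xr)// lerDl.
  have le2 : y + h <= y1 by rewrite (le_trans _ yr)// lerDl.
  case/abs_sum4_ge => Q.
  + by exists x, y; split; [left|left|].
  + by exists (x + w), y; split; [right|left|].
  + by exists x, (y + h); split; [left|right|].
  + by exists (x + w), (y + h); split; [right|right|].
have pin : x0 <= px <= x1 /\ y0 <= py <= y1.
  have [x [y [/andP[a1 a2] /andP[a3 a4] [[a5 a6] [a7 a8] _]]]] := near_p 0%N.
  by rewrite (le_trans a5 a1) (le_trans a2 a6) (le_trans a7 a3) (le_trans a4 a8).
have [l dp] := dF px py pin.1 pin.2.
have S0 : 0 < W + H + 1 by rewrite ltr_wpDl// addr_ge0.
(* With this tolerance the quadratic estimate at level [n] reads [eta / 4 ^+ n / 2], half of the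
   lower bound kept by the bisection. The summand 1 keeps the denominator positive for degenerate
   rectangles. *)
have e0 : 0 < eta / (8 * (W + H + 1) ^+ 2).
  by rewrite divr_gt0// mulr_gt0// exprn_gt0.
have [dl dl0 Hp] := rint_cderiv dp e0.
have [n Hn] := small_dyadic (W + H + 1) dl0.
have [x [y [a1 a2 [[xl xr] [yl yr] Pe]]]] := near_p n.
have whS : W / 2 ^+ n + H / 2 ^+ n <= (W + H + 1) / 2 ^+ n.
  by rewrite -mulrDl ler_wpM2r ?invr_ge0 ?exprn_ge0// lerDl.
have := Hp x y (W / 2 ^+ n) (H / 2 ^+ n) a1 a2 (le_lt_trans whS Hn)
  (cFs _ _ _ _ xl xr yl yr).
move=> /(le_trans Pe) Q.
have {}Q : eta / 4 ^+ n <= (eta / 4 ^+ n) / 2.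
  apply: (le_trans Q).
  have -> : (4 : R) ^+ n = 2 ^+ n * 2 ^+ n by rewrite -exprMn; congr (_ ^+ _); clear; lra.
  rewrite [leRHS](_ : _ = 4 * (eta / (8 * (W + H + 1) ^+ 2)) *
      ((W + H + 1) / 2 ^+ n) ^+ 2).
    apply: ler_wpM2l; first by rewrite mulr_ge0// ltW.
    have wh0 : 0 <= W / 2 ^+ n + H / 2 ^+ n by rewrite addr_ge0// ge0h.
    by rewrite ler_pXn2r// nnegrE// (le_trans wh0).
  by field; rewrite expf_neq0 //= gt_eqF.
have : 0 < eta / 4 ^+ n by rewrite divr_gt0// exprn_gt0.
by clear -Q => a; exfalso; lra.
Qed.

(** Points on the boundary of the square of half-side [r] have modulus between [r] and [2 * r], so a
    bound on that annulus is enough. *)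
Lemma rint_square_le F (r M : R) : 0 <= r -> rcont F (- r) r (- r) r ->
  (forall w, r <= abs w -> abs w <= 2 * r -> abs (F w) <= M) ->
  abs (rint F (- r) r (- r) r) <= 16 * M * r.
Proof.
move=> r0 cF FM; have rr : - r <= r by rewrite (le_trans _ r0)// oppr_le0.
have near x y : `|x| <= r -> `|y| <= r -> abs (x +i* y) <= 2 * r.
  move=> xr yr; rewrite (le_trans (abs_le_ReIm _))//=.
  by rewrite (le_trans (lerD xr yr))// mulr_natl mulr2n.
have far x y : `|x| = r \/ `|y| = r -> r <= abs (x +i* y).
  case=> <-; first exact: (ler_Re_abs (x +i* y)).
  exact: (ler_Im_abs (x +i* y)).
have [nr nNr] : `|r| = r /\ `|- r| = r by rewrite normrN ger0_norm.
rewrite (_ : 16 * M * r = 4 * M * (r - - r + (r - - r))); last by ring.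
apply: (rint_le rr rr cF) => t; rewrite -ler_norml => tr;
  by split; (apply: FM; [apply: far; tauto|apply: near; rewrite ?nr ?nNr]).
Qed.

(** The value is 2 pi i, but a lower bound suffices. Each pair of opposite edges contributes i times
    the integral of [2 * e / (t ^+ 2 + e ^+ 2)], which is at least [e^-1] on the edge, so each pair
    gives at least 2. *)
Lemma abs_rint_inv (e : R) : 0 < e ->
  4 <= abs (rint (fun w : C => w^-1) (- e) e (- e) e).
Proof.
move=> e0.
have ne0 : (-e <= e) by lra.
have dinv (w : C) : w != 0 -> ccont (fun w => w^-1) w.
  move=> w0; have /derivable_cderiv[l /cderiv_ccont//] :
      derivable (fun w : C^o => (w^-1 : C^o)) w 1.
    exact: (@derivableV _ _ (id : C^o -> C^o)).
have nz1 t y : y != 0 -> (t +i* y : C) != 0.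
  by move=> y0; rewrite eq_complex /= (negbTE y0) andbF.
have nz2 t x : x != 0 -> (x +i* t : C) != 0.
  by move=> x0; rewrite eq_complex /= (negbTE x0).
have ee : e != 0 by rewrite gt_eqF.
have nee : - e != 0 by rewrite oppr_eq0.
have c1 t : ccont (fun w : C => w^-1) (t +i* e) by apply/dinv/nz1.
have c2 t : ccont (fun w : C => w^-1) (t +i* - e) by apply/dinv/nz1.
have c3 t : ccont (fun w : C => w^-1) (e +i* t) by apply/dinv/nz2.
have c4 t : ccont (fun w : C => w^-1) (- e +i* t) by apply/dinv/nz2.
rewrite rintE; last by split => t _; split.
pose u (t : R) : C := (2 * e / (t ^+ 2 + e ^+ 2))%:C.
have te t : t ^+ 2 + e ^+ 2 != 0.
  by rewrite gt_eqF// ltr_wpDl ?sqr_ge0// exprn_gt0.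
have -> : (fun t : R => (t +i* - e)^-1 - (t +i* e)^-1) = fun t => 'i * u t.
  apply/funext => t; apply: complex_eqP; rewrite /= ?sqrrN; field => //.
have uE : (fun t : R => (e +i* t)^-1 - (- e +i* t)^-1) = u.
  by apply/funext => t; apply: complex_eqP; rewrite /= ?sqrrN; field => //; rewrite addrC.
have iu : segint (- e) e u by rewrite -uE; apply: cintgB => //; apply: vseg_int => t _.
rewrite uE.
rewrite /seg cIZ// -/(seg _ _ _) -mulrDl absM.
have -> : abs ('i + 'i : C) = 2.
  by rewrite /= addr0 expr0n add0r sqrtr_sqr ger0_norm.
suff : 2 <= abs (seg (- e) e u) by lra.
apply: le_trans (ler_Re_abs _); apply: le_trans (ler_norm _); rewrite /=.
apply: (@le_trans _ _ (\int[lebesgue_measure]_(x in `[(- e), e]) (e^-1))).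
  apply: le_eq.
  by rewrite Rintegral_cst// fine_lebesgue_seg// opprK; field.
apply: le_Rintegral => //; first exact: integrable_seg_cst.
  by case: iu.
move=> t /=; rewrite in_itv/= => /andP[t1 t2].
rewrite ler_pdivlMr; last by rewrite lt_def te addr_ge0 ?sqr_ge0.
rewrite mulrC ler_pdivrMr//.
rewrite (_ : 2 * e * e = e ^+ 2 + e ^+ 2); last by ring.
rewrite lerD2r; have : 0 <= (e - t) * (e + t) by apply: mulr_ge0; lra.
lra.
Qed.
End rectangles.

(** * Holomorphic functions and Cauchy's estimate at the origin *)

Section cauchy.
Context {R : realType}.
Local Notation C := R[i].
Implicit Types (f g : C -> C) (a l s w : C).

Definition holo g := forall w, exists l, cderiv g w l.

Lemma holo_derivable g : holo g <-> forall w : C^o, derivable (g : C^o -> C^o) w 1.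
Proof.
by split=> h w; have := h w; rewrite derivable_cderiv.
Qed.

Lemma holo_cst (k : C) : holo (fun=> k).
Proof. by apply/holo_derivable => w; exact: derivable_cst. Qed.

Lemma holo_id : holo id.
Proof. by apply/holo_derivable => w; exact: derivable_id. Qed.

Lemma holoD f g : holo f -> holo g -> holo (fun w => f w + g w).
Proof.
move=> /holo_derivable hf /holo_derivable hg; apply/holo_derivable => w.
exact: (derivableD (hf w) (hg w)).
Qed.

Lemma holoB f g : holo f -> holo g -> holo (fun w => f w - g w).
Proof.
move=> /holo_derivable hf /holo_derivable hg; apply/holo_derivable => w.
exact: (derivableB (hf w) (hg w)).
Qed.

Lemma holoM f g : holo f -> holo g -> holo (fun w => f w * g w).
Proof.
move=> /holo_derivable hf /holo_derivable hg; apply/holo_derivable => w.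
exact: (derivableM (hf w) (hg w)).
Qed.

Lemma cderiv_shift g a b l : cderiv g (b + a) l <-> cderiv (fun w => g (b + w)) a l.
Proof.
by split=> h e e0; have [dl dl0 H] := h e e0; exists dl => // s sd;
  have := H s sd; rewrite addrA.
Qed.

Lemma holo_shift g b : holo g -> holo (fun w => g (b + w)).
Proof. by move=> hg w; have [l /cderiv_shift] := hg (b + w); exists l. Qed.

Lemma cderivD f g a l l' : cderiv f a l -> cderiv g a l' ->
  cderiv (fun w => f w + g w) a (l + l').
Proof.
by move=> /is_derive_cderiv h1 /is_derive_cderiv h2; apply/is_derive_cderiv; exact: is_deriveD.
Qed.

Lemma cderivN f a l : cderiv f a l -> cderiv (fun w => - f w) a (- l).
Proof.
by move=> /is_derive_cderiv h1; apply/is_derive_cderiv; exact: is_deriveN.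
Qed.

Lemma cderivB f g a l l' : cderiv f a l -> cderiv g a l' ->
  cderiv (fun w => f w - g w) a (l - l').
Proof. by move=> h1 /cderivN; exact: cderivD. Qed.

Lemma cderiv_cst (k : C) a : cderiv (fun=> k) a 0.
Proof. by move=> e e0; exists 1 => // s _; rewrite subrr mulr0 subr0 abs0 mulr_ge0 ?abs_ge0 ?(ltW e0). Qed.

Lemma cderivZ k f a l : cderiv f a l -> cderiv (fun w => k * f w) a (k * l).
Proof.
move=> df e e0; have K0 : 0 < 1 + abs k by rewrite ltr_pwDl// abs_ge0.
have [dl dl0 H] := df _ (divr_gt0 e0 K0); exists dl => // s sd.
rewrite [X in abs X](_ : _ = k * (f (a + s) - f a - s * l)); last by ring.
rewrite absM; apply: (@le_trans _ _ ((1 + abs k) * (e / (1 + abs k) * abs s))).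
  by rewrite ler_pM ?abs_ge0 ?H// lerDr.
by rewrite mulrA (mulrC (1 + _)) divfK// gt_eqF.
Qed.

(** The function [F w = (g w - g 0) / w ^+ 2] has residue [l] at 0. By Goursat its integral is the
    same over large and small squares. The large square gives at most [64 * M / r]; the small one
    gives [l] times the integral of [w^-1], of modulus at least [4 * abs l], up to [16 * e]. *)
Lemma cauchy_at0 g l (r M : R) : holo g -> 0 < r ->
  (forall w, abs w <= r -> abs (g w) <= M) -> cderiv g 0 l ->
  abs l <= 16 * M / r.
Proof.
move=> hg r0 gM dg.
have M0 : 0 <= M by apply: le_trans (abs_ge0 (g 0)) (gM _ _); rewrite abs0 ltW.
pose G w := g w - g 0; pose F w := G w * (w^-1 * w^-1).
have hG : holo G by apply: holoB => //; exact: holo_cst.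
have dF w : w != 0 -> exists m, cderiv F w m.
  move=> w0; have /derivable_cderiv// : derivable (F : C^o -> C^o) w 1.
  have dV : derivable (fun w : C^o => (w^-1 : C^o)) w 1 by apply: derivableV.
  have dG : derivable (G : C^o -> C^o) w 1 by move/holo_derivable: hG; apply.
  exact: (derivableM dG (derivableM dV dV)).
have nz1 t y : y != 0 -> (t +i* y : C) != 0.
  by move=> y0; rewrite eq_complex /= (negbTE y0) andbF.
have nz2 t x : x != 0 -> (x +i* t : C) != 0.
  by move=> x0; rewrite eq_complex /= (negbTE x0).
have cF w : w != 0 -> ccont F w by move=> /dF[m /cderiv_ccont].
have rF (x0 x1 y0 y1 : R) : x0 != 0 -> x1 != 0 -> y0 != 0 -> y1 != 0 ->
    rcont F x0 x1 y0 y1.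
  by move=> *; split => t _; split; apply: cF; by [apply: nz1|apply: nz2].
(* Half of [r], so that the corners of the square stay in the disc of radius [r]. *)
pose h := r / 2; have h0 : 0 < h by rewrite divr_gt0.
(* The frame between the two squares is cut into four rectangles, left and right over the full
   height, bottom and top in the middle; none of them contains 0. *)
have shrink (e : R) : 0 < e -> e <= h ->
    rint F (- h) h (- h) h = rint F (- e) e (- e) e.
  move=> e0 eh.
  have [nh ne] : - h != 0 /\ - e != 0 by rewrite !oppr_eq0 !gt_eqF.
  have [ph pe] : h != 0 /\ e != 0 by rewrite !gt_eqF.
  have heh : - h <= - e <= h.
    by rewrite lerN2 eh (le_trans _ (ltW h0))// oppr_le0 ltW.
  have eh' : - e <= e <= h by rewrite eh andbT (le_trans _ (ltW e0))// oppr_le0 ltW.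
  rewrite (rint_splitx heh); last exact: rF.
  rewrite [X in _ + X](rint_splitx eh'); last exact: rF.
  rewrite [X in _ + (X + _)](rint_splity heh); last exact: rF.
  rewrite [X in _ + (_ + X + _)](rint_splity eh'); last exact: rF.
  have [hme mee] := andP heh. have [ee' _] := andP eh'.
  rewrite (@goursat _ F (- h) (- e) (- h) h); first last.
  - move=> x y /andP[x1 x2] _; apply: dF; apply: nz2; rewrite lt_eqF//.
    by rewrite (le_lt_trans x2)// oppr_lt0.
  - by rewrite (le_trans hme).
  - by [].
  rewrite (@goursat _ F e h (- h) h); first last.
  - move=> x y /andP[x1 x2] _; apply: dF; apply: nz2; rewrite gt_eqF//.
    by rewrite (lt_le_trans e0).
  - by rewrite (le_trans hme).
  - by [].
  rewrite (@goursat _ F (- e) e (- h) (- e)); first last.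
  - move=> x y _ /andP[x1 x2]; apply: dF; apply: nz1; rewrite lt_eqF//.
    by rewrite (le_lt_trans x2)// oppr_lt0.
  - by [].
  - by [].
  rewrite (@goursat _ F (- e) e e h); first last.
  - move=> x y _ /andP[x1 x2]; apply: dF; apply: nz1; rewrite gt_eqF//.
    by rewrite (lt_le_trans e0).
  - by [].
  - by [].
  by rewrite !add0r !addr0.
have large : abs (rint F (- h) h (- h) h) <= 64 * M / r.
  have [nh ph] : - h != 0 /\ h != 0 by rewrite oppr_eq0 !gt_eqF.
  have bF w : abs w <= r -> h <= abs w -> abs (F w) <= 2 * M / h ^+ 2.
    move=> wr hw; rewrite /F !absM absV -!invfM.
    have w0 : 0 < abs w by rewrite (lt_le_trans h0).
    apply: ler_pM; rewrite ?abs_ge0 ?invr_ge0 ?mulr_ge0 ?abs_ge0//.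
      rewrite /G (le_trans (absB _ _))// mulr_natl mulr2n lerD// gM//.
      by rewrite abs0 ltW.
    by rewrite lef_pV2 ?posrE ?mulr_gt0// ler_pM// ltW.
  have -> : 64 * M / r = 16 * (2 * M / h ^+ 2) * h by rewrite /h; field; rewrite gt_eqF.
  apply: (rint_square_le (ltW h0) (rF _ _ _ _ nh ph nh ph)) => w hw wh.
  by apply: bF => //; rewrite (le_trans wh)// /h mulrC divfK.
suff small (e : R) : 0 < e -> 4 * abs l <= 64 * M / r + 16 * e.
  have : 4 * abs l <= 64 * M / r.
    apply/ler_addgt0Pr => e e0; have e16 : 0 < e / 16 by rewrite divr_gt0.
    by have := small _ e16; rewrite mulrCA divff ?mulr1.
  clear; set m := M / r; rewrite -!(mulrA _ M) -/m; lra.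
move=> e0; have [dl dl0 H] := dg e e0.
pose t := Num.min h (dl / 4).
have t0 : 0 < t by rewrite lt_min h0 divr_gt0.
have th : t <= h by rewrite ge_min lexx.
have td : 2 * t < dl.
  have : t <= dl / 4 by rewrite ge_min lexx orbT.
  by clear -dl0; lra.
(* What is left of [F] after removing the pole is the first-order remainder of [g] divided by
   [w ^+ 2], hence at most [e / abs w]. *)
pose K w := F w - l * w^-1.
have cinv w : w != 0 -> ccont (fun w : C => w^-1) w.
  move=> w0; have /derivable_cderiv[m /cderiv_ccont//] :
      derivable (fun w : C^o => (w^-1 : C^o)) w 1.
  by apply: derivableV.
have [nt pt] : - t != 0 /\ t != 0 by rewrite oppr_eq0 !gt_eqF.
have rI : rcont (fun w : C => l * w^-1) (- t) t (- t) t.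
  by split => x _; split; apply/ccontZ/cinv; by [apply: nz1|apply: nz2].
have rV : rcont (fun w : C => w^-1) (- t) t (- t) t.
  by split => x _; split; apply/cinv; by [apply: nz1|apply: nz2].
have rK : rcont K (- t) t (- t) t.
  have -> : K = fun w => F w + (- l) * w^-1.
    by apply/funext => w; rewrite mulNr.
  have cK w : w != 0 -> ccont (fun w => F w + (- l) * w^-1) w.
    by move=> w0; apply: ccontD; [exact: cF|exact/ccontZ/cinv].
  by split => x _; split; apply: cK; by [apply: nz1|apply: nz2].
have FE : F = fun w => K w + l * w^-1 by apply/funext => w; rewrite /K subrK.
move: large; rewrite (shrink _ t0 th) {1}FE (rintD rK rI) (rintZ _ rV).
set k := rint (fun w : C => w^-1) _ _ _ _.
have k4 : 4 <= abs k by exact: abs_rint_inv.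
have bK w : t <= abs w -> abs w <= 2 * t -> abs (K w) <= e / t.
  move=> tw wt; have w0 : 0 < abs w by rewrite (lt_le_trans t0).
  have wn0 : w != 0 by rewrite -abs_gt0.
  have -> : K w = (g (0 + w) - g 0 - w * l) * (w^-1 * w^-1).
    by rewrite /K /F /G add0r; field.
  rewrite !absM absV.
  apply: (@le_trans _ _ (e * abs w * ((abs w)^-1 * (abs w)^-1))).
    rewrite ler_wpM2r ?mulr_ge0 ?invr_ge0 ?abs_ge0//.
    by apply: H; exact: le_lt_trans td.
  rewrite mulrA mulfK ?gt_eqF// ler_wpM2l ?(ltW e0)//.
  by rewrite lef_pV2.
have HK : abs (rint K (- t) t (- t) t) <= 16 * e.
  rewrite (_ : 16 * e = 16 * (e / t) * t); last by field; rewrite gt_eqF.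
  exact: rint_square_le (ltW t0) rK bK.
move=> HL.
have : abs (l * k) <= 64 * M / r + 16 * e.
  have -> : l * k = rint K (- t) t (- t) t + l * k - rint K (- t) t (- t) t.
    by rewrite addrC addKr.
  by rewrite (le_trans (absB _ _))// lerD.
apply: le_trans; rewrite absM mulrC ler_wpM2l ?abs_ge0//.
Qed.

End cauchy.

(** * Growth and Taylor estimates *)

Section growth.
Context {R : realType}.
Local Notation C := R[i].

Lemma is_derive_eps (f : R -> R) (t l : R) :
  (forall e : R, 0 < e -> exists2 dl : R, 0 < dl & forall s : R, `|s| < dl ->
     `|f (t + s) - f t - s * l| <= e * `|s|) -> is_derive t 1 f l.
Proof.
move=> h.
have cl : (fun h : R => h^-1 *: (f (h *: 1 + t) - f t)) @ 0^' --> l.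
  apply/cvgrPdist_le => e e0; have [dl dl0 H] := h _ e0.
  apply/nbhs_ballP; exists dl => // s /=; rewrite /ball/= sub0r normrN => sd s0.
  rewrite -(ler_pM2r (_ : 0 < `|s|)) ?normr_gt0//.
  rewrite -normrM; apply: le_trans (H s sd).
  rewrite -normrN; apply: le_eq; congr `|_|.
  rewrite /GRing.scale/= mulr1 (addrC s t) mulrBl mulrAC mulVf// mul1r.
  by ring.
split; first by apply/cvg_ex; exists l.
by rewrite /derive (cvg_lim _ cl).
Qed.

Lemma within_continuous_eps (f : R -> R) (a b : R) :
  (forall t, a <= t <= b -> forall e : R, 0 < e -> exists2 dl : R, 0 < dl &
     forall s, a <= s <= b -> `|s - t| < dl -> `|f s - f t| <= e) ->
  {within `[a, b], continuous f}.
Proof.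
move=> h; apply/subspace_continuousP => t /=; rewrite in_itv/= => tab.
apply/cvgrPdist_le => e e0; have [dl dl0 H] := h t tab e e0.
rewrite /nbhs/= /within/=; apply/nbhs_ballP; exists dl => // s /=.
rewrite /ball/= in_itv/= => ts sab; rewrite distrC; apply: H => //.
by rewrite distrC.
Qed.

Definition rderiv (u : R -> C) (t : R) (l : C) := forall e : R, 0 < e ->
  exists2 dl : R, 0 < dl & forall s : R, `|s| < dl ->
    abs (u (t + s) - u t - s%:C * l) <= e * `|s|.

(** For a real-linear [f] dominated by the modulus, the mean value theorem applied to [V - f \o u]
    shows that it increases. Choosing [f] as the real part after a rotation that makes [u b - u a]
    positive transfers this to the modulus without loss. *)
Lemma growth (u : R -> C) (V v : R -> R) (a b : R) : a <= b ->
  (forall t, a <= t <= b -> forall e : R, 0 < e -> exists2 dl : R, 0 < dl &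
     forall s, a <= s <= b -> `|s - t| < dl -> abs (u s - u t) <= e) ->
  (forall t, a < t < b -> exists2 l, abs l <= v t & rderiv u t l) ->
  (forall t : R, is_derive t 1 V (v t)) ->
  abs (u b - u a) <= V b - V a.
Proof.
move=> ab uc ud dV.
have key (f : C -> R) : (forall x y, f (x + y) = f x + f y) ->
    (forall x, f (- x) = - f x) ->
    (forall (k : R) x, f (k%:C * x) = k * f x) ->
    (forall x, `|f x| <= abs x) -> f (u b - u a) <= V b - V a.
  move=> fD fN fZ fle.
  pose dl t := xget 0 [set l | abs l <= v t /\ rderiv u t l].
  have dlP t : a < t < b -> abs (dl t) <= v t /\ rderiv u t (dl t).
    move=> tab; rewrite /dl; case: xgetP => [y -> //|nex].
    by have [l l1 l2] := ud t tab; case: (nex l).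
  have dh t : t \in `]a, b[%R ->
      is_derive t 1 ((V : R -> R) - (f \o u)) (v t - f (dl t)).
    rewrite in_itv/= => tab; have [_ dut] := dlP t tab.
    have ? : is_derive t 1 (f \o u) (f (dl t)).
      apply: is_derive_eps => e e0; have [d d0 H] := dut e e0.
      exists d => // s sd; rewrite /= -fZ -!fN -!fD.
      by rewrite (le_trans (fle _))// H.
    by apply: is_deriveB.
  have ch : {within `[a, b], continuous ((V : R -> R) - (f \o u))}.
    apply: within_continuous_eps => t tab e e0.
    have e2 : 0 < e / 2 by rewrite divr_gt0.
    have [d d0 H] := uc t tab _ e2.
    have : V x @[x --> t] --> V t.
      by have [/derivable1_diffP/differentiable_continuous + _] := dV t; exact.
    move=> /cvgrPdist_le/(_ _ e2)/nbhs_ballP[d' /= d'0 H'].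
    exists (Num.min d d'); first by rewrite lt_min d0.
    move=> s sab; rewrite lt_min => /andP[sd sd'].
    rewrite -[X in `|X|]/((V s - f (u s)) - (V t - f (u t))).
    rewrite (_ : _ - _ = (V s - V t) - (f (u s) - f (u t))); last by ring.
    rewrite (le_trans (ler_normB _ _))// (splitr e) lerD//.
      by rewrite distrC; apply: H'; rewrite /ball/= distrC.
    by rewrite -fN -fD (le_trans (fle _))// H.
  have [ltab|] := ltP a b; last first.
    move=> ba; have -> : b = a by apply/eqP; rewrite eq_le ba ab.
    by rewrite !subrr; have := fZ 0 0; rewrite mulr0 mul0r => ->.
  have [c cab /eqP] := MVT ltab dh ch.
  rewrite -[X in X == _]/((V b - f (u b)) - (V a - f (u a))) => /eqP E.
  have : 0 <= (v c - f (dl c)) * (b - a).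
    rewrite mulr_ge0 ?subr_ge0//; move: cab; rewrite in_itv/= => /dlP[+ _].
    by apply: le_trans; rewrite (le_trans (ler_norm _)).
  by rewrite -E fD fN; clear; lra.
set w := u b - u a in key *; have [w0|w0] := eqVneq w 0.
  by rewrite w0 abs0 (key (fun=> 0))// => *; rewrite ?addr0 ?oppr0 ?mulr0 ?normr0 ?abs_ge0.
have aw : 0 < abs w by rewrite abs_gt0.
(* A number of modulus one that rotates [w] onto the positive axis. *)
pose c := w^-1 * (abs w)%:C.
have -> : abs w = complex.Re (c * w) by rewrite /c mulrAC mulVf// mul1r.
apply: (key (fun x => complex.Re (c * x))) => [x y|x|k x|x].
- by rewrite mulrDr cReD.
- by rewrite mulrN cReN.
- by rewrite mulrCA [LHS]cReM /= mul0r subr0.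
- rewrite (le_trans (ler_Re_abs _))// absM /c absM absV abs_real gtr0_norm//.
  by rewrite mulVf ?mul1r// gt_eqF.
Qed.

Lemma growth_cst (u du : R -> C) (K : R) (b : R) : 0 <= b ->
  (forall t, 0 <= t <= b -> rderiv u t (du t)) ->
  (forall t, 0 <= t <= b -> abs (du t) <= K) ->
  abs (u b - u 0) <= K * b.
Proof.
move=> b0 ud uK.
have := @growth u (fun t => K * t) (fun=> K) 0 b b0.
rewrite mulr0 subr0; apply.
- move=> t tb e e0; have [dl dl0 H] := ud t tb 1 ltr01.
  have K0 : 0 < 1 + abs (du t) by rewrite ltr_pwDl// abs_ge0.
  exists (Num.min dl (e / (1 + abs (du t)))).
    by rewrite lt_min dl0 divr_gt0.
  move=> s sb; rewrite lt_min => /andP[sd se].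
  have := H _ sd; rewrite [t + _]addrC subrK mul1r => {}H.
  have -> : u s - u t = (u s - u t - (s - t)%:C * du t) + (s - t)%:C * du t.
    by rewrite subrK.
  rewrite (le_trans (absD _ _))// absM abs_real.
  apply: (@le_trans _ _ (`|s - t| * (1 + abs (du t)))).
    by rewrite mulrDr mulr1 lerD2r.
  by rewrite -ler_pdivlMr// ltW.
- move=> t /andP[/ltW t0 /ltW tb]; have tt : 0 <= t <= b by rewrite t0.
  by exists (du t); [exact: uK|exact: ud].
- move=> t; have := @is_deriveZ _ _ _ id K t 1 1 (is_derive_id _ _).
  by rewrite /GRing.scale/= mulr1.
Qed.

End growth.

(** * Second-order estimates and limits of holomorphic functions *)

Section taylor.
Context {R : realType}.
Local Notation C := R[i].
Implicit Types (f g : C -> C) (a l s w : C).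

Lemma cauchy_estimate g a l (r M : R) : holo g -> 0 < r ->
  (forall w, abs (w - a) <= r -> abs (g w) <= M) -> cderiv g a l ->
  abs l <= 16 * M / r.
Proof.
move=> hg r0 gM dg.
apply: (@cauchy_at0 R (fun w => g (a + w)) l r M) => //.
- exact: holo_shift.
- by move=> w wr; apply: gM; rewrite addrAC subrr add0r.
- by apply/cderiv_shift; rewrite addr0.
Qed.

Lemma cderiv_line g a s l (t : R) : cderiv g (a + t%:C * s) l ->
  rderiv (fun t => g (a + t%:C * s)) t (s * l).
Proof.
move=> dg e e0; have K0 : 0 < 1 + abs s by rewrite ltr_pwDl// abs_ge0.
have [dl dl0 H] := dg _ (divr_gt0 e0 K0).
exists (dl / (1 + abs s)); first by rewrite divr_gt0.
move=> h; rewrite ltr_pdivlMr// => hd.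
have hs : abs (h%:C * s) < dl.
  by rewrite absM abs_real (le_lt_trans _ hd)// ler_wpM2l// lerDr.
have := H _ hs.
have -> : a + t%:C * s + h%:C * s = a + (t + h)%:C * s.
  by rewrite (rmorphD (@real_complex R)) /=; ring.
rewrite -mulrA => /le_trans; apply; rewrite absM abs_real.
rewrite [leLHS](_ : _ = e * `|h| * (abs s / (1 + abs s))); last by ring.
by rewrite ler_piMr ?mulr_ge0 ?(ltW e0)// ler_pdivrMr// mul1r lerDr.
Qed.

(** Discs of radius [r / 2] about points of the segment from [a] to [a + s] stay in the disc of
    radius [r], so Cauchy's estimate bounds the derivative there by [16 * M / (r / 2)]. *)
Lemma lipschitz_estimate g a s (r M : R) : holo g -> 0 < r ->
  (forall w, abs (w - a) <= r -> abs (g w) <= M) -> abs s <= r / 2 ->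
  abs (g (a + s) - g a) <= 32 * M / r * abs s.
Proof.
move=> hg r0 gM sr.
have [dg dgP] : {dg : C -> C | forall w, cderiv g w (dg w)}.
  by exists (fun w => sval (cid (hg w))) => w; case: cid.
have dgM w : abs (w - a) <= r / 2 -> abs (dg w) <= 32 * M / r.
  move=> wr; have -> : 32 * M / r = 16 * M / (r / 2).
    by field; rewrite gt_eqF.
  apply: (@cauchy_estimate g w) => //; first by rewrite divr_gt0.
  move=> w' w'r; apply: gM.
  have -> : w' - a = (w' - w) + (w - a) by ring.
  by rewrite (le_trans (absD _ _))// (splitr r) lerD.
have := @growth_cst R (fun t => g (a + t%:C * s)) (fun t => s * dg (a + t%:C * s))
  (abs s * (32 * M / r)) 1 ler01.
rewrite mul1r mul0r addr0 => /(_ _ _)/le_trans; apply.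
- by move=> t _; apply: cderiv_line.
- move=> t /andP[t0 t1]; rewrite absM ler_wpM2l ?abs_ge0// dgM//.
  rewrite addrAC subrr add0r absM abs_real ger0_norm//.
  by rewrite (le_trans _ sr)// ler_piMl// abs_ge0.
- by apply: le_eq; ring.
Qed.

(** The derivative is shown to be Lipschitz without differentiating it: [dg (a + h) - dg a] is the
    derivative at [a] of [w |-> g (h + w) - g w], which the Lipschitz estimate bounds by
    [64 * M / r * abs h] on radius [r / 2]. Cauchy's estimate there gives 16 * 64 * 2 = 2048. *)
Lemma taylor2_estimate g a s l (r M : R) : holo g -> 0 < r ->
  (forall w, abs (w - a) <= r -> abs (g w) <= M) -> abs s <= r / 4 ->
  cderiv g a l ->
  abs (g (a + s) - g a - s * l) <= 2048 * M / r ^+ 2 * abs s ^+ 2.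
Proof.
move=> hg r0 gM sr dga.
have [dg dgP] : {dg : C -> C | forall w, cderiv g w (dg w)}.
  by exists (fun w => sval (cid (hg w))) => w; case: cid.
have El : l = dg a by exact: cderiv_uniq (dgP a).
have dgL h : abs h <= r / 4 -> abs (dg (a + h) - dg a) <= 2048 * M / r ^+ 2 * abs h.
  move=> hr; pose q w := g (h + w) - g w.
  have hq : holo q by apply: holoB => //; exact: holo_shift.
  have dq : cderiv q a (dg (a + h) - dg a).
    by apply: cderivB => //; apply/cderiv_shift; rewrite addrC.
  have -> : 2048 * M / r ^+ 2 * abs h = 16 * (32 * M / (r / 2) * abs h) / (r / 2).
    by field; rewrite gt_eqF.
  apply: (cauchy_estimate hq _ _ dq); first by rewrite divr_gt0.
  move=> w wr; rewrite /q addrC.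
  rewrite addrC (addrC h).
  apply: lipschitz_estimate => //; first by rewrite divr_gt0.
    move=> w' w'r; apply: gM.
    have -> : w' - a = (w' - w) + (w - a) by ring.
    by rewrite (le_trans (absD _ _))// (splitr r) lerD.
  by rewrite (le_trans hr)//; apply: le_eq; field.
have L0 : 0 <= 2048 * M / r ^+ 2.
  apply: divr_ge0; last exact/exprn_ge0/ltW.
  apply: mulr_ge0; first exact: ler0n.
  by apply: le_trans (abs_ge0 (g a)) (gM _ _); rewrite subrr abs0 ltW.
pose u (t : R) := g (a + t%:C * s) - t%:C * (s * l).
have := @growth_cst R u (fun t => s * dg (a + t%:C * s) - s * l)
  (abs s * (2048 * M / r ^+ 2 * abs s)) 1 ler01.
have -> : u 1 - u 0 = g (a + s) - g a - s * l.
  by rewrite /u !mul1r !mul0r addr0 subr0; ring.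
move=> /(_ _ _)/le_trans; apply.
- move=> t _ e e0.
  have [dl dl0 H] := @cderiv_line g a s _ t (dgP _) e e0.
  exists dl => // h hd; apply: le_trans (H h hd).
  apply: le_eq; congr (abs _).
  by rewrite /u (rmorphD (@real_complex R)) /=; ring.
- move=> t /andP[t0 t1]; rewrite -mulrBr absM ler_wpM2l ?abs_ge0// El.
  have ts : abs (t%:C * s) <= abs s.
    by rewrite absM abs_real ger0_norm// ler_piMl// abs_ge0.
  by rewrite (le_trans (dgL _ (le_trans ts sr)))// ler_wpM2l.
- apply: le_eq; field.
  by rewrite gt_eqF.
Qed.

(** Two difference quotients compared after cross-multiplication. The derivative has disappeared
    from the inequality, which therefore survives pointwise limits and integration over a
    parameter. *)
Lemma quotient_estimate g a s s' (r M : R) : holo g -> 0 < r ->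
  (forall w, abs (w - a) <= r -> abs (g w) <= M) ->
  abs s <= r / 4 -> abs s' <= r / 4 ->
  abs (s' * (g (a + s) - g a) - s * (g (a + s') - g a)) <=
    2048 * M / r ^+ 2 * (abs s * abs s' * (abs s + abs s')).
Proof.
move=> hg r0 gM sr s'r; have [l dg] := hg a.
have h1 := taylor2_estimate hg r0 gM sr dg.
have h2 := taylor2_estimate hg r0 gM s'r dg.
have -> : s' * (g (a + s) - g a) - s * (g (a + s') - g a) =
    s' * (g (a + s) - g a - s * l) - s * (g (a + s') - g a - s' * l) by ring.
rewrite (le_trans (absB _ _))// !absM.
set K := 2048 * M / r ^+ 2 in h1 h2 *.
apply: (@le_trans _ _ (abs s' * (K * abs s ^+ 2) + abs s * (K * abs s' ^+ 2))).
  by rewrite lerD// ler_wpM2l ?abs_ge0.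
by apply: le_eq; ring.
Qed.

(** Converse direction: the compared quotients form a Cauchy family as [s] tends to 0. The limit is
    taken along positive real increments, and a general [s] is then compared with its modulus. *)
Lemma quotient_cderiv g a (dl K : R) : 0 < dl ->
  (forall s s', abs s < dl -> abs s' < dl ->
    abs (s' * (g (a + s) - g a) - s * (g (a + s') - g a)) <=
      K * (abs s * abs s' * (abs s + abs s'))) ->
  exists l, cderiv g a l.
Proof.
move=> dl0 H.
have K0 : 0 <= K.
  have d2 : 0 < dl / 2 by rewrite divr_gt0.
  have d2l : abs (dl / 2)%:C < dl.
    by rewrite abs_real gtr0_norm// ltr_pdivrMr// ltr_pMr// ltr1n.
  have := le_trans (abs_ge0 _) (H _ _ d2l d2l).
  rewrite pmulr_lge0// abs_real gtr0_norm// !mulr_gt0// addr_gt0//.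
pose q s := s^-1 * (g (a + s) - g a).
have qL s s' : s != 0 -> s' != 0 -> abs s < dl -> abs s' < dl ->
    abs (q s - q s') <= K * (abs s + abs s').
  move=> s0 s'0 sd s'd.
  have p0 : 0 < abs s * abs s' by rewrite mulr_gt0// abs_gt0.
  rewrite -(ler_pM2l p0) -!absM.
  have -> : s * s' * (q s - q s') = s' * (g (a + s) - g a) - s * (g (a + s') - g a).
    by rewrite /q; field; rewrite s0 s'0.
  by rewrite (le_trans (H _ _ sd s'd))// absM mulrCA.
(* Every [f t' - K * t'] lies below every [f t + K * t], so the supremum of the former is a limit
   with an explicit rate. *)
have limit (f : R -> R) : (forall t t', 0 < t < dl -> 0 < t' < dl ->
    `|f t - f t'| <= K * (t + t')) ->
    exists L, forall t, 0 < t < dl -> `|f t - L| <= K * t.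
  move=> fL; pose A := [set f t - K * t | t in [set t | 0 < t < dl]].
  have ub t : 0 < t < dl -> ubound A (f t + K * t).
    move=> td _ [t' t'd <-]; have := fL _ _ t'd td.
    by rewrite ler_norml => /andP[_]; clear; lra.
  have d2 : 0 < dl / 2 < dl.
    by rewrite divr_gt0// ltr_pdivrMr// ltr_pMr// ltr1n.
  have sA : has_sup A.
    split; first by exists (f (dl / 2) - K * (dl / 2)), (dl / 2).
    by exists (f (dl / 2) + K * (dl / 2)); exact: ub.
  exists (sup A) => t td.
  have h1 : f t - K * t <= sup A by apply: sup_upper_bound => //; exists t.
  have h2 : sup A <= f t + K * t by apply: sup_le_ub (ub _ td); case: sA.
  by rewrite ler_norml; apply/andP; split; clear -h1 h2; lra.
have r0 (t : R) : 0 < t < dl -> (t%:C : C) != 0 /\ abs (t%:C : C) < dl.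
  move=> /andP[t0 td]; rewrite abs_real gtr0_norm// td; split => //.
  by rewrite -abs_gt0 abs_real normr_gt0 gt_eqF.
have qt (t t' : R) : 0 < t < dl -> 0 < t' < dl ->
   abs (q t%:C - q t'%:C) <= K * (t + t').
  move=> td t'd; have [t0 tl] := r0 _ td; have [t'0 t'l] := r0 _ t'd.
  have := qL _ _ t0 t'0 tl t'l; rewrite !abs_real.
  by case/andP: td => td _; case/andP: t'd => t'd _; rewrite !gtr0_norm.
have [|L1 L1P] := limit (fun t => complex.Re (q t%:C)) _.
  by move=> t t' td t'd; rewrite -cReN -cReD (le_trans (ler_Re_abs _))// qt.
have [|L2 L2P] := limit (fun t => complex.Im (q t%:C)) _.
  by move=> t t' td t'd; rewrite -cImN -cImD (le_trans (ler_Im_abs _))// qt.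
exists (L1 +i* L2) => e e0.
have K1 : 0 < 4 * K + 1 by rewrite ltr_pwDr// mulr_ge0.
exists (Num.min dl (e / (4 * K + 1))); first by rewrite lt_min dl0 divr_gt0.
move=> s; rewrite lt_min => /andP[sd se].
have [->|s0] := eqVneq s 0; first by rewrite addr0 subrr mul0r subrr abs0 mulr0.
have as0 : 0 < abs s by rewrite abs_gt0.
have asd : 0 < abs s < dl by rewrite as0.
have [t0 tl] := r0 _ asd.
have -> : g (a + s) - g a - s * (L1 +i* L2) = s * (q s - (L1 +i* L2)).
  by rewrite /q; field.
rewrite absM mulrC ler_wpM2r ?abs_ge0//.
have -> : q s - (L1 +i* L2) = (q s - q (abs s)%:C) + (q (abs s)%:C - (L1 +i* L2)).
  by ring.
rewrite (le_trans (absD _ _))//.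
have h1 := qL _ _ s0 t0 sd tl.
rewrite abs_real (gtr0_norm as0) in h1.
have h2 : abs (q (abs s)%:C - (L1 +i* L2)) <= K * abs s + K * abs s.
  rewrite (le_trans (abs_le_ReIm _))// lerD//.
    by rewrite cReD cReN /= L1P.
  by rewrite cImD cImN /= L2P.
rewrite (le_trans (lerD h1 h2))//.
rewrite [leLHS](_ : _ = 4 * K * abs s); last by ring.
rewrite (@le_trans _ _ ((4 * K + 1) * abs s))//; last by rewrite mulrC -ler_pdivlMr// ltW.
by rewrite ler_wpM2r ?abs_ge0// lerDl.
Qed.

Definition clim (u : nat -> C) l := forall e : R, 0 < e ->
  exists N, forall n, (N <= n)%N -> abs (u n - l) <= e.

Lemma clim_abs_le u l (B : R) : clim u l -> (forall n, abs (u n) <= B) -> abs l <= B.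
Proof.
move=> ul uB; apply/ler_addgt0Pr => e e0; have [N H] := ul e e0.
have -> : l = u N - (u N - l) by ring.
by rewrite (le_trans (absB _ _))// lerD// H.
Qed.

Lemma climD u v l m : clim u l -> clim v m -> clim (fun n => u n + v n) (l + m).
Proof.
move=> ul vm e e0; have e2 : 0 < e / 2 by rewrite divr_gt0.
have [N1 H1] := ul _ e2; have [N2 H2] := vm _ e2.
exists (maxn N1 N2) => n; rewrite geq_max => /andP[n1 n2].
have -> : u n + v n - (l + m) = (u n - l) + (v n - m) by ring.
by rewrite (le_trans (absD _ _))// (splitr e) lerD ?H1 ?H2.
Qed.

Lemma climZ u l (k : C) : clim u l -> clim (fun n => k * u n) (k * l).
Proof.
move=> ul e e0; have K0 : 0 < 1 + abs k by rewrite ltr_pwDl// abs_ge0.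
have [N H] := ul _ (divr_gt0 e0 K0); exists N => n Nn.
rewrite -mulrBr absM; apply: (@le_trans _ _ ((1 + abs k) * (e / (1 + abs k)))).
  by rewrite ler_pM ?abs_ge0 ?H// lerDr.
by rewrite mulrC divfK// gt_eqF.
Qed.

Lemma climB u v l m : clim u l -> clim v m -> clim (fun n => u n - v n) (l - m).
Proof.
move=> ul /(climZ (-1)) vm; have := climD ul vm; rewrite mulN1r.
by under eq_fun do rewrite mulN1r.
Qed.

Lemma clim_uniq u l m : clim u l -> clim u m -> l = m.
Proof.
move=> ul um; apply: subr0_eq; apply: abs_le_small => e e0.
apply: (clim_abs_le (climB ul um)) => n; rewrite subrr abs0 ltW//.
Qed.

(** Pointwise convergence is enough because the terms are bounded on discs uniformly in [n]: this
    bound alone fixes the constant of the quotient estimate on the unit disc about [a], and the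
    estimate passes to the limit. *)
Lemma holo_clim (u : nat -> C -> C) g :
  (forall n, holo (u n)) ->
  (forall r : R, exists M : R, forall n w, abs w <= r -> abs (u n w) <= M) ->
  (forall w, clim (fun n => u n w) (g w)) -> holo g.
Proof.
move=> hu uM ug a; have [M HM] := uM (abs a + 1).
apply: (@quotient_cderiv g a (1 / 4) (2048 * M / 1 ^+ 2)) => // s s' sr s'r.
apply: (@clim_abs_le (fun n => s' * (u n (a + s) - u n a) - s * (u n (a + s') - u n a))).
  by apply: climB; apply: climZ; apply: climB.
move=> n; apply: quotient_estimate => //; rewrite ?(ltW sr) ?(ltW s'r)//.
move=> w wa; apply: HM; rewrite -{1}(subrK a w) addrC (le_trans (absD _ _))//.
by rewrite lerD2l.
Qed.

End taylor.

(** * The dual of L^1 *)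

Section l1_tools.
Context d (T : measurableType d) {R : realType}.
Variable mu : {measure set T -> \bar R}.

Lemma dominated_L1 (f G : T -> R) (u : nat -> T -> R) :
  (forall n, measurable_fun setT (u n)) -> measurable_fun setT f ->
  mu.-integrable setT (EFin \o G) -> (forall n x, `|u n x| <= G x) ->
  (forall x, u n x @[n --> \oo] --> f x) ->
  ((\int[mu]_x `|(u n x - f x)%:E|) @[n --> \oo] --> 0)%E.
Proof.
move=> mu_ mf iG uG uf.
have := @dominated_convergence _ _ _ mu setT measurableT (fun n x => (u n x)%:E)
  (EFin \o f) (EFin \o G).
case.
- by move=> n; exact/measurable_EFinP.
- exact/measurable_EFinP.
- by apply: aeW => x _; apply: cvg_EFin; [exact: nearW|exact: uf].
- exact: iG.
- by apply: aeW => x n _; rewrite /= lee_fin.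
by move=> _ + _; under eq_fun do under eq_integral do rewrite -EFinB.
Qed.

Lemma ae_le0_of_integral (a : T -> R) : mu.-integrable setT (EFin \o a) ->
  (forall A, measurable A -> \int[mu]_(x in A) a x <= 0) ->
  {ae mu, forall x, a x <= 0}.
Proof.
move=> ia aA.
have ma : measurable_fun setT a by apply/measurable_EFinP; exact: measurable_int ia.
pose N := [set x | 0 < a x].
have mN : measurable N.
  rewrite -[N]setTI; rewrite (_ : N = a @^-1` `]0, +oo[%classic).
    by apply: ma => //; exact: measurable_itv.
  by apply/seteqP; split => x /=; rewrite in_itv/= andbT.
have iaN : mu.-integrable N (EFin \o a) by apply: integrableS ia.
have aN0 : (\int[mu]_(x in N) `|(a x)%:E| = 0)%E.
  apply/eqP; rewrite eq_le integral_ge0// andbT.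
  have -> : (\int[mu]_(x in N) `|(a x)%:E| = \int[mu]_(x in N) (a x)%:E)%E.
    by apply: eq_integral => x; rewrite inE => /ltW Nx; rewrite gee0_abs// lee_fin.
  by rewrite -[leLHS]fineK ?lee_fin ?aA//; exact: integrable_fin_num.
have := (ae_eq_integral_abs mu mN (measurable_int mu iaN)).1 aN0.
apply: filterS => x /= Nx; rewrite leNgt; apply/negP => ax.
by have [] := Nx ax => a0; rewrite a0 ltxx in ax.
Qed.

End l1_tools.

Section l1_dual.
Context d (T : measurableType d) {R : realType}.
Variable mu : {sigma_finite_measure set T -> \bar R}.

(** The sum of [c n] times the indicators of sets of finite measure exhausting the space, with [c n]
    so small that both the sum and its integral are at most 1. With this weight a functional on L^1
    yields a finite charge on all measurable sets. *)
Lemma positive_weight : exists w : T -> R,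
  [/\ measurable_fun setT w, (forall x, 0 < w x) & mu.-integrable setT (EFin \o w)].
Proof.
have [F FT mF] := sigma_finiteT mu.
pose c n : R := (1 / (2 ^ n.+1)%:R) / (1 + fine (mu (F n))).
have p0 n : 0 < 1 + fine (mu (F n)) by rewrite ltr_pwDl// fine_ge0.
have c0 n : 0 < c n by rewrite divr_gt0// divr_gt0// ltr0n expn_gt0.
have c1 n : c n <= 1 / (2 ^ n.+1)%:R.
  by rewrite /c ler_pdivrMr// ler_pMr ?lerDl ?fine_ge0// divr_gt0// ltr0n expn_gt0.
pose f n x : \bar R := (c n * \1_(F n) x)%:E.
have f0 n x : (0 <= f n x)%E by rewrite lee_fin mulr_ge0// ?(ltW (c0 n)).
have mf n : measurable_fun setT (f n).
  apply/measurable_EFinP; apply: measurable_funM => //.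
  by apply: measurable_indic; have [] := mF n.
pose W x := (\sum_(n <oo) f n x)%E.
have W0 x : (0 <= W x)%E by apply: nneseries_ge0.
have W1 x : (W x <= 1)%E.
  apply: le_trans (epsilon_trick0 xpredT (ler01 : (0 : R) <= 1)).
  apply: lee_nneseries => // n _; rewrite lee_fin indicE.
  by case: (_ \in _); rewrite ?mulr1 ?c1// mulr0 divr_ge0.
have Wfin x : W x \is a fin_num.
  by rewrite ge0_fin_numE// (le_lt_trans (W1 x))// ltry.
have mW : measurable_fun setT W by apply: ge0_emeasurable_sum.
have iW : (\int[mu]_x W x <= 1)%E.
  rewrite integral_nneseries//.
  apply: le_trans (epsilon_trick0 xpredT (ler01 : (0 : R) <= 1)).
  apply: lee_nneseries => [n _ _|n _]; first by rewrite integral_ge0.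
  have [mFn Fnfin] := mF n.
  rewrite /f; under eq_integral do rewrite EFinM.
  rewrite ge0_integralZl//; last by rewrite lee_fin ltW.
    rewrite integral_indic// setIT.
    rewrite -[X in (_ * X)%E]fineK ?ge0_fin_numE// -EFinM lee_fin.
    rewrite /c mulrAC ler_pdivrMr// ler_wpM2l ?divr_ge0// lerDr//.
  by apply/measurable_EFinP; exact: measurable_indic.
exists (fine \o W); split.
- by apply: measurableT_comp.
- move=> x; have [n _ Fnx] : (\bigcup_n F n) x by rewrite -FT.
  rewrite /= fine_gt0//; apply/andP; split; last by rewrite (le_lt_trans (W1 x))// ltry.
  apply: (@lt_le_trans _ _ (f n x)).
    by rewrite lte_fin indicE mem_set// mulr1.
  rewrite /W (@nneseriesD1 R _ n xpredT)// leeDl// nneseries_ge0//.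
- apply/integrableP; split; first by apply/measurable_EFinP; apply: measurableT_comp.
  rewrite (le_lt_trans _ (ltry 1))// (le_trans _ iW)//.
  apply: le_eq; apply: eq_integral => x _.
  by rewrite -[X in `|X|%E]/((fine (W x))%:E) fineK// gee0_abs.
Qed.

Local Notation itg f := (mu.-integrable setT (EFin \o (f : T -> R))).

Section functional.
Implicit Types (f g h : T -> R) (A B : set T).
Variables (lam : (T -> R) -> R) (K : R).
Hypothesis K0 : 0 <= K.
Hypothesis lamD : forall f g, itg f -> itg g -> lam (fun x => f x + g x) = lam f + lam g.
Hypothesis lamZ : forall c f, itg f -> lam (fun x => c * f x) = c * lam f.
Hypothesis lamK : forall f, itg f -> `|lam f| <= K * \int[mu]_x `|f x|.

Let itgD f g : itg f -> itg g -> itg (fun x => f x + g x).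
Proof. by move=> h1 h2; exact: (integrableD measurableT h1 h2). Qed.

Let itgZ c f : itg f -> itg (fun x => c * f x).
Proof. by move=> h1; exact: (integrableZl measurableT c h1). Qed.

Let itg_meas f : itg f -> measurable_fun setT f.
Proof. by move=> h; apply/measurable_EFinP; exact: measurable_int h. Qed.

Let itg_le f g : measurable_fun setT f -> (forall x, `|f x| <= g x) -> itg g -> itg f.
Proof.
move=> mf fg; apply: le_integrable => //; first exact/measurable_EFinP.
by move=> x _; rewrite /= lee_fin (le_trans (fg x))// ler_norm.
Qed.

Let itgB f g : itg f -> itg g -> itg (fun x => f x - g x).
Proof. by move=> h1 h2; exact: (integrableB measurableT h1 h2). Qed.

Let itg0 : itg (fun=> 0).
Proof. exact: integrable0. Qed.

Variable w : T -> R.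
Hypothesis mw : measurable_fun setT w.
Hypothesis w0 : forall x, 0 < w x.
Hypothesis iw : itg w.

Let cut A x := \1_A x * w x.

Let cut_le A x : `|cut A x| <= w x.
Proof.
rewrite /cut indicE; case: (_ \in _); first by rewrite mul1r gtr0_norm.
by rewrite mul0r normr0 ltW.
Qed.

Let mcut A : measurable A -> measurable_fun setT (cut A).
Proof. by move=> mA; apply: measurable_funM => //; exact: measurable_indic. Qed.

Let icut A : measurable A -> itg (cut A).
Proof. by move=> mA; apply: (itg_le (mcut mA) (cut_le A)). Qed.

Let nu A : \bar R := (lam (cut A))%:E.

Let nu0 : nu set0 = 0%E.
Proof.
rewrite /nu; have -> : cut set0 = (fun=> 0) :> (T -> R).
  by apply/funext => x; rewrite /cut indic0 mul0r.
by have := lamZ 0 itg0; rewrite mul0r => ->; rewrite mul0r.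
Qed.

Let nuU A B : measurable A -> measurable B -> A `&` B = set0 ->
  lam (cut (A `|` B)) = lam (cut A) + lam (cut B).
Proof.
move=> mA mB AB; rewrite -lamD; [|exact: icut|exact: icut].
congr lam; apply/funext => x; rewrite /cut -mulrDl; congr (_ * _).
rewrite !indicE in_setU.
have : ~ (x \in A /\ x \in B).
  by rewrite !inE => -[xA xB]; have : (A `&` B) x by []; rewrite AB.
case: (x \in A); case: (x \in B) => //= h; rewrite ?addr0 ?add0r//.
by exfalso; apply: h.
Qed.

Let lamB f g : itg f -> itg g -> lam (fun x => f x - g x) = lam f - lam g.
Proof.
move=> hf hg; have h1 := itgZ (-1) hg.
rewrite -mulN1r -(lamZ (-1) hg) -lamD//.
by congr lam; apply/funext => x; rewrite mulN1r.
Qed.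

(** Cuts along partial unions converge in L^1, dominated by [w], and [lam] is continuous there.
    Dividing by [K + 1] covers the case [K = 0]. *)
Let nu_sigma_additive : semi_sigma_additive nu.
Proof.
move=> F mF tF mU.
have E n : (\sum_(0 <= i < n) nu (F i) = nu (\big[setU/set0]_(i < n) F i))%E.
  elim: n => [|n IH]; first by rewrite big_geq// big_ord0 nu0.
  rewrite big_nat_recr//= IH big_ord_recr/= /nu nuU//.
    by apply: bigsetU_measurable => i _; exact: mF.
  apply/seteqP; split => // x [].
  rewrite -bigcup_mkord => -[i /= lin Fix] Fnx.
  by move: lin; rewrite (tF i n I I (ex_intro _ x (conj Fix Fnx))) ltnn.
under eq_fun do rewrite E.
set U := \bigcup_n F n.
pose u n := cut (\big[setU/set0]_(i < n) F i).
have mUn n : measurable (\big[setU/set0]_(i < n) F i).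
  by apply: bigsetU_measurable => i _; exact: mF.
have := @dominated_L1 _ _ _ mu (cut U) w u (fun n => mcut (mUn n)) (mcut mU) iw
  (fun n => cut_le _).
move=> H.
have {}H : ((\int[mu]_x `|(u n x - cut U x)%:E|) @[n --> \oo] --> 0)%E.
  apply: H => x; apply/cvgrPdist_le => e e0.
  have [[N _ FNx]|nUx] := pselect (U x).
    exists N.+1 => // n /= Nn.
    have h1 : U x by exists N.
    have h2 : (\big[setU/set0]_(i < n) F i) x by rewrite -bigcup_mkord; exists N.
    by rewrite /u /cut !indicE !mem_set// subrr normr0 ltW.
  exists 0%N => // n _.
  have h2 : ~ (\big[setU/set0]_(i < n) F i) x.
    by rewrite -bigcup_mkord => -[i _ Fix]; apply: nUx; exists i.
  by rewrite /u /cut !indicE !memNset// subrr normr0 ltW.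
apply: cvg_EFin; first exact: nearW.
apply/cvgrPdist_le => e e0.
have K1 : 0 < K + 1 by rewrite ltr_pwDr.
have /fine_cvgP[_ /cvgrPdist_le/(_ (e / (K + 1)) (divr_gt0 e0 K1))] := H.
apply: filterS => n /=; rewrite sub0r normrN => Hn.
rewrite distrC -lamB; [|exact: icut (mUn n)|exact: icut mU].
rewrite (le_trans (lamK _))//; first exact: itgB (icut (mUn n)) (icut mU).
have {}Hn : \int[mu]_x `|cut (\big[setU/set0]_(i < n) F i) x - cut U x| <= e / (K + 1).
  by apply: le_trans Hn; rewrite /Rintegral /= ler_norm.
rewrite (@le_trans _ _ ((K + 1) * (e / (K + 1))))//.
  apply: ler_pM => //; first exact: Rintegral_ge0.
  by rewrite lerDl.
by rewrite mulrC divfK// gt_eqF.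
Qed.

Let nu_fin A : measurable A -> nu A \is a fin_num.
Proof. by []. Qed.

Lemma l1_density : exists k : T -> R, itg k /\
  forall A, measurable A -> lam (cut A) = \int[mu]_(x in A) k x.
Proof.
pose m := isCharge.Build _ _ _ nu nu0 nu_fin nu_sigma_additive.
pose nuc : {charge set T -> \bar R} := HB.pack nu m.
have dom : nuc `<< mu.
  move=> A nA B mB BA; rewrite /= /nu.
  have muB := nA B mB BA.
  apply/eqP; rewrite eqe -normr_eq0 eq_le normr_ge0 andbT.
  rewrite (le_trans (lamK (icut mB)))//.
  have -> : \int[mu]_x `|cut B x| = 0.
    rewrite /Rintegral.
    have -> : (\int[mu]_x (`|cut B x|)%:E = \int[mu]_(x in B) `|(cut B x)%:E|)%E.
      rewrite [RHS]integral_mkcond; apply: eq_integral => x _.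
      rewrite patchE; case: ifPn => // xB.
      by rewrite /cut indicE (negbTE xB) mul0r normr0.
    rewrite integral_abs_eq0//.
    by apply/measurable_EFinP; apply: measurable_funS (mcut mB).
  by rewrite mulr0.
pose k := fine \o Radon_Nikodym nuc mu.
have kE x : (k x)%:E = Radon_Nikodym nuc mu x.
  by rewrite /k /= fineK//; exact: Radon_Nikodym_fin_num.
have ik : itg k.
  apply: eq_integrable (Radon_Nikodym_integrable dom) => // x _.
  by rewrite /= kE.
exists k; split => // A mA.
have := Radon_Nikodym_integral dom mA; rewrite /Rintegral.
under [in X in _ -> X]eq_integral do rewrite kE.
by move=> <-.
Qed.

(** The representing function is the density [k] of the charge divided by [w]. The defect [D]
    between [lam] and integration against it is linear and bounded. It vanishes on every [cut A],
    hence on simple functions times [w], hence by density on nonnegative functions and then on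
    all. *)
Lemma l1_dual_weight : exists g : T -> R, [/\ measurable_fun setT g,
  (forall x, `|g x| <= K) & forall f, itg f -> lam f = \int[mu]_x (g x * f x)].
Proof.
have [k [ik kE]] := l1_density.
have mwV : measurable_fun setT (fun x => (w x)^-1).
  rewrite (_ : (fun x => (w x)^-1) = (fun x => powR (w x) (-1))).
    exact: (measurableT_comp (measurable_powR (-1)) mw).
  by apply/funext => x; rewrite powR_inv1// ltW.
have mk := itg_meas ik.
have cutA A : measurable A -> \int[mu]_x `|cut A x| = \int[mu]_(x in A) w x.
  move=> mA; rewrite [RHS]Rintegral_mkcond; apply: eq_Rintegral => x _.
  rewrite patchE /cut indicE; case: ifPn => _; rewrite ?mul1r ?mul0r ?normr0//.
  by rewrite gtr0_norm.
have sub (f : T -> R) A : measurable A -> itg f -> mu.-integrable A (EFin \o f).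
  by move=> mA; exact: (integrableS measurableT mA (@subsetT _ A)).
have lamcut A : measurable A -> `|lam (cut A)| <= K * \int[mu]_(x in A) w x.
  by move=> mA; rewrite (le_trans (lamK (icut mA)))// cutA.
have ub : {ae mu, forall x, k x - K * w x <= 0}.
  apply: ae_le0_of_integral; first exact: itgB ik (itgZ K iw).
  move=> A mA; rewrite RintegralB//; [|exact: sub|exact: sub (itgZ K iw)].
  rewrite RintegralZl//; last exact: sub.
  by rewrite subr_le0 -kE// (le_trans (ler_norm _))// lamcut.
have lb : {ae mu, forall x, (-1) * k x - K * w x <= 0}.
  apply: ae_le0_of_integral; first exact: itgB (itgZ (-1) ik) (itgZ K iw).
  move=> A mA; rewrite RintegralB//; [|exact: sub (itgZ _ ik)|exact: sub (itgZ K iw)].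
  rewrite !RintegralZl//; [|exact: sub|exact: sub].
  by rewrite subr_le0 mulN1r -kE// (le_trans (ler_norm _))// normrN lamcut.
(* Almost everywhere [k / w] already lies between [- K] and [K]; clipping changes it on a null set
   only and makes the bound hold at every point. *)
pose g x := Num.max (- K) (Num.min K (k x / w x)).
have mg : measurable_fun setT g.
  apply: measurable_maxr => //; apply: measurable_minr => //.
  exact: measurable_funM.
have gK x : `|g x| <= K.
  by rewrite ler_norml /g le_max lexx /= ge_max ge_min lexx (le_trans _ K0)//= oppr_le0.
exists g; split => //.
have igf f : itg f -> itg (fun x => g x * f x).
  move=> itf; apply: (@itg_le _ (fun x => K * `|f x|)).
  - by apply: measurable_funM => //; exact: itg_meas.
  - by move=> x; rewrite normrM ler_wpM2r.
  - by apply: itgZ; exact: integrable_norm.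
pose D f := lam f - \int[mu]_x (g x * f x).
have DD f h : itg f -> itg h -> D (fun x => f x + h x) = D f + D h.
  move=> itf ith; rewrite /D lamD//.
  have -> : \int[mu]_x (g x * (f x + h x)) = \int[mu]_x (g x * f x + g x * h x).
    by apply: eq_Rintegral => x _; rewrite mulrDr.
  by rewrite RintegralD//; [ring|exact: igf|exact: igf].
have DZ c f : itg f -> D (fun x => c * f x) = c * D f.
  move=> itf; rewrite /D lamZ//.
  have -> : \int[mu]_x (g x * (c * f x)) = \int[mu]_x (c * (g x * f x)).
    by apply: eq_Rintegral => x _; rewrite mulrCA.
  by rewrite RintegralZl//; [ring|exact: igf].
have DK f : itg f -> `|D f| <= 2 * K * \int[mu]_x `|f x|.
  move=> itf; rewrite /D (le_trans (ler_normB _ _))//.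
  rewrite -mulrA mulr_natl mulr2n lerD// ?lamK//.
  rewrite (le_trans (le_normr_Rintegral _ _))//; first exact: igf.
  rewrite -RintegralZl//; last exact: integrable_norm.
  apply: le_Rintegral => //; first exact/integrable_norm/igf.
    by apply: itgZ; exact: integrable_norm.
  by move=> x _; rewrite normrM ler_wpM2r.
have Dcut A : measurable A -> D (cut A) = 0.
  move=> mA; rewrite /D kE//; apply/eqP; rewrite subr_eq0; apply/eqP.
  have -> : \int[mu]_x (g x * cut A x) = \int[mu]_(x in A) (g x * w x).
    rewrite [RHS]Rintegral_mkcond; apply: eq_Rintegral => x _.
    by rewrite patchE /cut indicE; case: ifPn => _; rewrite ?mul1r ?mul0r ?mulr0.
  rewrite /Rintegral; congr fine; apply: ae_eq_integral => //.
  - by apply/measurable_EFinP; apply: measurable_funS mk.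
  - apply/measurable_EFinP; apply: measurable_funS (_ : measurable_fun setT _) => //.
    exact: measurable_funM.
  apply: filterS2 ub lb => x h1 h2 _; congr EFin.
  have h1' : k x / w x <= K by rewrite ler_pdivrMr// -subr_le0.
  have h2' : - K <= k x / w x.
    by rewrite ler_pdivlMr// mulNr lerNl -subr_le0 -mulN1r.
  by rewrite /g min_r// max_r// divfK// gt_eqF.
have Dsum (f : {nnsfun T >-> R}) : D (fun x => f x * w x) = 0.
  have [s sE] : exists s : seq R, forall x,
      f x = \sum_(i < size s) (s`_i * \1_(f @^-1` [set s`_i]) x).
    exists (finmap.enum_fset (fset_set (range f))) => x; exact: fimfunEord.
  pose A i := f @^-1` [set s`_i].
  have mA i : measurable (A i) by exact: measurable_sfunP.
  have -> : (fun x => f x * w x) = fun x => \sum_(i < size s) (s`_i * cut (A i) x).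
    apply/funext => x; rewrite sE mulr_suml; apply: eq_bigr => i _.
    by rewrite mulrA.
  have : itg (fun x => \sum_(i < size s) (s`_i * cut (A i) x)) /\
      D (fun x => \sum_(i < size s) (s`_i * cut (A i) x)) = 0.
    move: (size s) => m; elim: m => [|n [IH1 IH2]].
      have -> : (fun x => \sum_(i < 0) (s`_i * cut (A i) x)) = fun=> 0.
        by apply/funext => x; rewrite big_ord0.
      by split => //; have := DZ 0 _ itg0; rewrite mul0r => ->; rewrite mul0r.
    have -> : (fun x => \sum_(i < n.+1) (s`_i * cut (A i) x)) =
        fun x => \sum_(i < n) (s`_i * cut (A i) x) + s`_n * cut (A n) x.
      by apply/funext => x; rewrite big_ord_recr.
    split; first exact: itgD IH1 (itgZ _ (icut (mA n))).
    by rewrite DD ?IH2 ?DZ ?Dcut ?mulr0 ?addr0//; [exact: icut|exact: itgZ (icut (mA n))].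
  by case.
have D0 f : itg f -> (forall x, 0 <= f x) -> D f = 0.
  (* Simple functions approximate [f / w] rather than [f], since [D] is known to vanish on
     indicators weighted by [w]. The products with [w] increase towards [f] and are dominated by
     it. *)
  move=> itf f0; pose h x := f x / w x.
  have mh : measurable_fun setT (EFin \o h).
    apply/measurable_EFinP; apply: measurable_funM => //; exact: itg_meas.
  have h0 x : (0 <= (EFin \o h) x)%E by rewrite lee_fin divr_ge0// ltW.
  pose h_ := nnsfun_approx measurableT mh.
  pose u n x := h_ n x * w x.
  have hle n x : h_ n x <= h x.
    by rewrite -lee_fin /h_ nnsfun_approxE; apply: le_approx.
  have ule n x : u n x <= f x by rewrite /u -ler_pdivlMr//; exact: hle.
  have un0 n x : 0 <= u n x by rewrite mulr_ge0// ltW.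
  have mu_ n : measurable_fun setT (u n) by apply: measurable_funM.
  have iu n : itg (u n).
    by apply: itg_le (mu_ n) _ itf => x; rewrite ger0_norm.
  have H : ((\int[mu]_x `|(u n x - f x)%:E|) @[n --> \oo] --> 0)%E.
    apply: (@dominated_L1 _ _ _ mu f f u mu_ (itg_meas itf) itf).
      by move=> n x; rewrite ger0_norm.
    move=> x; have -> : f x = h x * w x by rewrite divfK// gt_eqF.
    apply: cvgMr_tmp.
    have /fine_cvgP[_] := cvg_nnsfun_approx measurableT mh (fun x _ => h0 x) (I : setT x).
    exact.
  apply/eqP; rewrite -normr_eq0 eq_le normr_ge0 andbT.
  apply/ler_addgt0Pr => e e0; rewrite add0r.
  have K1 : 0 < 2 * K + 1 by rewrite ltr_pwDr// mulr_ge0.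
  have /fine_cvgP[_ /cvgrPdist_le/(_ (e / (2 * K + 1)) (divr_gt0 e0 K1))] := H.
  move=> [N _ /(_ N (leqnn N))] /=; rewrite sub0r normrN => Hn.
  have -> : D f = D (fun x => (-1) * (u N x - f x)).
    rewrite DZ; last exact: itgB.
    have -> : D (fun x => u N x - f x) = D (fun x => u N x + (-1) * f x).
      by congr D; apply/funext => x; rewrite mulN1r.
    rewrite DD//; last exact: itgZ.
    by rewrite DZ// Dsum; ring.
  rewrite DZ ?normrM ?normrN ?normr1 ?mul1r; last exact: itgB.
  rewrite (le_trans (DK _ (itgB (iu N) itf)))//.
  rewrite (@le_trans _ _ ((2 * K + 1) * (e / (2 * K + 1))))//.
    apply: ler_pM => //; [by rewrite mulr_ge0|exact: Rintegral_ge0|by rewrite lerDl|].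
    by apply: le_trans Hn; rewrite /Rintegral /= ler_norm.
  by rewrite mulrC divfK// gt_eqF.
move=> f itf; apply: subr0_eq; rewrite -/(D f).
have iaf : itg (fun x => `|f x|) by exact: integrable_norm.
have -> : D f = D (fun x => `|f x| + (-1) * (`|f x| - f x)).
  by congr D; apply/funext => x; ring.
rewrite DD//; last by apply: itgZ; exact: itgB.
rewrite DZ; last exact: itgB.
rewrite !D0 ?mulr0 ?addr0//; first exact: itgB.
by move=> x; rewrite subr_ge0 ler_norm.
Qed.

End functional.

Lemma l1_dual (lam : (T -> R) -> R) (K : R) : 0 <= K ->
  (forall f g, itg f -> itg g -> lam (fun x => f x + g x) = lam f + lam g) ->
  (forall c f, itg f -> lam (fun x => c * f x) = c * lam f) ->
  (forall f, itg f -> `|lam f| <= K * \int[mu]_x `|f x|) ->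
  exists g : T -> R, [/\ measurable_fun setT g,
    (forall x, `|g x| <= K) & forall f, itg f -> lam f = \int[mu]_x (g x * f x)].
Proof.
move=> K0 lD lZ lK; have [w [mw w0 iw]] := positive_weight.
exact: (@l1_dual_weight lam K K0 lD lZ lK w).
Qed.

End l1_dual.

(** * Reflections preserve Lebesgue measure *)

Section reflection.
Context {R : realType}.
Local Notation leb := (@lebesgue_measure R).

Lemma measurable_subl (a : R) : measurable_fun setT (fun b : measurableTypeR R => a - b : measurableTypeR R).
Proof. by apply: measurable_funB => //. Qed.

Lemma lebesgue_measure_subl (a : R) (A : set (measurableTypeR R)) : measurable A ->
  pushforward leb (fun b : measurableTypeR R => a - b : measurableTypeR R) A = leb A.
Proof.
pose m := measure_function_pushforward__canonical__measure_function_Measure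
  leb (measurable_subl a).
move=> mA; apply/esym.
apply: (@lebesgue_measure_unique R m) => //= _ [[u v] _ <-].
rewrite /m /= /pushforward.
rewrite (_ : _ @^-1` _ = `[a - v, a - u[%classic).
  rewrite !lebesgue_measure_itv/= !lte_fin -!EFinB ltrD2l ltrN2.
  by case: ifP => // _; congr EFin; ring.
apply/seteqP; split => x /=; rewrite !in_itv/= => /andP[h1 h2]; apply/andP; split; lra.
Qed.

Lemma ge0_integral_subl (a : R) (f : measurableTypeR R -> \bar R) :
  measurable_fun setT f -> (forall x, 0 <= f x)%E ->
  (\int[leb]_b f (a - b)%R = \int[leb]_b f b)%E.
Proof.
move=> mf f0.
have E := @ge0_integral_pushforward _ _ _ _ R _ (measurable_subl a) leb setT f
  measurableT mf (fun x _ => f0 x).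
rewrite preimage_setT in E; rewrite -[LHS]E.
apply: eq_measure_integral => [|m A mA _]; [exact: measurable_subl|exact: lebesgue_measure_subl].
Qed.

Lemma measurable_rdsub d (x : Rd R d) : measurable_fun setT (rdsub x).
Proof.
apply/measurable_fun_tnthP => i /=.
rewrite (_ : _ \o _ = fun y : Rd R d => (tnth x i : R) - tnth y i); last first.
  by apply/funext => y /=; rewrite tnth_mktuple.
apply: (measurableT_comp (measurable_subl _)); exact: measurable_tnth.
Qed.

Lemma measurable_rdsub2 d :
  measurable_fun setT (fun p : Rd R d * Rd R d => rdsub p.1 p.2).
Proof.
apply/measurable_fun_tnthP => i /=.
rewrite (_ : _ \o _ = fun p : Rd R d * Rd R d => (tnth p.1 i : R) - tnth p.2 i); last first.
  by apply/funext => y /=; rewrite tnth_mktuple.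
apply: measurable_funB.
  exact: (measurableT_comp (@measurable_tnth _ (measurableTypeR R) d i) measurable_fst).
exact: (measurableT_comp (@measurable_tnth _ (measurableTypeR R) d i) measurable_snd).
Qed.

Lemma rdsub_cons d (p q : measurableTypeR R * Rd R d) :
  rdsub (rdcons p) (rdcons q) = rdcons ((p.1 : R) - q.1, rdsub p.2 q.2).
Proof.
apply/eq_from_tnth => i; rewrite tnth_mktuple.
have [->|i0] := eqVneq i ord0; first by rewrite !tnth0.
have [j ->] : exists j, i = lift ord0 j.
  by case: (unliftP ord0 i) i0 => [j ->|->]; [exists j|rewrite eqxx].
by rewrite !tnthS !tnth_mktuple.
Qed.

Lemma ge0_integral_rdcons d (f : Rd R d.+1 -> \bar R) :
  measurable_fun setT f -> (forall x, 0 <= f x)%E ->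
  (\int[@lebesgue_Rd R d.+1]_x f x =
   \int[leb]_a \int[@lebesgue_Rd R d]_y f (rdcons (a, y)))%E.
Proof.
move=> mf f0.
have E := @ge0_integral_pushforward _ _ _ _ R (@rdcons R d) (@measurable_rdcons R d)
  (leb \x @lebesgue_Rd R d)%E setT f measurableT mf (fun x _ => f0 x).
apply: (etrans E); rewrite preimage_setT fubini_tonelli1//.
  by apply: measurableT_comp => //; exact: measurable_rdcons.
by move=> x; exact: f0.
Qed.

(** Induction on the dimension: Tonelli splits off the first coordinate, which is reflected by the
    one-dimensional statement. It makes the mass of [y |-> mayer (rdsub x y)] independent of [x]. *)
Lemma ge0_integral_rdsub d (x : Rd R d) (f : Rd R d -> \bar R) :
  measurable_fun setT f -> (forall x, 0 <= f x)%E ->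
  (\int[@lebesgue_Rd R d]_y f (rdsub x y) = \int[@lebesgue_Rd R d]_y f y)%E.
Proof.
elim: d x f => [x f mf f0|d IH x f mf f0].
  by apply: eq_integral => y _; rewrite (tuple0 (rdsub x y)) (tuple0 y).
have mfx : measurable_fun setT (fun y => f (rdsub x y)).
  by apply: measurableT_comp => //; exact: measurable_rdsub.
rewrite !ge0_integral_rdcons//.
rewrite -[in LHS](rdunconsK x); set p := rduncons x.
transitivity (\int[leb]_a \int[lebesgue_Rd d]_y f (rdcons ((p.1 : R) - a, y)%R))%E.
  apply: eq_integral => a _.
  rewrite -[RHS](IH p.2 (fun y => f (rdcons ((p.1 : R) - a, y)%R))) => [|//|//].
    by apply: eq_integral => y _; rewrite rdsub_cons.
  apply: measurableT_comp => //.
  apply: (measurableT_comp (@measurable_rdcons R d)).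
  exact: measurable_pair1.
rewrite (ge0_integral_subl (p.1 : R) (f := fun a => \int[lebesgue_Rd d]_y f (rdcons (a, y)))%E)//.
  have mfc : measurable_fun setT (f \o @rdcons R d).
    by apply: measurableT_comp => //; exact: measurable_rdcons.
  apply: (@measurable_fun_fubini_tonelli_F _ _ _ _ R (@lebesgue_Rd R d) (f \o @rdcons R d)) => //.
  by move=> z; exact: f0.
by move=> a; exact: integral_ge0.
Qed.

End reflection.

(** * Measurability of continuous functions of a kernel *)

Section separable_range.
Context d1 d2 (S : measurableType d1) (T : measurableType d2) {R : realType}.
Variable mu : {sigma_finite_measure set T -> \bar R}.
Implicit Types (f g h : T -> R) (K L : S -> T -> R).

Definition l1dist f g : \bar R := (\int[mu]_y `|(f y - g y)%:E|)%E.

Lemma measurable_abs_sub f g : measurable_fun setT f -> measurable_fun setT g ->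
  measurable_fun setT (fun y => `|(f y - g y)%:E|%E).
Proof.
move=> mf mg; apply/measurable_EFinP; apply: measurableT_comp => //.
exact: measurable_funB.
Qed.

Lemma l1dist_triangle f g h : measurable_fun setT f -> measurable_fun setT g ->
  measurable_fun setT h -> (l1dist f h <= l1dist f g + l1dist g h)%E.
Proof.
move=> mf mg mh; rewrite /l1dist.
have mB := measurable_abs_sub.
rewrite -ge0_integralD//; [|exact: mB|exact: mB].
apply: ge0_le_integral => //; first exact: mB.
- by apply: emeasurable_funD; exact: mB.
- move=> y _; rewrite -EFinD lee_fin.
  by rewrite (le_trans _ (ler_normD _ _))// addrA subrK.
Qed.

Lemma l1distC f g : l1dist f g = l1dist g f.
Proof. by apply: eq_integral => y _; rewrite !abse_EFin distrC. Qed.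

Lemma dominated_l1dist f (G : T -> R) (u : nat -> T -> R) :
  (forall n, measurable_fun setT (u n)) -> measurable_fun setT f ->
  mu.-integrable setT (EFin \o G) -> (forall n x, `|u n x| <= G x) ->
  (forall x, u n x @[n --> \oo] --> f x) ->
  forall e : R, 0 < e -> exists n, (l1dist f (u n) < e%:E)%E.
Proof.
move=> mu_ mf iG uG uf e e0; have e2 : 0 < e / 2 by rewrite divr_gt0.
have /fine_cvgP[[N1 _ H1] /cvgrPdist_le/(_ (e / 2) e2)[N2 _ H2]] :=
  dominated_L1 mu_ mf iG uG uf.
exists (maxn N1 N2); have := H2 (maxn N1 N2) (leq_maxr _ _).
have := H1 (maxn N1 N2) (leq_maxl _ _); rewrite /= sub0r normrN => fin H3.
rewrite l1distC -[ltLHS]fineK// lte_fin (le_lt_trans (ler_norm _))//.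
by rewrite (le_lt_trans H3)// ltr_pdivrMr// ltr_pMr// ltr1n.
Qed.

(** Separability in L^1 of the range of [x |-> K x], with one approximating sequence for all [x]. It
    lets a continuous functional of [K x] be approximated by functions of [x] with countably many
    values. *)
Definition l1_separable K := exists2 g : nat -> T -> R,
  (forall n, mu.-integrable setT (EFin \o g n)) &
  forall x (e : R), 0 < e -> exists n, (l1dist (K x) (g n) < e%:E)%E.

Let imeas f : mu.-integrable setT (EFin \o f) -> measurable_fun setT f.
Proof. by move=> h; apply/measurable_EFinP; exact: measurable_int h. Qed.

Lemma l1_separableD K L : (forall x, measurable_fun setT (K x)) ->
  (forall x, measurable_fun setT (L x)) -> l1_separable K -> l1_separable L ->
  l1_separable (fun x y => K x y + L x y).
Proof.
move=> mK mL [g ig gK] [h ih hL].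
(* The two sequences are added over all pairs of indices, coded by [pickle]; codes of no pair fall
   back to [(0, 0)]. *)
exists (fun n => let p := odflt (0%N, 0%N) (unpickle n) in fun y => g p.1 y + h p.2 y).
  by move=> n; exact: (integrableD measurableT (ig _) (ih _)).
move=> x e e0; have e2 : 0 < e / 2 by rewrite divr_gt0.
have [n Hn] := gK x _ e2; have [m Hm] := hL x _ e2.
exists (pickle (n, m)); rewrite pickleK /=.
rewrite (splitr e) EFinD (le_lt_trans _ (lteD Hn Hm))// /l1dist.
have m1 : measurable_fun setT (fun y => `|(K x y - g n y)%:E|%E).
  by apply: measurable_abs_sub => //; exact: imeas.
have m2 : measurable_fun setT (fun y => `|(L x y - h m y)%:E|%E).
  by apply: measurable_abs_sub => //; exact: imeas.
rewrite -ge0_integralD//; apply: ge0_le_integral => //.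
- by apply: measurable_abs_sub; apply: measurable_funD => //; exact: imeas.
- exact: emeasurable_funD.
- move=> y _; rewrite -EFinD lee_fin (le_trans _ (ler_normD _ _))//.
  by apply: le_eq; congr `|_|; ring.
Qed.

Lemma l1_separableZ K (c : R) : (forall x, measurable_fun setT (K x)) ->
  l1_separable K -> l1_separable (fun x y => c * K x y).
Proof.
move=> mK [g ig gK]; exists (fun n y => c * g n y).
  by move=> n; exact: (integrableZl measurableT c (ig n)).
move=> x e e0; have c1 : 0 < `|c| + 1 by rewrite ltr_pwDr.
have [n Hn] := gK x _ (divr_gt0 e0 c1); exists n.
have m1 : measurable_fun setT (fun y => `|(K x y - g n y)%:E|%E).
  by apply: measurable_abs_sub => //; exact: imeas.
apply: (@le_lt_trans _ _ ((`|c| + 1)%:E * l1dist (K x) (g n))%E); last first.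
  by rewrite -[ltRHS](_ : (`|c| + 1)%:E * (e / (`|c| + 1))%:E = _)%E
    ?lte_pmul2l// -EFinM mulrC divfK// gt_eqF.
rewrite /l1dist -ge0_integralZl//.
apply: ge0_le_integral => //.
- by apply: measurable_abs_sub; apply: measurable_funM => //; exact: imeas.
- exact: measurable_funeM.
- move=> y _; rewrite -EFinM lee_fin -mulrBr normrM ler_wpM2r//.
  by rewrite lerDl.
Qed.

Lemma l1_separable_lim K (Kn : nat -> S -> T -> R) :
  (forall x, measurable_fun setT (K x)) ->
  (forall n x, measurable_fun setT (Kn n x)) ->
  (forall n, l1_separable (Kn n)) ->
  (forall x (e : R), 0 < e -> exists n, (l1dist (K x) (Kn n x) < e%:E)%E) ->
  l1_separable K.
Proof.
move=> mK mKn sKn cK.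
have [g gP] : {g : nat -> nat -> T -> R | forall m,
    (forall n, mu.-integrable setT (EFin \o g m n)) /\
    forall x (e : R), 0 < e -> exists n, (l1dist (Kn m x) (g m n) < e%:E)%E}.
  exists (fun m => sval (cid2 (sKn m))) => m; by case: cid2.
exists (fun n => let p := odflt (0%N, 0%N) (unpickle n) in g p.1 p.2).
  by move=> n; have [] := gP (odflt (0%N, 0%N) (unpickle n)).1.
move=> x e e0; have e2 : 0 < e / 2 by rewrite divr_gt0.
have [n Hn] := cK x _ e2; have [m Hm] := (gP n).2 x _ e2.
exists (pickle (n, m)); rewrite pickleK /=.
rewrite (splitr e) EFinD (le_lt_trans _ (lteD Hn Hm))// l1dist_triangle//.
by apply: imeas; exact: (gP n).1.
Qed.

Lemma l1_separable0 : l1_separable (fun _ _ => 0).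
Proof.
exists (fun _ _ => 0); first by move=> _; exact: integrable0.
move=> x e e0; exists 0%N; rewrite /l1dist; under eq_integral do rewrite subrr abse0.
by rewrite integral0 lte_fin.
Qed.

(** Dynkin induction on [E], starting from measurable rectangles. The window [W] of finite measure
    keeps the whole space and complements integrable, and countable disjoint unions are limits
    dominated by the indicator of [W]. *)
Lemma l1_separable_indic (W : set T) (E : set (S * T)) : measurable W ->
  (mu W < +oo)%E -> measurable E ->
  l1_separable (fun x y => \1_E (x, y) * \1_W y).
Proof.
move=> mW Wfin mE.
have iW : mu.-integrable setT (EFin \o (\1_W : T -> R)).
  apply/integrableP; split; first by apply/measurable_EFinP; exact: measurable_indic.
  under eq_integral do rewrite /= ger0_norm//.
  by rewrite integral_indic// setIT.
have mcut (F : set (S * T)) x : measurable F ->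
    measurable_fun setT (fun y => \1_F (x, y) * \1_W y : R).
  move=> mF; apply: measurable_funM; last exact: measurable_indic.
  apply: (measurableT_comp (f := (\1_F : S * T -> R))); first exact: measurable_indic.
  exact: measurable_pair1.
have {mE} : <<s [set A `*` B | A in @measurable _ S & B in @measurable _ T]>> E.
  by rewrite -measurable_prod_measurableType.
move: E; apply: (@dynkin_induction _ (S * T)%type _
  (fun E => l1_separable (fun x y => \1_E (x, y) * \1_W y))).
- by rewrite measurable_prod_measurableType.
- move=> _ _ [A1 mA1 [A2 mA2 <-]] [B1 mB1 [B2 mB2 <-]].
  exists (A1 `&` B1); first exact: measurableI.
  exists (A2 `&` B2); first exact: measurableI.
  by rewrite setXI.
- exists (fun _ => \1_W) => // x e e0; exists 0%N.
  rewrite /l1dist; under eq_integral do rewrite indicT mul1r subrr abse0.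
  by rewrite integral0 lte_fin.
- move=> _ [A mA [B mB <-]].
  (* Sections of a rectangle take two values only: zero off [A], the indicator of [B] inside the
     window on [A]. *)
  exists (fun n => if n is 0%N then (fun=> 0) else (fun y => \1_B y * \1_W y)).
    case => [|n]; first exact: integrable0.
    apply: le_integrable iW => //.
      by apply/measurable_EFinP; apply: measurable_funM; exact: measurable_indic.
    move=> y _; rewrite /= lee_fin !indicE.
    by case: (_ \in B); rewrite ?mul1r// mul0r normr0.
  move=> x e e0; have [Ax|nAx] := pselect (A x).
    exists 1%N; rewrite /l1dist.
    have AB y : \1_(A `*` B) (x, y) = \1_B y :> R.
      rewrite !indicE; have -> // : ((x, y) \in A `*` B) = (y \in B).
      by apply/idP/idP; rewrite !inE; [case|split].
    under eq_integral do rewrite AB subrr abse0.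
    by rewrite integral0 lte_fin.
  exists 0%N; rewrite /l1dist.
  have AB y : \1_(A `*` B) (x, y) = 0 :> R.
    by rewrite indicE memNset// => -[].
  under eq_integral do rewrite AB mul0r subrr abse0.
  by rewrite integral0 lte_fin.
- move=> F mF sF.
  have -> : (fun x y => \1_(~` F) (x, y) * \1_W y) =
      fun x y => (\1_setT (x, y) * \1_W y) + (-1) * (\1_F (x, y) * \1_W y) :> R.
    apply/funext => x; apply/funext => y; rewrite !indicE in_setC in_setT.
    by case: (_ \in F) => /=; ring.
  apply: l1_separableD.
  + by move=> x; exact: mcut.
  + by move=> x; apply: measurable_funM => //; exact: mcut.
  + exists (fun _ => \1_W) => // x e e0; exists 0%N.
    rewrite /l1dist; under eq_integral do rewrite indicT mul1r subrr abse0.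
    by rewrite integral0 lte_fin.
  + by apply: l1_separableZ => // x; exact: mcut.
- move=> F mF tF sF.
  pose U n := \big[setU/set0]_(i < n) F i.
  have mU n : measurable (U n) by apply: bigsetU_measurable => i _.
  apply: (@l1_separable_lim _ (fun n x y => \1_(U n) (x, y) * \1_W y)).
  + by move=> x; apply: mcut; exact: bigcup_measurable.
  + by move=> n x; exact: mcut.
  + elim => [|n IH].
      have -> : (fun x y => \1_(U 0%N) (x, y) * \1_W y) = (fun _ _ => 0) :> (S -> T -> R).
        by apply/funext => x; apply/funext => y; rewrite /U big_ord0 indic0 mul0r.
      exact: l1_separable0.
    have -> : (fun x y => \1_(U n.+1) (x, y) * \1_W y) =
        fun x y => (\1_(U n) (x, y) * \1_W y) + (\1_(F n) (x, y) * \1_W y) :> R.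
      apply/funext => x; apply/funext => y; rewrite -mulrDl; congr (_ * _).
      rewrite /U big_ord_recr/= -/(U n) !indicE in_setU.
      have : ~ ((x, y) \in U n /\ (x, y) \in F n).
        rewrite !inE /U -bigcup_mkord => -[[i /= lin Fi] Fn].
        by move: lin; rewrite (tF i n I I (ex_intro _ _ (conj Fi Fn))) ltnn.
      case: (_ \in U n); case: (_ \in F n) => //= H; rewrite ?addr0 ?add0r//.
      by exfalso; apply: H.
    by apply: l1_separableD => // x; exact: mcut.
  + move=> x; apply: (dominated_l1dist (fun n => mcut _ _ (mU n))
      (mcut _ _ (bigcup_measurable (fun n _ => mF n))) iW).
      move=> n y; rewrite !indicE.
      by case: (_ \in U n); case: (_ \in W); rewrite ?mul1r ?mul0r ?normr1 ?normr0.
    move=> y; apply/cvgrPdist_le => e' e'0.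
    have [[N _ FNx]|nUx] := pselect ((\bigcup_n F n) (x, y)).
      exists N.+1 => // n /= Nn.
      have h1 : (\bigcup_n F n) (x, y) by exists N.
      have h2 : (U n) (x, y) by rewrite /U -bigcup_mkord; exists N.
      by rewrite !indicE (mem_set h1) (mem_set h2) subrr normr0 ltW.
    exists 0%N => // n _.
    have h2 : ~ U n (x, y).
      by rewrite /U -bigcup_mkord => -[i _ Fix]; apply: nUx; exists i.
    by rewrite !indicE (memNset nUx) (memNset h2) subrr normr0 ltW.
Qed.

Lemma l1_separable_ge0 K : measurable_fun setT (fun p : S * T => K p.1 p.2) ->
  (forall x y, 0 <= K x y) -> (forall x, mu.-integrable setT (EFin \o K x)) ->
  l1_separable K.
Proof.
move=> mK K0 iK.
have mKx x : measurable_fun setT (K x) by exact: imeas.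
have /sigma_finiteP[W [TW ndW Wfin]] := sigma_finiteT mu.
have mK' : measurable_fun setT (EFin \o (fun p : S * T => K p.1 p.2)).
  exact/measurable_EFinP.
pose h := nnsfun_approx measurableT mK'.
have mW n : measurable (W n) by have [] := Wfin n.
(* Simple functions below [K], cut to windows of finite measure: separable by the case of
   indicators, and convergent in L^1 for each [x] by domination by [K x]. *)
pose Kn n x y : R := h n (x, y) * \1_(W n) y.
have mh n x : measurable_fun setT (fun y => h n (x, y)).
  have mhn : measurable_fun setT (h n) by [].
  exact: (measurableT_comp mhn (measurable_pair1 x)).
have mKn n x : measurable_fun setT (Kn n x).
  by apply: measurable_funM => //; exact: measurable_indic.
have hK n x y : h n (x, y) <= K x y.
  rewrite -lee_fin /h nnsfun_approxE.
  have f0 (p : S * T) : setT p -> (0 <= (EFin \o (fun p => K p.1 p.2)) p)%E.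
    by move=> _; rewrite lee_fin.
  exact: (le_approx n f0 (I : setT (x, y))).
have h0 n p : 0 <= h n p by [].
apply: (@l1_separable_lim _ Kn) => //.
  move=> n.
  have [s sE] : exists s : seq R, forall x,
      h n x = \sum_(i < size s) (s`_i * \1_(h n @^-1` [set s`_i]) x).
    exists (finmap.enum_fset (fset_set (range (h n)))) => x; exact: fimfunEord.
  have -> : Kn n = fun x y => \sum_(i < size s)
      (s`_i * (\1_(h n @^-1` [set s`_i]) (x, y) * \1_(W n) y)).
    apply/funext => x; apply/funext => y; rewrite /Kn sE mulr_suml.
    by apply: eq_bigr => i _; rewrite mulrA.
  have mA i : measurable (h n @^-1` [set s`_i]) by exact: measurable_sfunP.
  have mcut i x : measurable_fun setT
      (fun y => (\1_(h n @^-1` [set s`_i]) (x, y) * \1_(W n) y) : R).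
    apply: measurable_funM; last exact: measurable_indic.
    apply: (measurableT_comp (f := (\1_(h n @^-1` [set s`_i]) : S * T -> R))).
      exact: measurable_indic.
    exact: measurable_pair1.
  elim: (size s) => [|m IH].
    rewrite (_ : (fun x y => _) = (fun _ _ => 0)); first exact: l1_separable0.
    by apply/funext => x; apply/funext => y; rewrite big_ord0.
  rewrite (_ : (fun x y => _) = (fun x y => \sum_(i < m)
      (s`_i * (\1_(h n @^-1` [set s`_i]) (x, y) * \1_(W n) y)) +
      s`_m * (\1_(h n @^-1` [set s`_m]) (x, y) * \1_(W n) y))); last first.
    by apply/funext => x; apply/funext => y; rewrite big_ord_recr.
  apply: l1_separableD => //.
  - move=> x; apply: measurable_sum => i; exact: measurable_funM.
  - by move=> x; apply: measurable_funM.
  - apply: l1_separableZ => //; apply: l1_separable_indic => //.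
    by have [] := Wfin n.
move=> x; apply: (dominated_l1dist (fun n => mKn n x) (mKx x) (iK x)).
  move=> n y; rewrite /Kn indicE; case: (_ \in _); rewrite ?mulr0 ?normr0//.
  by rewrite mulr1 ger0_norm.
move=> y; apply/cvgrPdist_le => e' e'0.
have : EFin \o h ^~ (x, y) @ \oo --> (EFin \o (fun p : S * T => K p.1 p.2)) (x, y).
  by apply: cvg_nnsfun_approx => // p _; rewrite lee_fin.
move=> /fine_cvgP[_ /cvgrPdist_le/(_ e' e'0)[N1 _ H1]].
have [N2 _ Wy] : (\bigcup_n W n) y by rewrite -TW.
exists (maxn N1 N2) => // n /=; rewrite geq_max => /andP[n1 n2].
have WN2 : W N2 `<=` W n by exact/subsetPset/ndW.
have Wny := WN2 _ Wy.
by rewrite /Kn indicE (mem_set Wny) mulr1; exact: H1.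
Qed.

Lemma l1_separable_integrable K : measurable_fun setT (fun p : S * T => K p.1 p.2) ->
  (forall x, mu.-integrable setT (EFin \o K x)) -> l1_separable K.
Proof.
move=> mK iK.
have mKx x : measurable_fun setT (K x) by exact: imeas.
have ia x : mu.-integrable setT (EFin \o (fun y => `|K x y|)).
  exact: integrable_norm.
have mN x : measurable_fun setT (fun y => `|K x y|) by exact: measurableT_comp.
have -> : K = fun x y => `|K x y| + (-1) * (`|K x y| - K x y).
  by apply/funext => x; apply/funext => y; ring.
apply: l1_separableD => //.
- by move=> x; apply: measurable_funM => //; exact: measurable_funB.
- by apply: l1_separable_ge0 => //; exact: measurableT_comp.
apply: l1_separableZ; first by move=> x; exact: measurable_funB.
apply: l1_separable_ge0.
- by apply: measurable_funB => //; exact: measurableT_comp.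
- by move=> x y; rewrite subr_ge0 ler_norm.
- by move=> x; exact: (integrableB measurableT (ia x) (iK x)).
Qed.

End separable_range.

(** * Measurability of a continuous functional along a kernel *)

Section continuous_composition.
Context d1 d2 (S : measurableType d1) (T : measurableType d2) {R : realType}.
Variable mu : {sigma_finite_measure set T -> \bar R}.
Local Notation C := R[i].
Local Notation L := (cintg mu setT).

(** The section [K x] is replaced by an approximant [g n] whose index depends measurably on [x].
    Then [B] of it takes countably many values on measurable sets, and continuity of [B] on L^1
    gives convergence to [B (K x)]. *)
Lemma measurable_continuous_comp (K : S -> T -> C) (B : (T -> C) -> C) :
  measurable_fun setT (fun p : S * T => complex.Re (K p.1 p.2)) ->
  measurable_fun setT (fun p : S * T => complex.Im (K p.1 p.2)) ->
  (forall x, L (K x)) ->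
  (forall f, L f -> forall e : R, 0 < e -> exists2 dl : R, 0 < dl &
    forall g, L g -> (\int[mu]_y (abs (f y - g y))%:E < dl%:E)%E ->
      abs (B f - B g) <= e) ->
  measurable_fun setT (fun x => complex.Re (B (K x))) /\
  measurable_fun setT (fun x => complex.Im (B (K x))).
Proof.
move=> mK1 mK2 iK cB.
have [g1 ig1 g1P] := l1_separable_integrable mK1 (fun x => (iK x).1).
have [g2 ig2 g2P] := l1_separable_integrable mK2 (fun x => (iK x).2).
pose dec n := odflt (0%N, 0%N) (unpickle n : option (nat * nat)).
pose g n (y : T) : C := g1 (dec n).1 y +i* g2 (dec n).2 y.
have Lg n : L (g n) by split; [exact: ig1|exact: ig2].
pose N n x : \bar R := (\int[mu]_y (abs (K x y - g n y))%:E)%E.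
have imeas (f : T -> R) : mu.-integrable setT (EFin \o f) -> measurable_fun setT f.
  by move=> h; apply/measurable_EFinP; exact: measurable_int h.
have mB x n : measurable_fun setT (fun y => abs (K x y - g n y)).
  by apply: imeas; exact: (integrable_abs measurableT (cintgB measurableT (iK x) (Lg n))).
have mN n : measurable_fun setT (N n).
  pose G (p : S * T) : \bar R := (abs (K p.1 p.2 - g n p.2))%:E.
  have mG : measurable_fun setT G.
    apply/measurable_EFinP; apply: measurable_abs.
      rewrite (_ : (fun p => _) = (fun p : S * T =>
          complex.Re (K p.1 p.2) - g1 (dec n).1 p.2)); last first.
        by apply/funext => p; rewrite cReD cReN.
      by apply: measurable_funB => //; apply: measurableT_comp => //; exact: imeas.
    rewrite (_ : (fun p => _) = (fun p : S * T =>
          complex.Im (K p.1 p.2) - g2 (dec n).2 p.2)); last first.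
      by apply/funext => p; rewrite cImD cImN.
    by apply: measurable_funB => //; apply: measurableT_comp => //; exact: imeas.
  apply: (@measurable_fun_fubini_tonelli_F _ _ _ _ R mu G) => //.
  by move=> p; rewrite lee_fin abs_ge0.
have Nsmall x (e : R) : 0 < e -> exists n, (N n x < e%:E)%E.
  move=> e0; have e2 : 0 < e / 2 by rewrite divr_gt0.
  have [n Hn] := g1P x _ e2; have [m Hm] := g2P x _ e2.
  exists (pickle (n, m)).
  rewrite (splitr e) EFinD (le_lt_trans _ (lteD Hn Hm))// /l1dist.
  have m1 : measurable_fun setT (fun y => `|(complex.Re (K x y) - g1 n y)%:E|%E).
    by apply: measurable_abs_sub; apply: imeas; [exact: (iK x).1|exact: ig1].
  have m2 : measurable_fun setT (fun y => `|(complex.Im (K x y) - g2 m y)%:E|%E).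
    by apply: measurable_abs_sub; apply: imeas; [exact: (iK x).2|exact: ig2].
  rewrite -ge0_integralD// /N; apply: ge0_le_integral => //.
  - by move=> y _; rewrite lee_fin abs_ge0.
  - exact/measurable_EFinP.
  - exact: emeasurable_funD.
  - move=> y _; rewrite !abse_EFin -EFinD lee_fin (le_trans (abs_le_ReIm _))//.
    by rewrite cReD cReN cImD cImN /g /dec pickleK.
pose r k : \bar R := (k.+1%:R^-1 : R)%:E.
have r0 k : 0 < k.+1%:R^-1 :> R by rewrite invr_gt0 ltr0n.
have exN k x : exists n, (N n x < r k)%E by exact: Nsmall.
(* Taking the least admissible index makes the choice measurable, since its level sets are Boolean
   combinations of sublevel sets of the distances [N n]. *)
pose s k x := ex_minn (exN k x).
have sP k x : (N (s k x) x < r k)%E by rewrite /s; case: ex_minnP.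
have smin k x n : (N n x < r k)%E -> (s k x <= n)%N.
  by rewrite /s; case: ex_minnP => m _ + /[dup]; move=> + _; apply.
have mP k n : measurable [set x | (N n x < r k)%E].
  by rewrite -[X in measurable X]setTI; apply: emeasurable_fun_infty_o.
have ms k n : measurable [set x | s k x = n].
  rewrite (_ : [set x | _] = [set x | (N n x < r k)%E] `&`
      \bigcap_(m in [set m | (m < n)%N]) ~` [set x | (N m x < r k)%E]).
    apply: measurableI => //; apply: bigcap_measurableType => m _.
    exact: measurableC.
  apply/seteqP; split => x /=.
    move=> sx; split; first by rewrite -sx; exact: sP.
    by move=> m /= mn Nm; have := smin _ _ _ Nm; rewrite sx leqNgt mn.
  move=> [Nn Nm]; apply/eqP; rewrite eqn_leq smin//= leqNgt; apply/negP => sn.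
  by have := Nm _ sn; apply; exact: sP.
have mphi (p : C -> R) k : measurable_fun setT (fun x => p (B (g (s k x)))).
  move=> _ Y mY; rewrite setTI.
  rewrite (_ : _ @^-1` _ = \bigcup_(n in [set n | Y (p (B (g n)))]) [set x | s k x = n]).
    by apply: bigcup_measurable => n _; exact: ms.
  apply/seteqP; split => x /=; first by move=> h; exists (s k x).
  by move=> [n /= h ->].
have cphi (p : C -> R) x : (forall u v, `|p u - p v| <= abs (u - v)) ->
    p (B (g (s k x))) @[k --> \oo] --> p (B (K x)).
  move=> pL; apply/cvgrPdist_le => e e0.
  have [dl dl0 H] := cB _ (iK x) e e0.
  exists (Num.truncn dl^-1) => // k /= kd.
  rewrite (le_trans (pL _ _))// H//; apply: (lt_le_trans (sP k x)).
  rewrite lee_fin invf_ple ?posrE// ltW// (lt_le_trans (truncnS_gt _))//.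
  by rewrite ler_nat.
split.
  apply: (@measurable_fun_cvg _ _ _ setT (fun k x => complex.Re (B (g (s k x))))) => [k|x _].
    exact: mphi.
  by apply: cphi => u v; rewrite -cReN -cReD ler_Re_abs.
apply: (@measurable_fun_cvg _ _ _ setT (fun k x => complex.Im (B (g (s k x))))) => [k|x _].
  exact: mphi.
by apply: cphi => u v; rewrite -cImN -cImD ler_Im_abs.
Qed.

End continuous_composition.

(** * Entire functionals of exponential type *)

Section l1_space.
Context {R : realType} {d : nat}.
Local Notation C := (R[i]).
Local Notation X := (Rd R d).
Local Notation mu := (@lebesgue_Rd R d).
Implicit Types (f g h k : X -> C) (B : (X -> C) -> C) (alpha K : R).

Lemma L1D f g : L1 f -> L1 g -> L1 (fun x => f x + g x).
Proof. exact: (cintgD measurableT). Qed.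

Lemma L1Z (c : C) f : L1 f -> L1 (fun x => c * f x).
Proof. exact: (cintgZ measurableT). Qed.

Lemma L1B f g : L1 f -> L1 g -> L1 (fun x => f x - g x).
Proof. exact: (cintgB measurableT). Qed.

Lemma L10 : L1 (fun _ : X => 0 : C).
Proof. by split; exact: integrable0. Qed.

Lemma L1DZ (c : C) f h : L1 f -> L1 h -> L1 (fun x => f x + c * h x).
Proof. by move=> Lf Lh; apply: L1D => //; exact: L1Z. Qed.

Lemma integrable_L1abs f : L1 f -> mu.-integrable setT (EFin \o (fun x => abs (f x))).
Proof. exact: (integrable_abs measurableT). Qed.

Lemma L1norm_ge0 f : 0 <= L1norm f.
Proof. by apply: Rintegral_ge0 => x _; exact: abs_ge0. Qed.

Lemma L1norm_le f (G : X -> R) : L1 f -> mu.-integrable setT (EFin \o G) ->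
  (forall x, abs (f x) <= G x) -> L1norm f <= \int[mu]_x G x.
Proof.
by move=> Lf iG fG; apply: le_Rintegral => //; exact: integrable_L1abs.
Qed.

Lemma L1normD f g : L1 f -> L1 g ->
  L1norm (fun x => f x + g x) <= L1norm f + L1norm g.
Proof.
move=> Lf Lg; rewrite /L1norm -RintegralD//; try exact: integrable_L1abs.
apply: L1norm_le; first exact: L1D.
  exact: (integrableD measurableT (integrable_L1abs Lf) (integrable_L1abs Lg)).
by move=> x; exact: absD.
Qed.

Lemma L1normZ (c : C) f : L1 f -> L1norm (fun x => c * f x) = abs c * L1norm f.
Proof.
move=> Lf; rewrite /L1norm -RintegralZl//; last exact: integrable_L1abs.
by apply: eq_Rintegral => x _; rewrite absM.
Qed.

Lemma L1normDZ (c : C) f h : L1 f -> L1 h ->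
  L1norm (fun x => f x + c * h x) <= L1norm f + abs c * L1norm h.
Proof. by move=> Lf Lh; rewrite -L1normZ// L1normD//; exact: L1Z. Qed.

Lemma L1norm_EFin f : L1 f -> (L1norm f)%:E = (\int[mu]_x (abs (f x))%:E)%E.
Proof.
move=> Lf; rewrite /L1norm /Rintegral fineK//.
exact: (integrable_fin_num measurableT (integrable_L1abs Lf)).
Qed.

Lemma locally_bounded_mono (b : R -> R) B :
  (forall r s, 0 <= r -> r <= s -> b r <= b s) ->
  (forall f, L1 f -> abs (B f) <= b (L1norm f)) -> locally_bounded B.
Proof.
move=> bb Bb f0 Lf0; exists 1, (b (L1norm f0 + 1)); split => // f Lf ff0.
rewrite (le_trans (Bb f Lf))// bb ?L1norm_ge0// {1}(_ : f = fun x => f0 x + (f x - f0 x)).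
  by rewrite (le_trans (L1normD Lf0 (L1B Lf Lf0)))// lerD2l ltW.
by apply/funext => x; rewrite addrC subrK.
Qed.

Definition expbound (alpha K : R) (B : (X -> C) -> C) :=
  forall f, L1 f -> abs (B f) <= K * expR (L1norm f / alpha).

Lemma EnormP alpha K B : (Enorm alpha B <= K%:E)%E <-> expbound alpha K B.
Proof.
split=> [h f Lf|h].
  have : ((abs (B f) * expR (- (L1norm f / alpha)))%:E <= K%:E)%E.
    by apply: le_trans h; apply: ereal_sup_ubound; exists f.
  by rewrite lee_fin expRN ler_pdivrMr ?expR_gt0.
apply: ge_ereal_sup => _ [f Lf <-].
by rewrite lee_fin expRN ler_pdivrMr ?expR_gt0//; exact: h.
Qed.

Lemma Enorm_ge0 alpha B : (0 <= Enorm alpha B)%E.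
Proof.
apply: (@le_trans _ _ (abs (B (fun=> 0)) * expR (- (L1norm (fun=> 0) / alpha)))%:E).
  by rewrite lee_fin mulr_ge0 ?abs_ge0 ?expR_ge0.
by apply: ereal_sup_ubound; exists (fun=> 0) => //; exact: L10.
Qed.

Lemma calEP alpha B : calE alpha B <-> entire B /\ exists2 K, 0 <= K & expbound alpha K B.
Proof.
split=> [[eB Efin]|[eB [K K0 BK]]]; split => //.
  exists (fine (Enorm alpha B)); first exact: fine_ge0 (Enorm_ge0 _ _).
  by apply/EnormP; rewrite fineK// ge0_fin_numE ?Enorm_ge0.
by rewrite (le_lt_trans _ (ltry K))//; exact/EnormP.
Qed.

Lemma expbound_weaken alpha alpha' K B : 0 < alpha' -> alpha' <= alpha -> 0 <= K ->
  expbound alpha K B -> expbound alpha' K B.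
Proof.
move=> a'0 aa K0 BK f Lf; rewrite (le_trans (BK f Lf))// ler_wpM2l// ler_expR.
by rewrite ler_wpM2l ?L1norm_ge0// lef_pV2// posrE (lt_le_trans a'0).
Qed.

(** * Continuity and directional derivatives of one entire functional *)

Section directional.
Variables (alpha K : R) (B : (X -> C) -> C).
Hypothesis alpha0 : 0 < alpha.
Hypothesis K0 : 0 <= K.
Hypothesis eB : entire B.
Hypothesis bB : expbound alpha K B.

Lemma along_holo f h : L1 f -> L1 h -> holo (along B f h).
Proof. by case: eB => _ _ H Lf Lh; apply/holo_derivable => w; exact: H. Qed.

Lemma along_le f h (r : R) : L1 f -> L1 h -> forall w, abs w <= r ->
  abs (along B f h w) <= K * expR ((L1norm f + r * L1norm h) / alpha).
Proof.
move=> Lf Lh w wr; rewrite (le_trans (bB (L1DZ w Lf Lh)))// ler_wpM2l//.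
rewrite ler_expR ler_pM2r ?invr_gt0// (le_trans (L1normDZ w Lf Lh))//.
by rewrite lerD2l ler_wpM2r// L1norm_ge0.
Qed.

Lemma expbound_exp_ge0 (t : R) : 0 <= K * expR t.
Proof. by rewrite mulr_ge0// expR_ge0. Qed.

(** If [g] is within [alpha / r] of [f], the complex line through them stays within [alpha] of [f]
    for [abs w <= r]. The bound [M] is thus the same for every [r], and the increment at [w = 1] is
    at most [32 * M / r]. *)
Lemma entire_continuous f (e : R) : L1 f -> 0 < e ->
  exists2 dl : R, 0 < dl & forall g, L1 g -> L1norm (fun x => f x - g x) < dl ->
    abs (B f - B g) <= e.
Proof.
move=> Lf e0; pose M := K * expR ((L1norm f + alpha) / alpha).
have M0 : 0 <= M by exact: expbound_exp_ge0.
(* The summand 2 makes the increment 1 admissible, being at most [r / 2]; the other one turns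
   [32 * M / r] into at most [e]. *)
pose r := 2 + 32 * M / e.
have Me : 0 <= 32 * M / e by apply: divr_ge0 (ltW e0); apply: mulr_ge0.
have r2 : 2 <= r by rewrite lerDl.
have r0 : 0 < r by rewrite (lt_le_trans _ r2).
exists (alpha / r); first exact: divr_gt0.
move=> g Lg fg; rewrite abs_subC.
pose h x := g x - f x.
have Lh : L1 h by exact: L1B.
have hg : L1norm h < alpha / r.
  by apply: le_lt_trans fg; apply: le_eq;
    apply: eq_Rintegral => x _; rewrite abs_subC.
have E0 : B f = along B f h 0.
  by rewrite /along; congr B; apply/funext => x; rewrite mul0r addr0.
have E1 : B g = along B f h (0 + 1).
  by rewrite /along; congr B; apply/funext => x; rewrite add0r mul1r /h addrC subrK.
rewrite E0 E1; apply: (le_trans (@lipschitz_estimate _ _ 0 1 r M (along_holo Lf Lh) r0 _ _)).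
- move=> w; rewrite subr0 => wr; apply: (le_trans (along_le Lf Lh wr)).
  rewrite ler_wpM2l// ler_expR ler_pM2r ?invr_gt0// lerD2l.
  by rewrite mulrC -ler_pdivlMr// ltW.
- by rewrite abs1 ler_pdivlMr// mul1r.
rewrite abs1 mulr1 ler_pdivrMr// [leRHS]mulrC -ler_pdivrMr//.
by rewrite /r lerDr.
Qed.

Definition dird f h : C := xget 0 [set l | cderiv (along B f h) 0 l].

Lemma dirdP f h : L1 f -> L1 h -> cderiv (along B f h) 0 (dird f h).
Proof.
move=> Lf Lh; rewrite /dird; case: xgetP => [l -> //|nex].
by have [l dl] := along_holo Lf Lh 0; case: (nex l).
Qed.

Lemma dird_eq f h l : L1 f -> L1 h -> cderiv (along B f h) 0 l -> dird f h = l.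
Proof. by move=> Lf Lh; exact: cderiv_uniq (dirdP Lf Lh). Qed.

(** Cauchy's estimate on the disc of radius [alpha / L1norm h], on which the exponent grows by
    exactly 1. For a direction of norm zero every radius is admissible, and letting it grow shows
    that the derivative vanishes. *)
Lemma dird_le f h : L1 f -> L1 h ->
  abs (dird f h) <= 16 * (K * expR ((L1norm f + alpha) / alpha)) / alpha * L1norm h.
Proof.
move=> Lf Lh; set M := K * _.
have M0 : 0 <= M by exact: expbound_exp_ge0.
have est (r : R) : 0 < r -> r * L1norm h <= alpha -> abs (dird f h) <= 16 * M / r.
  move=> r0 rh; apply: (cauchy_at0 (along_holo Lf Lh) r0 _ (dirdP Lf Lh)) => w wr.
  rewrite (le_trans (along_le Lf Lh wr))// ler_wpM2l// ler_expR.
  by rewrite ler_pM2r ?invr_gt0// lerD2l.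
have [h0|h0] := eqVneq (L1norm h) 0.
  rewrite h0 mulr0; apply/ler_addgt0Pr => e e0; rewrite add0r.
  have M1 : 0 < 16 * M + 1 by rewrite ltr_pwDr// mulr_ge0.
  rewrite (le_trans (est ((16 * M + 1) / e) _ _))//.
  - by rewrite divr_gt0.
  - by rewrite h0 mulr0 ltW.
  - rewrite ler_pdivrMr ?divr_gt0// [leRHS]mulrC divfK ?gt_eqF//.
    by rewrite lerDl.
have hp : 0 < L1norm h by rewrite lt_def h0 L1norm_ge0.
rewrite (le_trans (est (alpha / L1norm h) _ _))//.
- by rewrite divr_gt0.
- by rewrite divfK.
- apply: le_eq; field.
  by rewrite h0 gt_eqF.
Qed.

Lemma dird_taylor f h : L1 f -> L1 h -> exists2 D : R, 0 <= D & forall s,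
  abs s <= 1 / 4 -> abs (along B f h s - B f - s * dird f h) <= D * abs s ^+ 2.
Proof.
move=> Lf Lh; pose M := K * expR ((L1norm f + 1 * L1norm h) / alpha).
exists (2048 * M / 1 ^+ 2).
  rewrite expr1n divr1; apply: mulr_ge0; [exact: ler0n|exact: expbound_exp_ge0].
move=> s sr.
have -> : along B f h s - B f = along B f h (0 + s) - along B f h 0.
  rewrite add0r; congr (_ - _); rewrite /along; congr B.
  by apply/funext => x; rewrite mul0r addr0.
apply: (taylor2_estimate (along_holo Lf Lh) ltr01 _ sr (dirdP Lf Lh)).
by move=> w; rewrite subr0; exact: along_le.
Qed.

(** Only differentiability along lines is given, so additivity in the direction is not automatic.
    The mixed second difference is quadratic: the Lipschitz estimate in direction [k] bounds [q] by
    a multiple of [abs t], and a second one in direction [h] gives the other factor. *)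
Lemma mixed_difference f h k : L1 f -> L1 h -> L1 k ->
  exists2 D : R, 0 <= D & forall s, abs s <= 1 / 4 ->
    abs (along B f (fun x => h x + k x) s - along B f h s - along B f k s + B f)
      <= D * abs s ^+ 2.
Proof.
move=> Lf Lh Lk.
pose M := K * expR ((L1norm f + 1 * L1norm h + 1 * L1norm k) / alpha).
have M0 : 0 <= M by exact: expbound_exp_ge0.
exists (32 * (32 * M / 1) / 1).
  by rewrite !divr1; apply: mulr_ge0 => //; apply: mulr_ge0.
move=> t t4.
have t2 : abs t <= 1 / 2 by rewrite (le_trans t4)// !mul1r lef_pV2 ?posrE// ler_nat.
pose q w := along B (fun x => f x + t * k x) h w - along B f h w.
have hq : holo q by apply: holoB; apply: along_holo => //; exact: L1DZ.
have qM w : abs (w - 0) <= 1 -> abs (q w) <= 32 * M / 1 * abs t.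
  rewrite subr0 => w1.
  have -> : q w = along B (fun x => f x + w * h x) k (0 + t) -
      along B (fun x => f x + w * h x) k 0.
    rewrite /q /along; congr (B _ - B _); apply/funext => x.
      by rewrite add0r addrAC.
    by rewrite mul0r addr0.
  have Lfw := L1DZ w Lf Lh.
  apply: (lipschitz_estimate (along_holo Lfw Lk) ltr01 _ t2) => v.
  rewrite subr0 => v1; rewrite (le_trans (along_le Lfw Lk v1))// ler_wpM2l//.
  rewrite ler_expR ler_pM2r ?invr_gt0// lerD2r.
  rewrite (le_trans (L1normDZ w Lf Lh))// lerD2l ler_wpM2r// L1norm_ge0//.
have -> : along B f (fun x => h x + k x) t - along B f h t - along B f k t + B f =
    q (0 + t) - q 0.
  have -> : along B f (fun x => h x + k x) t = along B (fun x => f x + t * k x) h (0 + t).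
    by rewrite /along; congr B; apply/funext => x; rewrite add0r; ring.
  have E1 : along B f h t = along B f h (0 + t) by rewrite add0r.
  have -> : along B f k t = along B (fun x => f x + t * k x) h 0.
    by rewrite /along; congr B; apply/funext => x; ring.
  have -> : B f = along B f h 0.
    by rewrite /along; congr B; apply/funext => x; ring.
  by rewrite E1 /q; ring.
rewrite (le_trans (lipschitz_estimate hq ltr01 qM t2))//.
apply: le_eq; rewrite !divr1.
by ring.
Qed.

(** The defect multiplied by [s] is a combination of three Taylor remainders and the mixed
    difference, all of order [s ^+ 2]. Dividing by [s] leaves an arbitrarily small bound. *)
Lemma dirdD f h k : L1 f -> L1 h -> L1 k ->
  dird f (fun x => h x + k x) = dird f h + dird f k.
Proof.
move=> Lf Lh Lk; have Lhk := L1D Lh Lk.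
have [D1 D10 H1] := dird_taylor Lf Lh.
have [D2 D20 H2] := dird_taylor Lf Lk.
have [D3 D30 H3] := dird_taylor Lf Lhk.
have [D4 D40 H4] := mixed_difference Lf Lh Lk.
apply: subr0_eq; apply: abs_le_small => e e0.
pose D := D1 + D2 + D3 + D4 + 1.
have D0 : 0 < D by rewrite ltr_pwDr// !addr_ge0.
pose s := Num.min (1 / 4) (e / D).
have s0 : 0 < s by rewrite lt_min !divr_gt0.
have s4 : s <= 1 / 4 by rewrite ge_min lexx.
have se : s <= e / D by rewrite ge_min lexx orbT.
have as_ : abs (s%:C : C) = s by rewrite abs_real gtr0_norm.
have := H1 s%:C; have := H2 s%:C; have := H3 s%:C; have := H4 s%:C.
rewrite as_ => /(_ s4) h4 /(_ s4) h3 /(_ s4) h2 /(_ s4) h1.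
set a := dird f _ in h3 *; set a1 := dird f h in h1 *; set a2 := dird f k in h2 *.
set u := along B f _ _ in h3 h4; set u1 := along B f h _ in h1 h4.
set u2 := along B f k _ in h2 h4.
have : abs (s%:C * (a - (a1 + a2))) <= s * (s * D).
  have -> : s%:C * (a - (a1 + a2)) = (u - u1 - u2 + B f) - (u - B f - s%:C * a) +
      (u1 - B f - s%:C * a1) + (u2 - B f - s%:C * a2) by ring.
  rewrite (le_trans (absD _ _))//.
  rewrite (le_trans (lerD (le_trans (absD _ _) (lerD (le_trans (absB _ _) (lerD h4 h3)) h1)) h2))//.
  rewrite [leLHS](_ : _ = s * (s * (D1 + D2 + D3 + D4))); last by ring.
  by rewrite !ler_wpM2l ?(ltW s0)// /D lerDl.
rewrite absM as_ ler_pM2l// => /le_trans; apply.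
by rewrite -ler_pdivlMr.
Qed.

Lemma dirdZ c f h : L1 f -> L1 h -> dird f (fun x => c * h x) = c * dird f h.
Proof.
move=> Lf Lh; apply: dird_eq => //; first exact: L1Z.
move=> e e0; have c1 : 0 < 1 + abs c by rewrite ltr_pwDl// abs_ge0.
have [dl dl0 H] := dirdP Lf Lh (divr_gt0 e0 c1).
exists (dl / (1 + abs c)); first by rewrite divr_gt0.
move=> s; rewrite ltr_pdivlMr// => sd.
have scd : abs (s * c) < dl.
  by rewrite absM (le_lt_trans _ sd)// ler_wpM2l ?abs_ge0// lerDr.
have -> : along B f (fun x => c * h x) (0 + s) = along B f h (0 + s * c).
  by rewrite /along; congr B; apply/funext => x; ring.
have -> : along B f (fun x => c * h x) 0 = along B f h 0.
  by rewrite /along; congr B; apply/funext => x; ring.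
rewrite mulrA; apply: (le_trans (H _ scd)); rewrite absM.
rewrite [leLHS](_ : _ = e * abs s * (abs c / (1 + abs c))); last by ring.
rewrite ler_piMr ?mulr_ge0 ?abs_ge0 ?(ltW e0)//.
by rewrite ler_pdivrMr// mul1r lerDr.
Qed.

(** The derivative in direction [k] is the limit of difference quotients with steps [c n]. Each of
    these is holomorphic in [w], and the Lipschitz estimate bounds them locally uniformly, so joint
    analyticity is never invoked. *)
Lemma dird_holo f h k : L1 f -> L1 h -> L1 k ->
  holo (fun w => dird (fun x => f x + w * h x) k).
Proof.
move=> Lf Lh Lk.
pose c n : C := (n.+1%:R^-1 : R)%:C.
pose u n w : C := n.+1%:R * (along B (fun x => f x + c n * k x) h w - along B f h w).
have ac n : abs (c n) = n.+1%:R^-1.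
  by rewrite /c abs_real ger0_norm// invr_ge0.
have nc n : (n.+1%:R : C) * c n = 1.
  rewrite (_ : n.+1%:R = (n.+1%:R : R)%:C); last by rewrite rmorph_nat.
  by rewrite /c -(rmorphM (@real_complex R)) /= mulfV ?pnatr_eq0.
have ucE n w : u n w = n.+1%:R * (along B (fun x => f x + w * h x) k (0 + c n) -
      along B (fun x => f x + w * h x) k 0).
  rewrite /u /along; congr (_ * (B _ - B _)); apply/funext => x; ring.
have an n : abs (n.+1%:R : C) = n.+1%:R.
  rewrite (_ : n.+1%:R = (n.+1%:R : R)%:C); last by rewrite rmorph_nat.
  by rewrite abs_real ger0_norm.
apply: (@holo_clim _ u).
- move=> n; apply: holoM; first exact: holo_cst.
  by apply: holoB; apply: along_holo => //; exact: L1DZ.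
(* Radius 2 in direction [k] admits all steps [c n], the largest of which is 1. *)
- move=> r; pose M := K * expR ((L1norm f + r * L1norm h + 2 * L1norm k) / alpha).
  exists (32 * M / 2) => n w wr; rewrite ucE absM.
  have Lfw := L1DZ w Lf Lh.
  have cn1 : abs (c n) <= 2 / 2.
    by rewrite ac divff// invf_le1// ler1n.
  have bM v : abs (v - 0) <= 2 -> abs (along B (fun x => f x + w * h x) k v) <= M.
    rewrite subr0 => v1; rewrite (le_trans (along_le Lfw Lk v1))// ler_wpM2l//.
    rewrite ler_expR ler_pM2r ?invr_gt0// lerD2r.
    by rewrite (le_trans (L1normDZ w Lf Lh))// lerD2l ler_wpM2r// L1norm_ge0.
  rewrite an mulrC -ler_pdivlMr ?ltr0n//.
  have := lipschitz_estimate (along_holo Lfw Lk) (ltr0n R 2) bM cn1.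
  by rewrite ac.
- move=> w e e0; have Lfw := L1DZ w Lf Lh.
  have [dl dl0 H] := dirdP Lfw Lk e0.
  exists (Num.truncn dl^-1).+1 => n Nn.
  have cd : abs (c n) < dl.
    rewrite ac invf_plt ?posrE ?ltr0n// (lt_le_trans (truncnS_gt _))//.
    by rewrite ler_nat ltnW.
  have := H _ cd; rewrite ucE ac.
  set q := _ - along _ _ _ 0; set D := dird _ _ => h1.
  have -> : n.+1%:R * q - D = n.+1%:R * (q - c n * D).
    by rewrite [RHS]mulrBr [in RHS]mulrA nc mul1r.
  by rewrite absM an mulrC -ler_pdivlMr// ltr0n.
Qed.

Lemma dird_aeq f g : L1 f -> L1 g -> aeq f g -> dird f f = dird g g.
Proof.
move=> Lf Lg fg; rewrite /dird; congr xget.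
have -> // : along B f f = along B g g.
apply/funext => w; case: eB => BL _ _; apply: BL; [exact: L1DZ|exact: L1DZ|].
by move: fg; apply: filterS => x /= ->.
Qed.

End directional.

End l1_space.

(** * The variational derivative *)

Section products.
Context d (T : measurableType d) {R : realType}.
Variable mu : {measure set T -> \bar R}.
Local Notation C := (R[i]).
Implicit Types (f g h : T -> C).

Definition cmeas f := measurable_fun setT (fun x => complex.Re (f x)) /\
  measurable_fun setT (fun x => complex.Im (f x)).

Lemma cmeasM f g : cmeas f -> cmeas g -> cmeas (fun x => f x * g x).
Proof.
move=> [f1 f2] [g1 g2]; split.
  rewrite (_ : (fun x => _) = fun x => complex.Re (f x) * complex.Re (g x) -
    complex.Im (f x) * complex.Im (g x)); last by apply/funext => x; rewrite cReM.
  by apply: measurable_funB; apply: measurable_funM.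
rewrite (_ : (fun x => _) = fun x => complex.Re (f x) * complex.Im (g x) +
  complex.Im (f x) * complex.Re (g x)); last by apply/funext => x; rewrite cImM.
by apply: measurable_funD; apply: measurable_funM.
Qed.

Lemma cintg_cmeas f : cintg mu setT f -> cmeas f.
Proof. by move/cintg_measurable. Qed.

Lemma cintg_ae_le f (G : T -> R) : cmeas f -> mu.-integrable setT (EFin \o G) ->
  {ae mu, forall x, abs (f x) <= G x} -> cintg mu setT f.
Proof.
move=> [m1 m2] iG fG.
have mG : measurable_fun setT G by apply/measurable_EFinP; exact: measurable_int iG.
have /integrableP[_ GG] := iG.
split; apply/integrableP; split; try exact/measurable_EFinP;
  apply: le_lt_trans GG; apply: ae_ge0_le_integral => //;
  try (by apply: measurableT_comp => //; exact/measurable_EFinP);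
  apply: filterS fG => x fx _; rewrite /= lee_fin.
  by rewrite (le_trans (ler_Re_abs _))// (le_trans fx)// ler_norm.
by rewrite (le_trans (ler_Im_abs _))// (le_trans fx)// ler_norm.
Qed.

Lemma cintgM_bounded f g (M : R) : cmeas g -> {ae mu, forall x, abs (g x) <= M} ->
  cintg mu setT f -> cintg mu setT (fun x => g x * f x).
Proof.
move=> mg gM Lf; apply: (@cintg_ae_le _ (fun x => M * abs (f x))).
- by apply: cmeasM => //; exact: cintg_cmeas.
- exact: (integrableZl measurableT M (integrable_abs measurableT Lf)).
- by apply: filterS gM => x gx; rewrite absM ler_wpM2r ?abs_ge0.
Qed.

Lemma cI_ae_eq f g : cmeas f -> cmeas g -> {ae mu, forall x, f x = g x} ->
  cI mu setT f = cI mu setT g.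
Proof.
move=> [f1 f2] [g1 g2] fg; rewrite /cI /Rintegral; congr (fine _ +i* fine _);
  apply: ae_eq_integral => //; try exact/measurable_EFinP;
  by apply: filterS fg => x /= -> _.
Qed.

End products.

Section variational_derivative.
Context {R : realType} {d : nat}.
Local Notation C := (R[i]).
Local Notation X := (Rd R d).
Local Notation mu := (@lebesgue_Rd R d).
Implicit Types (f g h k : X -> C).
Variables (alpha K : R) (B : (X -> C) -> C).
Hypothesis alpha0 : 0 < alpha.
Hypothesis K0 : 0 <= K.
Hypothesis eB : entire B.
Hypothesis bB : expbound alpha K B.

Lemma L1_real (u : X -> R) : mu.-integrable setT (EFin \o u) ->
  L1 (fun x => (u x)%:C).
Proof. by move=> iu; split => //; exact: integrable0. Qed.

(** Restricted to real directions, the real and imaginary parts of the derivative are bounded real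
    functionals, each represented by duality. Complex linearity in the direction then recovers a
    general [h] from its two parts. *)
Lemma vderiv_exists f : L1 f -> exists g, is_vderiv B f g.
Proof.
move=> Lf.
pose Dr (p : C -> R) (u : X -> R) := p (dird B f (fun x => (u x)%:C)).
pose K' := 16 * (K * expR ((L1norm f + alpha) / alpha)) / alpha.
have K'0 : 0 <= K'.
  by apply: divr_ge0 (ltW alpha0); apply: mulr_ge0 => //; rewrite mulr_ge0 ?expR_ge0.
have dual (p : C -> R) : (forall u v, p (u + v) = p u + p v) ->
    (forall (c : R) u, p (c%:C * u) = c * p u) -> (forall u, `|p u| <= abs u) ->
    exists g : X -> R, [/\ measurable_fun setT g, (forall x, `|g x| <= K') &
     forall u : X -> R, mu.-integrable setT (EFin \o u) ->
       Dr p u = \int[mu]_x (g x * u x)].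
  move=> pD pZ ple; apply: l1_dual => //.
  - move=> u v iu iv; rewrite /Dr -pD -(dirdD alpha0 K0 eB bB)//; try exact: L1_real.
    by congr (p (dird _ _ _)); apply/funext => x; rewrite (rmorphD (@real_complex R)).
  - move=> c u iu; rewrite /Dr -pZ -(dirdZ eB)//; try exact: L1_real.
    by congr (p (dird _ _ _)); apply/funext => x; rewrite (rmorphM (@real_complex R)).
  - move=> u iu; rewrite /Dr (le_trans (ple _))//.
    apply: (le_trans (dird_le alpha0 K0 eB bB Lf (L1_real iu))).
    apply: le_eq; congr (_ * _).
    by apply: eq_Rintegral => x _; rewrite abs_real.
have [|g1 [mg1 g1K g1P]] := dual (@complex.Re R) (@cReD R) _ (@ler_Re_abs R).
  by move=> c u; rewrite cReM /= mul0r subr0.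
have [|g2 [mg2 g2K g2P]] := dual (@complex.Im R) (@cImD R) _ (@ler_Im_abs R).
  by move=> c u; rewrite cImM /= mul0r addr0.
pose g x : C := g1 x +i* g2 x.
have gK x : abs (g x) <= K' + K' by rewrite (le_trans (abs_le_ReIm _))//= lerD.
have Lg : Linfty g by split => //; exists (K' + K'); exact: aeW.
have igu (u : X -> R) : mu.-integrable setT (EFin \o u) ->
    L1 (fun x => g x * (u x)%:C).
  by move=> iu; apply: (cintgM_bounded _ (aeW _ gK) (L1_real iu)).
have real_case (u : X -> R) : mu.-integrable setT (EFin \o u) ->
    dird B f (fun x => (u x)%:C) = cintegral (fun x => g x * (u x)%:C).
  move=> iu; apply: complex_eqP => /=.
    rewrite -/(Dr (@complex.Re R) u) g1P//; apply: eq_Rintegral => x _.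
    by rewrite mulr0 subr0.
  rewrite -/(Dr (@complex.Im R) u) g2P//; apply: eq_Rintegral => x _.
  by rewrite mulr0 add0r.
exists g; split => // h Lh; apply/is_derive_cderiv.
have -> : cintegral (fun x => g x * h x) = dird B f h; last exact: (dirdP eB).
have [h1 h2] := Lh.
have hE : h = fun x => (complex.Re (h x))%:C + 'i * (complex.Im (h x))%:C.
  by apply/funext => x; exact: complexE.
rewrite [in RHS]hE (dirdD alpha0 K0 eB bB)//; [|exact: L1_real|exact/L1Z/L1_real].
rewrite (dirdZ eB)//; last exact: L1_real.
rewrite !real_case//; have i2 := igu _ h2.
rewrite -[cintegral _ in X in _ = _ + 'i * X]/(cI mu setT _) -(cIZ _ _ i2)//.
rewrite -[cintegral _ in X in _ = X + _]/(cI mu setT _) -cID//; first last.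
- exact: L1Z.
- exact: igu.
by apply: eq_cI => x _; rewrite {1}(complexE (h x)); ring.
Qed.

Lemma vderivP f : L1 f -> is_vderiv B f (vderiv B f).
Proof.
move=> Lf; rewrite /vderiv; have [g gP] := vderiv_exists Lf.
by apply: xgetPex; exists g.
Qed.

(** Integrating [vderiv B f] against [f] itself gives the derivative of [B] at [f] in the direction
    [f]. This removes the chosen representative from the first term of [Ltilde]. *)
Lemma cI_vderiv f : L1 f ->
  L1 (fun x => f x * vderiv B f x) /\
  cintegral (fun x => f x * vderiv B f x) = dird B f f.
Proof.
move=> Lf; have [[m1 m2 [M gM]] dv] := vderivP Lf.
have E : (fun x => f x * vderiv B f x) = (fun x => vderiv B f x * f x).
  by apply/funext => x; rewrite mulrC.
rewrite E; split; first exact: (cintgM_bounded (conj m1 m2) gM Lf).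
by apply/esym; apply: (dird_eq eB) => //; apply/is_derive_cderiv; exact: dv.
Qed.

End variational_derivative.

(** * The Mayer function and the shifted argument *)

Section boltzmann_factor.
Context {R : realType} {d : nat}.
Local Notation C := (R[i]).
Local Notation X := (Rd R d).
Local Notation mu := (@lebesgue_Rd R d).
Implicit Types (f g h k : X -> C).
Variable phi : X -> \bar R.
Hypothesis hphi : potential phi.

(** The negative of the Mayer function of [phi], equal to 1 where [phi] is infinite. Between 0 and
    [phi], it is integrable, unlike the Boltzmann factor. *)
Definition mayer (u : X) : R := 1 - fine (expeR (- phi u)).

Lemma boltzmannE x y : boltzmann phi x y = (1 - mayer (rdsub x y))%:C.
Proof. by rewrite /boltzmann /mayer opprB addrC subrK. Qed.

Let phi0 u : (0 <= phi u)%E. Proof. by case: hphi. Qed.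

Lemma mayer_ge0 u : 0 <= mayer u.
Proof.
rewrite /mayer; move: (phi0 u); case: (phi u) => [r| |] //=; rewrite ?subr0//.
by rewrite lee_fin => r0; rewrite subr_ge0 expR_le1 oppr_le0.
Qed.

Lemma mayer_le1 u : mayer u <= 1.
Proof. by rewrite /mayer lerBlDr lerDl fine_ge0// expeR_ge0. Qed.

Lemma mayer_le u : ((mayer u)%:E <= phi u)%E.
Proof.
rewrite /mayer; move: (phi0 u); case: (phi u) => [r| |] //=; rewrite ?leey//.
rewrite !lee_fin => r0; rewrite lerBlDr -lerBlDl.
by rewrite (le_trans _ (expR_ge1Dx (- r))).
Qed.

Lemma measurable_mayer : measurable_fun setT mayer.
Proof.
have [mphi _ _ _] := hphi.
apply: measurable_funB => //.
(* Off this set the Boltzmann factor is 0, and on it the real exponential of [fine (phi u)]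
   applies. *)
pose A := [set u | (phi u < +oo)%E].
have mA : measurable A.
  by rewrite -[A]setTI; apply: emeasurable_fun_infty_o.
rewrite (_ : (fun u => _) = (fun u => \1_A u * expR (- fine (phi u)))).
  apply: measurable_funM; first exact: measurable_indic.
  apply: measurableT_comp; first exact: measurable_expR.
  by apply: measurableT_comp => //; apply: measurableT_comp.
apply/funext => u; rewrite indicE; move: (phi0 u).
have [Au|nAu] := boolP (u \in A).
  move: Au; rewrite inE /A /=; case: (phi u) => [r| |] //= _ _.
  by rewrite mul1r.
have : ~ A u by move=> /mem_set; exact/negP.
rewrite /A /=; case: (phi u) => [r| |] //= h _; last by rewrite mul0r.
by exfalso; apply: h; rewrite ltry.
Qed.

Lemma measurable_EFin_mayer : measurable_fun setT (EFin \o mayer).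
Proof. by apply/measurable_EFinP; have := measurable_mayer; exact. Qed.

Lemma integrable_mayer : mu.-integrable setT (EFin \o mayer).
Proof.
have [_ _ _ iphi] := hphi; apply: le_integrable iphi => //.
  exact: measurable_EFin_mayer.
by move=> u _; rewrite !gee0_abs ?phi0 ?lee_fin ?mayer_ge0// mayer_le.
Qed.

Definition mayer_int : R := \int[mu]_u mayer u.

Lemma mayer_int_ge0 : 0 <= mayer_int.
Proof. by apply: Rintegral_ge0 => u _; exact: mayer_ge0. Qed.

Lemma integrable_mayer_shift x : mu.-integrable setT (EFin \o (fun y => mayer (rdsub x y))).
Proof.
have mE := measurable_EFin_mayer.
have E0 u : (0 <= (EFin \o mayer) u)%E by rewrite lee_fin mayer_ge0.
apply/integrableP; split.
  by apply: (measurableT_comp mE); exact: measurable_rdsub.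
under eq_integral => y _ do rewrite gee0_abs ?E0//.
have := ge0_integral_rdsub x mE E0; rewrite /= => ->.
have /integrableP[_] := integrable_mayer.
by under eq_integral => y _ do rewrite gee0_abs ?E0//.
Qed.

Lemma mayer_int_shift x : \int[mu]_y mayer (rdsub x y) = mayer_int.
Proof.
have mE := measurable_EFin_mayer.
have E0 u : (0 <= (EFin \o mayer) u)%E by rewrite lee_fin mayer_ge0.
by rewrite /mayer_int /Rintegral; congr fine; exact: (ge0_integral_rdsub x mE E0).
Qed.

(* The argument [theta e^{-phi(x - .)} + e^{-phi(x - .)} - 1] of [B] in
   [Ltilde], with [e^{-phi} = 1 - mayer]. *)
Definition shiftmap f (x : X) : X -> C :=
  fun y => f y * boltzmann phi x y + boltzmann phi x y - 1.

Lemma L1_boltzmann f x : L1 f -> L1 (fun y => f y * boltzmann phi x y).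
Proof.
move=> Lf; rewrite (_ : (fun y => _) = fun y => boltzmann phi x y * f y); last first.
  by apply/funext => y; rewrite mulrC.
apply: (@cintgM_bounded _ _ _ _ _ _ 1) => //.
  split; last by [].
  rewrite (_ : (fun y => _) = fun y => 1 - mayer (rdsub x y)); last first.
    by apply/funext => y; rewrite boltzmannE.
  apply: measurable_funB => //.
  by apply: (measurableT_comp measurable_mayer); exact: measurable_rdsub.
apply: aeW => y; rewrite boltzmannE abs_real ger0_norm ?subr_ge0 ?mayer_le1//.
by rewrite lerBlDr lerDl mayer_ge0.
Qed.

Lemma L1norm_boltzmann f x : L1 f ->
  L1norm (fun y => f y * boltzmann phi x y) <= L1norm f.
Proof.
move=> Lf; apply: L1norm_le; [exact: L1_boltzmann|exact: integrable_L1abs|].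
move=> y; rewrite absM boltzmannE abs_real ger0_norm ?subr_ge0 ?mayer_le1//.
by rewrite ler_piMr ?abs_ge0// lerBlDr lerDl mayer_ge0.
Qed.

Lemma shiftmapE f x : shiftmap f x =
  fun y => f y * boltzmann phi x y + (- 1) * (mayer (rdsub x y))%:C.
Proof.
apply/funext => y; rewrite /shiftmap boltzmannE.
by rewrite (rmorphB (@real_complex R)) /=; ring.
Qed.

Lemma L1_shiftmap f x : L1 f -> L1 (shiftmap f x).
Proof.
move=> Lf; rewrite shiftmapE; apply: L1DZ; first exact: L1_boltzmann.
exact/L1_real/integrable_mayer_shift.
Qed.

Lemma L1norm_shiftmap f x : L1 f -> L1norm (shiftmap f x) <= L1norm f + mayer_int.
Proof.
move=> Lf; rewrite shiftmapE.
have Lm : L1 (fun y => (mayer (rdsub x y))%:C).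
  exact/L1_real/integrable_mayer_shift.
rewrite (le_trans (L1normDZ _ (L1_boltzmann x Lf) Lm))// absN abs1 mul1r.
rewrite lerD ?L1norm_boltzmann// -(mayer_int_shift x); apply: le_eq; apply: eq_Rintegral => y _.
by rewrite abs_real ger0_norm// mayer_ge0.
Qed.

(** The shift is affine in [f] and so maps complex lines to complex lines, along which [B] is
    holomorphic. *)
Lemma shiftmapDZ f h w x : shiftmap (fun y => f y + w * h y) x =
  fun y => shiftmap f x y + w * (h y * boltzmann phi x y).
Proof. by apply/funext => y; rewrite /shiftmap; ring. Qed.

Lemma cmeas_shiftmap f : L1 f -> cmeas (fun p : X * X => shiftmap f p.1 p.2).
Proof.
move=> Lf; have [m1 m2] := cintg_cmeas Lf.
have mm : measurable_fun setT (fun p : X * X => mayer (rdsub p.1 p.2)).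
  by apply: (measurableT_comp measurable_mayer); exact: measurable_rdsub2.
split.
  rewrite (_ : (fun p => _) = fun p : X * X => complex.Re (f p.2) *
      (1 - mayer (rdsub p.1 p.2)) - mayer (rdsub p.1 p.2)); last first.
    apply/funext => p; rewrite shiftmapE boltzmannE.
    by rewrite cReD cReM cReM cReN /=; ring.
  apply: measurable_funB => //; apply: measurable_funM.
    exact: (measurableT_comp m1 measurable_snd).
  by apply: measurable_funB.
rewrite (_ : (fun p => _) = fun p : X * X => complex.Im (f p.2) *
    (1 - mayer (rdsub p.1 p.2))); last first.
  apply/funext => p; rewrite shiftmapE boltzmannE.
  by rewrite cImD cImM cImM cImN cReN /=; ring.
apply: measurable_funM; last exact: measurable_funB.
exact: (measurableT_comp m2 measurable_snd).
Qed.

End boltzmann_factor.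

(** * The generator *)

Section generator.
Context {R : realType} {d : nat}.
Local Notation C := (R[i]).
Local Notation X := (Rd R d).
Local Notation mu := (@lebesgue_Rd R d).
Implicit Types (f g h k : X -> C) (B : (X -> C) -> C).
Variables (phi : X -> \bar R) (z : R).
Hypothesis hphi : potential phi.
Hypothesis z0 : 0 < z.

(** The nonlocal term with its two occurrences of theta separated: [k] is the linear prefactor, [f]
    the argument inside [B]. Holomorphy is proved in [f] for fixed [k]. *)
Definition gain B f k : C := cI mu setT (fun x => k x * B (shiftmap phi f x)).

Section one_functional.
Variables (alpha K : R) (B : (X -> C) -> C).
Hypothesis alpha0 : 0 < alpha.
Hypothesis K0 : 0 <= K.
Hypothesis eB : entire B.
Hypothesis bB : expbound alpha K B.

Lemma cmeas_shift f : L1 f -> cmeas (fun x => B (shiftmap phi f x)).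
Proof.
move=> Lf; have [m1 m2] := cmeas_shiftmap hphi Lf.
apply: (@measurable_continuous_comp _ _ X X R mu (shiftmap phi f) B m1 m2).
  by move=> x; exact: L1_shiftmap.
move=> u Lu e e0.
have [dl dl0 H] := entire_continuous alpha0 K0 eB bB Lu e0.
exists dl => // g Lg ug; apply: H => //.
by rewrite -lte_fin L1norm_EFin//; exact: L1B.
Qed.

Lemma abs_shift_le f x : L1 f ->
  abs (B (shiftmap phi f x)) <= K * expR ((L1norm f + mayer_int phi) / alpha).
Proof.
move=> Lf; rewrite (le_trans (bB (L1_shiftmap hphi x Lf)))// ler_wpM2l//.
by rewrite ler_expR ler_pM2r ?invr_gt0// L1norm_shiftmap.
Qed.

Lemma L1_gain f k : L1 f -> L1 k -> L1 (fun x => k x * B (shiftmap phi f x)).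
Proof.
move=> Lf Lk; rewrite (_ : (fun x => _) = (fun x => B (shiftmap phi f x) * k x)).
  apply: (cintgM_bounded (cmeas_shift Lf) _ Lk).
  by apply: aeW => x; exact: abs_shift_le.
by apply/funext => x; rewrite mulrC.
Qed.

(** Both terms on the right are free of the representative chosen by [xget], so linearity,
    invariance under a.e. equality and holomorphy of [Ltilde] are read off from this form. *)
Lemma LtildeE f : L1 f -> Ltilde z phi B f = - dird B f f + z%:C * gain B f f.
Proof.
move=> Lf; have [Lv Ev] := cI_vderiv alpha0 K0 eB bB Lf.
have Lg := L1_gain Lf Lf.
rewrite /Ltilde -Ev /gain -cIZ//.
rewrite -[cintegral _ in LHS]/(cI mu setT _) -[cintegral _ in RHS]/(cI mu setT _).
have LZ := L1Z z%:C Lg.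
rewrite -[RHS]opprK opprD opprK -cIB//.
by congr (- _); apply: eq_cI => x _; rewrite /shiftmap; ring.
Qed.

Lemma abs_gain_le f k : L1 f -> L1 k ->
  abs (gain B f k) <= 2 * (K * expR ((L1norm f + mayer_int phi) / alpha)) * L1norm k.
Proof.
move=> Lf Lk; set M := K * _.
rewrite /gain -mulrA -RintegralZl//; last exact: integrable_L1abs.
apply: abs_cI_le => //; first exact: L1_gain.
  exact: (integrableZl measurableT M (integrable_L1abs Lk)).
move=> x _; rewrite absM mulrC ler_wpM2r ?abs_ge0//; exact: abs_shift_le.
Qed.

(** The two terms share the factor [L1norm f * expR (L1norm f / alpha)]. Its unbounded first part is
    why the image is estimated at a smaller index. *)
Lemma abs_Ltilde_le f : L1 f -> abs (Ltilde z phi B f) <=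
  K * L1norm f * expR (L1norm f / alpha) *
    (16 * expR 1 / alpha + 2 * z * expR (mayer_int phi / alpha)).
Proof.
move=> Lf; rewrite LtildeE// (le_trans (absD _ _))// absN absM abs_real gtr0_norm//.
have h1 := dird_le alpha0 K0 eB bB Lf Lf.
have h2 := abs_gain_le Lf Lf.
have E1 : (L1norm f + alpha) / alpha = L1norm f / alpha + 1.
  by rewrite mulrDl divff// gt_eqF.
have E2 : (L1norm f + mayer_int phi) / alpha = L1norm f / alpha + mayer_int phi / alpha.
  by rewrite mulrDl.
rewrite E1 expRD in h1; rewrite E2 expRD in h2.
have h2' := ler_wpM2l (ltW z0) h2.
apply: (le_trans (lerD h1 h2')); apply: le_eq.
by ring.
Qed.

(** On the unit disc about [a] the integrand without [k x] is bounded by [M] independently of [x],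
    so the quotient estimate holds with one constant and can be integrated against [abs (k x)]. No
    derivative is taken under the integral sign. *)
Lemma gain_holo f h k : L1 f -> L1 h -> L1 k ->
  holo (fun w => gain B (fun x => f x + w * h x) k).
Proof.
move=> Lf Lh Lk a.
pose Fw w x := f x + w * h x.
have LF w : L1 (Fw w) by exact: L1DZ.
pose hb x y := h y * boltzmann phi x y.
have Lhb x : L1 (hb x) by exact: L1_boltzmann.
pose M := K * expR ((L1norm (Fw a) + mayer_int phi + 1 * L1norm h) / alpha).
have M0 : 0 <= M by exact: expbound_exp_ge0.
pose D := 2048 * M / 1 ^+ 2.
apply: (@quotient_cderiv _ _ a (1 / 4) (2 * (D * L1norm k))).
  by rewrite divr_gt0.
move=> s s' s4 s'4.
pose G w x : C := k x * B (shiftmap phi (Fw w) x).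
have LG w : L1 (G w) by exact: L1_gain.
have L1a : L1 (fun x => s' * (G (a + s) x - G a x)) by apply: L1Z; exact: L1B.
have L2a : L1 (fun x => s * (G (a + s') x - G a x)) by apply: L1Z; exact: L1B.
have -> : s' * (gain B (Fw (a + s)) k - gain B (Fw a) k) -
    s * (gain B (Fw (a + s')) k - gain B (Fw a) k) =
    cI mu setT (fun x => s' * (G (a + s) x - G a x) - s * (G (a + s') x - G a x)).
  rewrite (cIB measurableT L1a L2a) (cIZ measurableT s' (L1B (LG _) (LG _))).
  rewrite (cIZ measurableT s (L1B (LG _) (LG _))).
  by rewrite (cIB measurableT (LG _) (LG _)) (cIB measurableT (LG _) (LG _)).
set S := abs s * abs s' * (abs s + abs s').
have mulE (a1 a2 a3 : R) : 2 * (a1 * a2) * a3 = 2 * ((a1 * a3) * a2) by ring.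
rewrite mulE -RintegralZl//; last exact: integrable_L1abs.
apply: abs_cI_le => //; first exact: L1B.
  exact: (integrableZl measurableT (D * S) (integrable_L1abs Lk)).
move=> x _.
pose q := along B (shiftmap phi (Fw a) x) (hb x).
have GE w : G (a + w) x = k x * q (0 + w).
  rewrite /G /q /along add0r; congr (_ * B _).
  rewrite -shiftmapDZ; congr (shiftmap _ _ _).
  by apply/funext => y; rewrite /Fw; ring.
have GE0 : G a x = k x * q 0.
  by rewrite /G /q /along; congr (_ * B _); apply/funext => y; rewrite mul0r addr0.
have Lsx := L1_shiftmap hphi x (LF a).
have qest := @quotient_estimate _ q 0 s s' 1 M (along_holo eB Lsx (Lhb x)) ltr01.
have {}qest : abs (s' * (q (0 + s) - q 0) - s * (q (0 + s') - q 0)) <= D * S.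
  apply: qest; [|exact: ltW|exact: ltW].
  move=> w; rewrite subr0 => w1.
  rewrite (le_trans (along_le alpha0 K0 bB Lsx (Lhb x) w1))// ler_wpM2l//.
  rewrite ler_expR ler_pM2r ?invr_gt0// lerD ?L1norm_shiftmap// !mul1r.
  exact: L1norm_boltzmann.
rewrite !GE GE0.
have -> : s' * (k x * q (0 + s) - k x * q 0) - s * (k x * q (0 + s') - k x * q 0) =
   k x * (s' * (q (0 + s) - q 0) - s * (q (0 + s') - q 0)) by ring.
by rewrite absM [leRHS]mulrC ler_wpM2l ?abs_ge0.
Qed.

Lemma Ltilde_holo f h : L1 f -> L1 h -> holo (along (Ltilde z phi B) f h).
Proof.
move=> Lf Lh; pose Fw (w : C) x := f x + w * h x.
have LF w : L1 (Fw w) by exact: L1DZ.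
(* Expanding the outer occurrence of [f + w h] by linearity leaves sums and products of functions of
   [w] already known to be holomorphic. *)
have -> : along (Ltilde z phi B) f h = fun w =>
    ((0 - dird B (Fw w) f) - w * dird B (Fw w) h) +
     (z%:C * gain B (Fw w) f + z%:C * (w * gain B (Fw w) h)).
  apply/funext => w; rewrite /along -/(Fw w) LtildeE//.
  rewrite [X in dird B _ X](_ : Fw w = fun x => f x + w * h x)//.
  rewrite (dirdD alpha0 K0 eB bB)//; last exact: L1Z.
  rewrite (dirdZ eB)// /gain.
  have Lg1 := L1_gain (LF w) Lf; have Lg2 := L1_gain (LF w) Lh.
  rewrite -(cIZ measurableT w Lg2) -mulrDr -(cID measurableT Lg1 (L1Z w Lg2)).
  have -> : cI mu setT (fun x => Fw w x * B (shiftmap phi (Fw w) x)) =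
      cI mu setT (fun x => f x * B (shiftmap phi (Fw w) x) +
        w * (h x * B (shiftmap phi (Fw w) x))).
    by apply: eq_cI => x _; rewrite {1}/Fw mulrDl mulrA.
  by rewrite opprD sub0r.
apply: holoD.
  apply: holoB; first by apply: holoB; [exact: holo_cst|exact: (dird_holo alpha0 K0 eB bB)].
  by apply: holoM; [exact: holo_id|exact: (dird_holo alpha0 K0 eB bB)].
apply: holoD; apply: holoM; try exact: holo_cst; first exact: gain_holo.
by apply: holoM; [exact: holo_id|exact: gain_holo].
Qed.

Lemma Ltilde_functional : L1functional (Ltilde z phi B).
Proof.
move=> f g Lf Lg fg; rewrite !LtildeE// (dird_aeq eB Lf Lg fg); congr (_ + _ * _).
have BL : L1functional B by case: eB.
have Bs x : B (shiftmap phi f x) = B (shiftmap phi g x).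
  apply: BL; [exact: L1_shiftmap|exact: L1_shiftmap|].
  by apply: filterS fg => y fgy; rewrite /shiftmap fgy.
rewrite /gain; apply: cI_ae_eq.
- by apply: cintg_cmeas; exact: L1_gain.
- by apply: cintg_cmeas; exact: L1_gain.
by apply: filterS fg => x fgx /=; rewrite fgx Bs.
Qed.

Lemma Ltilde_entire : entire (Ltilde z phi B).
Proof.
split; first exact: Ltilde_functional.
  apply: (@locally_bounded_mono _ _ (fun r => K * r * expR (r / alpha) * (16 * expR 1 / alpha +
    2 * z * expR (mayer_int phi / alpha))) _ _ abs_Ltilde_le) => r s rp rs.
  rewrite ler_wpM2r//.
    rewrite addr_ge0//; first by rewrite divr_ge0 ?mulr_ge0 ?expR_ge0// ltW.
    by rewrite mulr_ge0 ?expR_ge0// mulr_ge0// ltW.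
  by rewrite ler_pM ?mulr_ge0 ?expR_ge0// ?ler_wpM2l// ler_expR ler_pM2r ?invr_gt0.
move=> f h Lf Lh; apply/holo_derivable; exact: Ltilde_holo.
Qed.

(* [s e^{s/alpha} <= e^{s/alpha'} / (1/alpha' - 1/alpha)], from [t <= e^t] at
   [t = s (1/alpha' - 1/alpha)]. *)
Lemma mul_expR_le (alpha' s : R) : 0 < alpha' -> alpha' < alpha -> 0 <= s ->
  s * expR (s / alpha) <= alpha * alpha' / (alpha - alpha') * expR (s / alpha').
Proof.
move=> a'0 aa s0; have da : 0 < alpha - alpha' by rewrite subr_gt0.
pose t := s * (alpha - alpha') / (alpha * alpha').
have st : s = alpha * alpha' / (alpha - alpha') * t.
  by rewrite /t; field; rewrite !gt_eqF.
have E : s / alpha' = s / alpha + t by rewrite /t; field; rewrite !gt_eqF.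
rewrite E expRD {1}st -mulrA ler_wpM2l//.
  by rewrite divr_ge0 ?mulr_ge0 ?(ltW alpha0) ?(ltW a'0) ?(ltW da).
rewrite mulrC ler_wpM2l ?expR_ge0//.
by rewrite (le_trans _ (expR_ge1Dx t))// lerDr.
Qed.

(** A constant valid on the whole scale from [amin] to [a0]: the product [alpha * alpha'] is at most
    [a0 ^+ 2], and the bracket is largest at the lower end. *)
Definition gen_const (amin a0 : R) : R :=
  a0 ^+ 2 * (16 * expR 1 / amin + 2 * z * expR (mayer_int phi / amin)).

Lemma gen_const_gt0 (amin a0 : R) : 0 < amin -> 0 < a0 -> 0 < gen_const amin a0.
Proof.
move=> m0 a00; rewrite mulr_gt0 ?exprn_gt0// addr_gt0//.
  by rewrite divr_gt0// mulr_gt0// expR_gt0.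
by rewrite !mulr_gt0// expR_gt0.
Qed.

Lemma Ltilde_expbound (amin a0 alpha' : R) : 0 < amin -> amin <= alpha' ->
  alpha' < alpha -> alpha <= a0 ->
  expbound alpha' (K * gen_const amin a0 / (alpha - alpha')) (Ltilde z phi B).
Proof.
move=> m0 ma' aa aa0 f Lf; have a'0 := lt_le_trans m0 ma'.
have da : 0 < alpha - alpha' by rewrite subr_gt0.
have ma : amin <= alpha by rewrite (le_trans ma')// ltW.
rewrite (le_trans (abs_Ltilde_le Lf))//.
set Q := 16 * expR 1 / alpha + _.
pose Q' := 16 * expR 1 / amin + 2 * z * expR (mayer_int phi / amin).
have Q0 : 0 <= Q.
  rewrite addr_ge0//; first by rewrite divr_ge0 ?mulr_ge0 ?expR_ge0// ltW.
  by rewrite mulr_ge0 ?expR_ge0// mulr_ge0// ltW.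
have Va : alpha^-1 <= amin^-1 by rewrite lef_pV2 ?posrE.
have QQ : Q <= Q'.
  apply: lerD; first by rewrite ler_wpM2l// mulr_ge0// expR_ge0.
  rewrite ler_wpM2l ?mulr_ge0 ?(ltW z0)// ler_expR ler_wpM2l//.
  exact: mayer_int_ge0.
have h := mul_expR_le a'0 aa (L1norm_ge0 f).
rewrite -[K * L1norm f * _]mulrA.
apply: (@le_trans _ _ (K * (alpha * alpha' / (alpha - alpha') *
    expR (L1norm f / alpha')) * Q')).
  apply: ler_pM => //; last by rewrite ler_wpM2l.
  by rewrite !mulr_ge0 ?L1norm_ge0 ?expR_ge0.
have Q'0 : 0 <= Q' by exact: le_trans QQ.
rewrite [leLHS](_ : _ = (K * Q' / (alpha - alpha') * expR (L1norm f / alpha')) *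
  (alpha * alpha')); last by ring.
rewrite [leRHS](_ : _ = (K * Q' / (alpha - alpha') * expR (L1norm f / alpha')) *
  a0 ^+ 2); last by rewrite /gen_const -/Q'; ring.
rewrite ler_wpM2l//.
  by rewrite mulr_ge0 ?expR_ge0// divr_ge0 ?mulr_ge0// ltW.
rewrite expr2 ler_pM// ?(ltW alpha0) ?(ltW a'0)//.
by rewrite (le_trans (ltW aa)).
Qed.

End one_functional.

Lemma entire_lin B B' (a b : C) : entire B -> entire B' ->
  entire (fun f => a * B f + b * B' f).
Proof.
move=> [BL Bb Bd] [B'L B'b B'd]; split.
- by move=> f g Lf Lg fg; rewrite (BL f g)// (B'L f g).
- move=> f0 Lf0; have [r [M [r0 rM]]] := Bb _ Lf0; have [r' [M' [r'0 rM']]] := B'b _ Lf0.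
  exists (Num.min r r'), (abs a * M + abs b * M'); split; first by rewrite lt_min r0.
  move=> f Lf; rewrite lt_min => /andP[fr fr'].
  rewrite (le_trans (absD _ _))// !absM lerD//.
    by rewrite ler_wpM2l ?abs_ge0// rM.
  by rewrite ler_wpM2l ?abs_ge0// rM'.
- move=> f h Lf Lh; apply/holo_derivable.
  have h1 : holo (along B f h) by apply/holo_derivable; exact: Bd.
  have h2 : holo (along B' f h) by apply/holo_derivable; exact: B'd.
  by apply: holoD; apply: holoM => //; exact: holo_cst.
Qed.

Lemma expbound_lin B B' (a b : C) alpha K K' : expbound alpha K B -> expbound alpha K' B' ->
  expbound alpha (abs a * K + abs b * K') (fun f => a * B f + b * B' f).
Proof.
move=> h h' f Lf; rewrite (le_trans (absD _ _))// !absM mulrDl -!mulrA.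
by rewrite lerD// ler_wpM2l ?abs_ge0 ?h ?h'.
Qed.

Lemma entire_ext B B' : (forall f, L1 f -> B f = B' f) -> entire B -> entire B'.
Proof.
move=> BB [BL Bb Bd]; split.
- by move=> f g Lf Lg fg; rewrite -!BB//; exact: BL.
- move=> f0 Lf0; have [r [M [r0 rM]]] := Bb _ Lf0.
  by exists r, M; split => // f Lf fr; rewrite -BB// rM.
- move=> f h Lf Lh w; have -> : along B' f h = along B f h; last exact: Bd.
  by apply/funext => v; rewrite /along BB//; exact: L1DZ.
Qed.

(** Not formal, since [vderiv] is chosen separately for each functional; it follows from uniqueness
    of the directional derivative and linearity of the integral. *)
Lemma Ltilde_lin B B' (a b : C) alpha K K' f : 0 < alpha -> 0 <= K -> 0 <= K' ->
  entire B -> entire B' -> expbound alpha K B -> expbound alpha K' B' -> L1 f ->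
  Ltilde z phi (fun f => a * B f + b * B' f) f =
  a * Ltilde z phi B f + b * Ltilde z phi B' f.
Proof.
move=> al0 K0 K'0 eB eB' bB bB' Lf.
have eL := entire_lin a b eB eB'; have bL := expbound_lin a b bB bB'.
have KL : 0 <= abs a * K + abs b * K' by rewrite addr_ge0// mulr_ge0// abs_ge0.
rewrite (LtildeE al0 KL eL bL Lf) (LtildeE al0 K0 eB bB Lf) (LtildeE al0 K'0 eB' bB' Lf).
have -> : dird (fun f => a * B f + b * B' f) f f = a * dird B f f + b * dird B' f f.
  apply: (dird_eq eL) => //; apply: cderivD; apply: cderivZ; exact: dirdP.
have -> : gain (fun f => a * B f + b * B' f) f f = a * gain B f f + b * gain B' f f.
  have g1 := L1_gain al0 K0 eB bB Lf Lf; have g2 := L1_gain al0 K'0 eB' bB' Lf Lf.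
  rewrite /gain -(cIZ measurableT a g1) -(cIZ measurableT b g2).
  rewrite -(cID measurableT (L1Z a g1) (L1Z b g2)).
  by apply: eq_cI => x _; ring.
by ring.
Qed.

End generator.

(** * Uniqueness *)

Section norm_convergence.
Context {R : realType} {d : nat}.
Local Notation C := (R[i]).
Local Notation X := (Rd R d).

Lemma Enorm_cvg0 (I : Type) (F : set_system I) (FF : Filter F) (alpha : R)
    (Y : I -> (X -> C) -> C) :
  (Enorm alpha (Y s) @[s --> F] --> 0%E) <->
  (forall e : R, 0 < e -> \forall s \near F, expbound alpha e (Y s)).
Proof.
split=> [H e e0|H].
  have /fine_cvgP[H1 /cvgrPdist_le/(_ e e0) H2] := H.
  apply: filterS2 H1 H2 => s fs; rewrite /= sub0r normrN => Hs.
  by apply/EnormP; rewrite -[leLHS]fineK// lee_fin (le_trans _ Hs)// ler_norm.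
have fin e s : expbound alpha e (Y s) ->
    Enorm alpha (Y s) \is a fin_num /\ `|fine (Enorm alpha (Y s))| <= e.
  move=> /EnormP h; have f : Enorm alpha (Y s) \is a fin_num.
    by rewrite ge0_fin_numE ?Enorm_ge0// (le_lt_trans h)// ltry.
  split => //; rewrite ger0_norm ?fine_ge0 ?Enorm_ge0//.
  by rewrite -lee_fin fineK.
apply/fine_cvgP; split.
  by apply: filterS (H 1 ltr01) => s /fin[].
apply/cvgrPdist_le => e e0.
by apply: filterS (H e e0) => s /fin[_]; rewrite sub0r normrN.
Qed.

Lemma expbound_ext alpha K (B B' : (X -> C) -> C) : (forall f, L1 f -> B f = B' f) ->
  expbound alpha K B -> expbound alpha K B'.
Proof. by move=> BB h f Lf; rewrite -BB// h. Qed.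

Lemma expbound_le alpha K K' (B : (X -> C) -> C) : K <= K' ->
  expbound alpha K B -> expbound alpha K' B.
Proof.
by move=> KK h f Lf; rewrite (le_trans (h f Lf))// ler_wpM2r// expR_ge0.
Qed.

(* [(1 + 1/n)^n <= e], for the optimal splitting of the interval
   [alpha', alpha] into [n + 1] pieces. *)
Lemma scale_split_le (x : R) n : 0 <= x ->
  x ^+ n <= expR 1 * (x - x / n.+1%:R) ^+ n.
Proof.
move=> x0; case: n => [|n].
  by rewrite !expr0 mulr1 (le_trans _ (expR_ge1Dx 1))// lerDl.
have E : x = (1 + n.+1%:R^-1) * (x - x / n.+2%:R).
  rewrite -[n.+2%:R]nat1r; field.
  by rewrite !nat1r !pnatr_eq0.
rewrite {1}E exprMn ler_wpM2r//.
  apply: exprn_ge0; rewrite subr_ge0 ler_piMr// invf_le1 ?ler1n// ltr0n//.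
rewrite (@le_trans _ _ (expR (n.+1%:R^-1) ^+ n.+1))//.
  by rewrite ler_pXn2r ?nnegrE ?expR_ge0 ?addr_ge0// expR_ge1Dx.
by rewrite -expRM_natl mulfV ?pnatr_eq0.
Qed.

(** One step of the splitting: [a''] lies [1 / (n + 1)] of the way from [a'] to [a], and the
    remaining [n] steps are left to the induction that uses it. For [n = 0] it is [a] itself, and
    the powers are 1. *)
Lemma intermediate_scale (a' a : R) n : a' < a -> exists a'',
  [/\ a' < a'', a'' <= a, 0 < (a - a'') ^+ n, a'' - a' = (a - a') / n.+1%:R &
      (a - a') ^+ n <= expR 1 * (a - a'') ^+ n].
Proof.
rewrite -subr_gt0 => dl0; exists (a' + (a - a') / n.+1%:R).
have n1 : (0 : R) < n.+1%:R by rewrite ltr0n.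
have -> : a - (a' + (a - a') / n.+1%:R) = (a - a') - (a - a') / n.+1%:R.
  by rewrite opprD addrA.
split; last exact/scale_split_le/ltW.
- by rewrite ltrDl divr_gt0.
- by rewrite -lerBrDl ler_piMr ?(ltW dl0)// invf_le1 ?ler1n.
- case: n n1 => [|n] _; first by rewrite expr0.
  by rewrite exprn_gt0// subr_gt0 gtr_pMr// invf_lt1 ?ltr0n// ltr1n.
- by rewrite addrAC subrr add0r.
Qed.

End norm_convergence.

Section uniqueness.
Context {R : realType} {d : nat}.
Local Notation C := (R[i]).
Local Notation X := (Rd R d).
Variables (phi : X -> \bar R) (z : R).
Hypothesis hphi : potential phi.
Hypothesis z0 : 0 < z.
Local Notation L := (Ltilde z phi).
Variables (alpha T : R).
Hypothesis alpha0 : 0 < alpha.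

(** Uniqueness works below [alpha], since arbitrary solutions are controlled in [calE alpha] only;
    the lower end [alpha / 2] is a choice. *)
Let Mg : R := gen_const phi z (alpha / 2) alpha.

Let Mg0 : 0 < Mg.
Proof. by apply: gen_const_gt0 => //; rewrite divr_gt0. Qed.

Section difference.
Variable D : R -> (X -> C) -> C.
Hypothesis eD : forall t, 0 <= t < T -> entire (D t).
Hypothesis cD : forall t, 0 <= t < T -> forall e : R, 0 < e ->
  exists2 dl : R, 0 < dl & forall s, 0 <= s < T -> `|s - t| < dl ->
    expbound alpha e (fun f => D s f - D t f).
Hypothesis bD : forall t, 0 <= t < T -> exists2 K, 0 <= K & expbound alpha K (D t).
Hypothesis dD : forall t, 0 < t < T -> forall f, L1 f ->
  rderiv (fun s => D s f) t (L (D t) f).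

(** By the triangle inequality the norm of [D t] is continuous in time, so it has a maximum on the
    compact interval. The iteration starts from this single constant. *)
Lemma uniform_expbound (t0 : R) : 0 <= t0 < T -> exists2 K, 0 <= K &
  forall t, 0 <= t <= t0 -> expbound alpha K (D t).
Proof.
move=> /andP[t00 t0T].
have inT t : 0 <= t <= t0 -> 0 <= t < T.
  by move=> /andP[-> tt0] /=; exact: le_lt_trans t0T.
pose N t := fine (Enorm alpha (D t)).
have NP t : 0 <= t <= t0 -> expbound alpha (N t) (D t).
  move=> tt; have [K K0 bK] := bD (inT _ tt); apply/EnormP; rewrite fineK//.
  rewrite ge0_fin_numE ?Enorm_ge0//.
  by apply: le_lt_trans (ltry K); exact/EnormP.
have Nle t K : 0 <= t <= t0 -> expbound alpha K (D t) -> N t <= K.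
  move=> tt /EnormP h; rewrite -lee_fin fineK//.
  by rewrite ge0_fin_numE ?Enorm_ge0// (le_lt_trans h)// ltry.
have N0 t : 0 <= N t by exact/fine_ge0/Enorm_ge0.
have cN : {within `[0, t0], continuous N}.
  apply: within_continuous_eps => t tt e e0.
  have [dl dl0 H] := cD (inT _ tt) e0; exists dl => // s ss sd.
  have h := H s (inT _ ss) sd.
  have h1 : N s <= N t + e.
    apply: Nle => //; apply: (@expbound_ext _ _ _ _ (fun f => 1 * D t f + 1 * (D s f - D t f))).
      by move=> f _; ring.
    apply: expbound_le (expbound_lin 1 1 (NP _ tt) h).
    by rewrite abs1 !mul1r.
  have h2 : N t <= N s + e.
    apply: Nle => //; apply: (@expbound_ext _ _ _ _ (fun f => 1 * D s f + (-1) * (D s f - D t f))).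
      by move=> f _; ring.
    apply: expbound_le (expbound_lin 1 (-1) (NP _ ss) h).
    by rewrite absN abs1 !mul1r.
  by rewrite ler_norml; apply/andP; split; rewrite ?lerBrDr ?lerBlDr; lra.
have [c c0 maxN] := EVT_max t00 cN.
exists (N c) => // t tt; apply: expbound_le (NP t tt); apply: maxN.
by rewrite in_itv.
Qed.

(** The power of [alpha - alpha'] stands on the left so that [alpha' = alpha] is included. No
    factorial appears: the factor [n + 1] from a scale step of relative length [1 / (n + 1)] cancels
    the one from integrating [(s - t1) ^+ n]. *)
Lemma iterated_bound (t1 t0 K : R) : 0 <= t1 -> t0 < T -> 0 <= K ->
  (forall f, L1 f -> D t1 f = 0) ->
  (forall t, t1 <= t <= t0 -> expbound alpha K (D t)) ->
  forall n alpha' t f, alpha / 2 <= alpha' -> alpha' <= alpha -> t1 <= t <= t0 ->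
    L1 f -> (alpha - alpha') ^+ n * abs (D t f) <=
      K * (expR 1 * Mg * (t - t1)) ^+ n * expR (L1norm f / alpha').
Proof.
move=> t10 t0T K0 D1 bK; set A := expR 1 * Mg.
have A0 : 0 < A by rewrite mulr_gt0 ?Mg0// expR_gt0.
have a2 : 0 < alpha / 2 by rewrite divr_gt0.
have inT t : t1 <= t <= t0 -> 0 <= t < T.
  by move=> /andP[t1t tt0]; rewrite (le_trans t10)//= (le_lt_trans tt0).
elim=> [|n IH] alpha' t f aa' a'a tt Lf.
  rewrite !expr0 mul1r mulr1.
  by apply: (expbound_weaken (lt_le_trans a2 aa') a'a K0 (bK t tt)).
have [t1t tt0] := andP tt.
have a'0 := lt_le_trans a2 aa'.
(* At the upper end the left-hand side is zero, the exponent being at least 1. *)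
have [->|a'n] := eqVneq alpha' alpha.
  rewrite subrr expr0n mul0r !mulr_ge0 ?expR_ge0// exprn_ge0// mulr_ge0 ?(ltW A0)//.
  by rewrite subr_ge0.
have a'a1 : alpha' < alpha by rewrite lt_neqAle a'n.
have [a'' [a'a'' a''a q0 a''1 split_le]] := intermediate_scale n a'a1.
have dl0 : 0 < alpha - alpha' by rewrite subr_gt0.
set dl := alpha - alpha' in dl0 a''1 split_le *.
have n1 : (0 : R) < n.+1%:R by rewrite ltr0n.
have a''0 : 0 < a'' by exact: lt_trans a'a''.
have bs s : t1 <= s <= t0 -> expbound a'' (K * (A * (s - t1)) ^+ n / (alpha - a'') ^+ n) (D s).
  move=> ss g Lg; have := IH a'' s g (le_trans aa' (ltW a'a'')) a''a ss Lg.
  rewrite [in X in _ -> X]mulrAC ler_pdivlMr// [in X in _ -> X]mulrC => /le_trans; apply.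
  by [].
pose Kc := K * A ^+ n / (alpha - a'') ^+ n * Mg / (a'' - alpha') * expR (L1norm f / alpha').
have sn s : t1 <= s <= t0 -> 0 <= s - t1 by move=> /andP[h _]; rewrite subr_ge0.
have bL s : t1 <= s <= t0 -> abs (L (D s) f) <= Kc * (s - t1) ^+ n.
  move=> ss; have Ks0 : 0 <= K * (A * (s - t1)) ^+ n / (alpha - a'') ^+ n.
    by rewrite divr_ge0 ?(ltW q0)// mulr_ge0// exprn_ge0// mulr_ge0 ?(ltW A0)// sn.
  have := Ltilde_expbound hphi z0 a''0 Ks0 (eD (inT _ ss)) (bs s ss) a2 aa' a'a'' a''a Lf.
  move=> /le_trans; apply; apply: le_eq.
  by rewrite -/Mg /Kc exprMn; ring.
(* The derivative [L (D s) f] is dominated by [Kc * (s - t1) ^+ n], whose antiderivative vanishing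
   at [t1] serves as majorant. *)
have := @growth R (fun s => D s f) (fun s => Kc * ((s - t1) ^+ n.+1 / n.+1%:R))
  (fun s => Kc * (s - t1) ^+ n) t1 t t1t.
rewrite D1// subr0 [in X in _ -> _ -> _ -> X]subrr expr0n mul0r mulr0 subr0 => G.
have {}G : abs (D t f) <= Kc * ((t - t1) ^+ n.+1 / n.+1%:R).
  apply: G.
  - move=> s /andP[t1s st] e e0.
    have ss : t1 <= s <= t0 by rewrite t1s (le_trans st).
    have ex0 : 0 < expR (L1norm f / alpha) by exact: expR_gt0.
    have [dl' dl'0 H] := cD (inT _ ss) (divr_gt0 e0 ex0).
    exists dl' => // r /andP[t1r rt] rd.
    have rr : t1 <= r <= t0 by rewrite t1r (le_trans rt).
    have := H r (inT _ rr) rd f Lf.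
    by rewrite divfK// gt_eqF.
  - move=> s /andP[t1s st].
    have ss : t1 <= s <= t0 by rewrite !ltW//= (lt_le_trans st).
    exists (L (D s) f); first exact: bL.
    by apply: dD => //; rewrite (le_lt_trans t10)//= (lt_trans st)// (le_lt_trans tt0).
  - move=> s.
    have h1 : is_derive s 1 (fun s : R => s - t1) 1.
      by rewrite -[X in is_derive _ _ _ X]subr0; apply: is_deriveB.
    have h2 := @is_deriveX _ _ (fun s : R => s - t1) n.+1 s 1 1 h1.
    have h3 := @is_deriveZ _ _ _ _ (Kc / n.+1%:R) s 1 _ h2.
    have E1 : (fun s => Kc * ((s - t1) ^+ n.+1 / n.+1%:R)) =
        (Kc / n.+1%:R) \*: ((fun s : R => s - t1) ^+ n.+1).
      by apply/funext => r /=; rewrite exprfctE /GRing.scale/=; ring.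
    have E2 : Kc * (s - t1) ^+ n = Kc / n.+1%:R *: ((n.+1%:R * (s - t1) ^+ n) *: (1 : R)).
      rewrite /GRing.scale/= mulr1.
      by field; rewrite gt_eqF.
    by rewrite E1 E2; exact: h3.
have n10 : n.+1%:R != 0 :> R by rewrite gt_eqF.
have dln : dl != 0 by rewrite gt_eqF.
have Kn0 : 0 <= K * A ^+ n by rewrite mulr_ge0// exprn_ge0// ltW.
have st0 : 0 <= t - t1 by rewrite subr_ge0.
apply: (@le_trans _ _ (dl ^+ n.+1 * (Kc * ((t - t1) ^+ n.+1 / n.+1%:R)))).
  by rewrite ler_wpM2l// exprn_ge0// ltW.
have E : dl ^+ n.+1 * (Kc * ((t - t1) ^+ n.+1 / n.+1%:R)) =
    (dl ^+ n / (alpha - a'') ^+ n) *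
    (K * A ^+ n * Mg * (t - t1) ^+ n.+1 * expR (L1norm f / alpha')).
  rewrite /Kc a''1 exprS; field.
  by rewrite dln nat1r n10 gt_eqF.
rewrite E.
apply: (@le_trans _ _ (expR 1 *
    (K * A ^+ n * Mg * (t - t1) ^+ n.+1 * expR (L1norm f / alpha')))).
  rewrite ler_wpM2r//.
    rewrite mulr_ge0 ?expR_ge0// mulr_ge0 ?exprn_ge0// mulr_ge0 ?(ltW Mg0)//.
  by rewrite ler_pdivrMr.
apply: le_eq.
rewrite [(A * _) ^+ _]exprMn [A ^+ n.+1]exprS.
rewrite [in RHS](_ : A * A ^+ n = expR 1 * Mg * A ^+ n)//; ring.
Qed.

(** At [alpha' = alpha / 2] this length of time makes the iterated bound at most a constant times
    [(alpha / 4) ^+ n] against [(alpha / 2) ^+ n], so [D t f] is bounded by a constant times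
    [2 ^- n] for every [n]. *)
Lemma small_time_zero (t1 t : R) : 0 <= t1 -> t1 <= t -> t < T ->
  (forall f, L1 f -> D t1 f = 0) ->
  t - t1 <= alpha / (4 * expR 1 * Mg) -> forall f, L1 f -> D t f = 0.
Proof.
move=> t10 t1t tT D1 tsmall f Lf.
have t00 : 0 <= t < T by rewrite (le_trans t10).
have [K K0 bK] := uniform_expbound t00.
have bK' s : t1 <= s <= t -> expbound alpha K (D s).
  by move=> /andP[h1 h2]; apply: bK; rewrite (le_trans t10).
have a2 : 0 < alpha / 2 by rewrite divr_gt0.
have a2a : alpha / 2 <= alpha by rewrite ler_piMr ?(ltW alpha0)// invf_le1// ler1n.
have tt : t1 <= t <= t by rewrite t1t lexx.
apply: abs_le_small => e e0.
pose Ke := K * expR (L1norm f / (alpha / 2)).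
have [n Hn] := small_dyadic Ke e0.
rewrite (le_trans _ (ltW Hn))// ler_pdivlMr ?exprn_gt0//.
have an : 0 < (alpha / 2) ^+ n by rewrite exprn_gt0.
rewrite -(ler_pM2r an).
have := iterated_bound t10 tT K0 D1 bK' n (lexx _) a2a tt Lf.
have -> : alpha - alpha / 2 = alpha / 2 by field.
move=> h.
have Mn : Mg != 0 by rewrite gt_eqF.
have h2 : expR 1 * Mg * (t - t1) <= alpha / 4.
  have -> : alpha / 4 = expR 1 * Mg * (alpha / (4 * expR 1 * Mg)).
    by field; rewrite Mn gt_eqF// expR_gt0.
  by rewrite ler_wpM2l// mulr_ge0 ?(ltW Mg0)// mulr_ge0 ?expR_ge0.
have h3 : (expR 1 * Mg * (t - t1)) ^+ n <= (alpha / 4) ^+ n.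
  have h0 : 0 <= expR 1 * Mg * (t - t1).
    by rewrite mulr_ge0 ?subr_ge0// mulr_ge0 ?(ltW Mg0)//.
  by case: n {Hn an h} => [|n]; rewrite ?expr0// ler_pXn2r// nnegrE (le_trans h0).
have E4 : (alpha / 4) ^+ n * 2 ^+ n = (alpha / 2) ^+ n.
  by rewrite -exprMn; congr (_ ^+ _); field.
have h4 : (alpha / 2) ^+ n * abs (D t f) <= Ke * (alpha / 4) ^+ n.
  rewrite (le_trans h)// /Ke mulrAC ler_wpM2l// mulr_ge0// expR_ge0.
rewrite mulrAC [_ * (alpha / 2) ^+ n]mulrC.
rewrite (@le_trans _ _ (Ke * (alpha / 4) ^+ n * 2 ^+ n))//.
  by rewrite ler_wpM2r// exprn_ge0.
by rewrite -mulrA E4.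
Qed.

Lemma zero_difference : (forall f, L1 f -> D 0 f = 0) ->
  forall t, 0 <= t < T -> forall f, L1 f -> D t f = 0.
Proof.
move=> D0 t /andP[t0 tT].
pose tau := alpha / (4 * expR 1 * Mg).
have tau0 : 0 < tau.
  by rewrite divr_gt0// mulr_gt0 ?Mg0// mulr_gt0 ?expR_gt0.
have key n : forall t, 0 <= t -> t < T -> t <= n%:R * tau -> forall f, L1 f -> D t f = 0.
  elim: n => [|n IH] s s0 sT.
    rewrite mul0r => s00; have -> : s = 0 by apply/eqP; rewrite eq_le s00.
    exact: D0.
  move=> sn; have [sm|sm] := leP s (n%:R * tau); first exact: IH.
  have n0 : 0 <= n%:R * tau by rewrite mulr_ge0// ltW.
  apply: (@small_time_zero (n%:R * tau)) => //; first exact: ltW.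
    by apply: IH => //; exact: lt_trans sT.
  by rewrite lerBlDl -/tau -[X in _ + X]mul1r -mulrDl natr1.
apply: (key (Num.truncn (t / tau)).+1) => //.
by rewrite -ler_pdivrMr// ltW// truncnS_gt.
Qed.

End difference.

Lemma solution_data (B0 : (X -> C) -> C) (B : R -> (X -> C) -> C) :
  is_solution z phi alpha T B0 B ->
  [/\ forall t, 0 <= t < T -> entire (B t),
      forall t, 0 <= t < T -> forall e : R, 0 < e ->
        exists2 dl : R, 0 < dl & forall s, 0 <= s < T -> `|s - t| < dl ->
          expbound alpha e (fun f => B s f - B t f),
      forall t, 0 <= t < T -> exists2 K, 0 <= K & expbound alpha K (B t) &
      forall t, 0 < t < T -> forall f, L1 f -> rderiv (fun s => B s f) t (L (B t) f)].
Proof.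
move=> [cal cont [dB [dBcal dBlim _ dBE]] _]; split.
- by move=> t /cal[[]].
- move=> t tT e e0; have /Enorm_cvg0/(_ e e0) := cont t tT.
  rewrite /within/= => /nbhs_ballP[dl /= dl0 H]; exists dl => // s sT sd.
  by apply: H => //; rewrite /ball/= distrC.
- by move=> t /cal[/calEP[_ []]]; eauto.
- move=> t tT f Lf e e0.
  have ex0 : 0 < expR (L1norm f / alpha) by exact: expR_gt0.
  have /Enorm_cvg0/(_ _ (divr_gt0 e0 ex0)) := dBlim t tT.
  move=> /nbhs_ballP[dl /= dl0 H]; exists dl => // s sd.
  have [->|s0] := eqVneq s 0.
    by rewrite addr0 subrr mul0r subrr abs0 normr0 mulr0.
  have := H s _ s0 f Lf; rewrite /ball/= sub0r normrN => /(_ sd).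
  rewrite divfK ?gt_eqF// dBE// => h.
  have sC : (s%:C : C) != 0 by rewrite -abs_gt0 abs_real normr_gt0.
  have -> : B (t + s) f - B t f - s%:C * L (B t) f =
      s%:C * ((s^-1)%:C * (B (t + s) f - B t f) - L (B t) f).
    have -> : (s^-1)%:C = (s%:C)^-1 :> C by rewrite (fmorphV (@real_complex R)).
    by field.
  by rewrite absM abs_real mulrC ler_wpM2r.
Qed.

Lemma solution_unique (B0 : (X -> C) -> C) (B B' : R -> (X -> C) -> C) :
  is_solution z phi alpha T B0 B -> is_solution z phi alpha T B0 B' ->
  forall t, 0 <= t < T -> forall f, L1 f -> B' t f = B t f.
Proof.
move=> sB sB'; have [e1 c1 b1 d1] := solution_data sB.
have [e2 c2 b2 d2] := solution_data sB'.
have B00 f : L1 f -> B 0 f = B0 f by case: sB => _ _ _ + Lf; exact.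
have B'00 f : L1 f -> B' 0 f = B0 f by case: sB' => _ _ _ + Lf; exact.
(* Written with coefficients 1 and -1 to match the shape of [entire_lin] and [Ltilde_lin]. *)
pose D t f := 1 * B' t f + (-1) * B t f.
move=> t tT f Lf; apply: subr0_eq.
have -> : B' t f - B t f = D t f by rewrite /D mul1r mulN1r.
refine (@zero_difference D _ _ _ _ _ t tT f Lf).
- by move=> s sT; apply: entire_lin; [exact: e2|exact: e1].
- move=> s sT e e0; have e20 : 0 < e / 2 by rewrite divr_gt0.
  have [dl1 dl10 H1] := c1 s sT _ e20; have [dl2 dl20 H2] := c2 s sT _ e20.
  exists (Num.min dl1 dl2); first by rewrite lt_min dl10.
  move=> r rT; rewrite lt_min => /andP[r1 r2].
  apply: (@expbound_ext _ _ _ _ (fun f => 1 * (B' r f - B' s f) + (-1) * (B r f - B s f))).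
    by move=> g _; rewrite /D; ring.
  apply: expbound_le (expbound_lin 1 (-1) (H2 r rT r2) (H1 r rT r1)).
  by rewrite absN abs1 !mul1r -splitr.
- move=> s sT; have [K1 K10 h1] := b1 s sT; have [K2 K20 h2] := b2 s sT.
  exists (abs (1 : C) * K2 + abs (-1 : C) * K1).
    by rewrite absN abs1 !mul1r addr_ge0.
  exact: expbound_lin.
- move=> s sT g Lg.
  have sT' : 0 <= s < T by case/andP: sT => /ltW -> ->.
  have [K1 K10 h1] := b1 s sT'; have [K2 K20 h2] := b2 s sT'.
  rewrite (Ltilde_lin z hphi 1 (-1) alpha0 K20 K10 (e2 s sT') (e1 s sT') h2 h1 Lg).
  move=> e e0; have e20 : 0 < e / 2 by rewrite divr_gt0.
  have [dl1 dl10 H1] := d1 s sT g Lg _ e20; have [dl2 dl20 H2] := d2 s sT g Lg _ e20.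
  exists (Num.min dl1 dl2); first by rewrite lt_min dl10.
  move=> r; rewrite lt_min => /andP[r1 r2]; rewrite /D.
  rewrite [X in abs X](_ : _ = (B' (s + r) g - B' s g - r%:C * L (B' s) g) -
    (B (s + r) g - B s g - r%:C * L (B s) g)); last by ring.
  rewrite (le_trans (absB _ _))// (splitr e) mulrDl lerD//; [exact: H2|exact: H1].
- by move=> g Lg; rewrite /D B00// B'00//; ring.
Qed.

End uniqueness.

(** * Existence *)

Section geometric_limits.
Context {R : realType}.
Local Notation C := (R[i]).

(** The intervals about [v n] with radius [2 * M / 2 ^+ n], the sum of all later increments, are
    nested; their common point is the limit, with its rate. *)
Lemma geometric_limit_real (v : nat -> R) (M : R) :
  (forall n, `|v n.+1 - v n| <= M / 2 ^+ n) ->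
  exists l, forall n, `|v n - l| <= 2 * M / 2 ^+ n.
Proof.
move=> vM.
have M0 n : 0 <= M / 2 ^+ n by exact: le_trans (vM n).
have dbl n : 2 * M / 2 ^+ n = M / 2 ^+ n + M / 2 ^+ n by ring.
have half n : 2 * M / 2 ^+ n.+1 = M / 2 ^+ n by rewrite dbl -dyadic_half.
have [n|n|n|l lP] := @nested_intervals R (fun n => v n - 2 * M / 2 ^+ n)
  (fun n => v n + 2 * M / 2 ^+ n).
- by rewrite half dbl; have := vM n; rewrite ler_norml => /andP[h1 h2]; lra.
- by rewrite half dbl; have := vM n; rewrite ler_norml => /andP[h1 h2]; lra.
- by rewrite dbl; have := M0 n; lra.
exists l => n; have /andP[h1 h2] := lP n.
by rewrite ler_norml; apply/andP; split; lra.
Qed.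

Lemma geometric_limit (v : nat -> C) (M : R) :
  (forall n, abs (v n.+1 - v n) <= M / 2 ^+ n) ->
  exists l, forall n, abs (v n - l) <= 4 * M / 2 ^+ n.
Proof.
move=> vM.
have [a aP] : exists l, forall n, `|complex.Re (v n) - l| <= 2 * M / 2 ^+ n.
  apply: geometric_limit_real => n.
  by rewrite -cReN -cReD (le_trans (ler_Re_abs _)).
have [b bP] : exists l, forall n, `|complex.Im (v n) - l| <= 2 * M / 2 ^+ n.
  apply: geometric_limit_real => n.
  by rewrite -cImN -cImD (le_trans (ler_Im_abs _)).
exists (a +i* b) => n; rewrite (le_trans (abs_le_ReIm _))//.
rewrite cReD cImD cReN cImN /=.
rewrite (_ : 4 * M / 2 ^+ n = 2 * M / 2 ^+ n + 2 * M / 2 ^+ n); last by ring.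
exact: lerD.
Qed.

Lemma clim_geometric (v : nat -> C) (l : C) (M : R) :
  (forall n, abs (v n - l) <= M / 2 ^+ n) -> clim v l.
Proof.
move=> vM e e0; have [N HN] := small_dyadic M e0; exists N => n Nn.
have M0 : 0 <= M.
  by have := le_trans (abs_ge0 _) (vM 0%N); rewrite expr0 divr1.
rewrite (le_trans (vM n))// (le_trans _ (ltW HN))// ler_wpM2l//.
by rewrite lef_pV2 ?posrE ?exprn_gt0// ler_eXn2l// ltr1n.
Qed.

End geometric_limits.

Section existence.
Context {R : realType} {d : nat}.
Local Notation C := (R[i]).
Local Notation X := (Rd R d).
Variables (phi : X -> \bar R) (z : R).
Hypothesis hphi : potential phi.
Hypothesis z0 : 0 < z.
Local Notation L := (Ltilde z phi).
Variables (alpha alpha0 : R).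
Hypothesis al0 : 0 < alpha.
Hypothesis al1 : alpha < alpha0.

Let Mg : R := gen_const phi z alpha alpha0.
Let alpha00 : 0 < alpha0. Proof. exact: lt_trans al1. Qed.
Let Mg0 : 0 < Mg. Proof. exact: gen_const_gt0. Qed.

(** The series is summed in [calE beta]; the gap from [beta] down to [alpha] pays for one
    application of [Ltilde] to the sum. *)
Let beta := (alpha + alpha0) / 2.
Let ab : alpha < beta. Proof. by rewrite /beta midf_lt. Qed.
Let ba : beta < alpha0. Proof. by rewrite /beta midf_lt. Qed.
Let be0 : 0 < beta. Proof. exact: lt_trans ab. Qed.

Let A := expR 1 * Mg.
Let A0 : 0 < A. Proof. by rewrite mulr_gt0 ?expR_gt0 ?Mg0. Qed.
(** Geometric ratio of the Taylor coefficients in time, measured in [calE beta]. *)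
Let rho := A / (alpha0 - beta).
Let rho0 : 0 < rho. Proof. by rewrite divr_gt0 ?A0// subr_gt0 ba. Qed.

(** For complex times with [abs w <= 2 * T] the terms of the series decay like [2 ^- n]. Around
    every time of modulus at most [T] this leaves a disc of radius [T] for Cauchy's estimates. *)
Definition existence_time : R := 1 / (4 * rho).
Local Notation T := existence_time.

Lemma existence_time_gt0 : 0 < T.
Proof. by rewrite divr_gt0// mulr_gt0 ?rho0. Qed.

Section from_initial_datum.
Variables (B0 : (X -> C) -> C) (K : R).
Hypothesis K0 : 0 <= K.
Hypothesis eB0 : entire B0.
Hypothesis bB0 : expbound alpha0 K B0.

Definition iterate n : (X -> C) -> C := iter n L B0.

(** Same recursion over the scale as for uniqueness, but without integration in time: the factors
    [n + 1] accumulate to the factorial, which [coef] divides out. *)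
Lemma iterate_bound n : entire (iterate n) /\
  forall a' f, alpha <= a' -> a' <= alpha0 -> L1 f ->
    (alpha0 - a') ^+ n * abs (iterate n f) <= K * A ^+ n * n`!%:R * expR (L1norm f / a').
Proof.
elim: n => [|n [eI bI]].
  split => // a' f aa' a'a Lf; rewrite !expr0 fact0 !mul1r !mulr1.
  exact: (expbound_weaken (lt_le_trans al0 aa') a'a K0 bB0).
have bs a'' : alpha <= a'' -> a'' <= alpha0 -> 0 < (alpha0 - a'') ^+ n ->
    expbound a'' (K * A ^+ n * n`!%:R / (alpha0 - a'') ^+ n) (iterate n).
  move=> aa'' a''a q0 f Lf.
  rewrite mulrAC ler_pdivlMr// mulrC; exact: bI.
have KA m : 0 <= K * A ^+ m * m`!%:R by rewrite !mulr_ge0// exprn_ge0// ltW.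
have qb : 0 < (alpha0 - beta) ^+ n by rewrite exprn_gt0// subr_gt0.
split.
  (* Entireness does not refer to the scale, so any index strictly between [alpha] and [alpha0] will
     do, and [beta] is at hand. *)
  apply: (Ltilde_entire hphi z0 be0 _ eI (bs beta _ _ qb)); [|exact: ltW|exact: ltW].
  by rewrite divr_ge0// ltW.
move=> a' f aa' a'a Lf; have a'0 := lt_le_trans al0 aa'.
have [->|a'n] := eqVneq a' alpha0.
  by rewrite subrr expr0n mul0r mulr_ge0// expR_ge0.
have a'a0 : a' < alpha0 by rewrite lt_neqAle a'n.
have [a'' [a'a'' a''a q0 a''1 split_le]] := intermediate_scale n a'a0.
have dl0 : 0 < alpha0 - a' by rewrite subr_gt0.
set dl := alpha0 - a' in dl0 a''1 split_le *.
have n1 : (0 : R) < n.+1%:R by rewrite ltr0n.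
have a''0 : 0 < a'' by exact: lt_trans a'a''.
have Ks0 : 0 <= K * A ^+ n * n`!%:R / (alpha0 - a'') ^+ n by rewrite divr_ge0// ltW.
have bsn := bs a'' (le_trans aa' (ltW a'a'')) a''a q0.
have h := Ltilde_expbound hphi z0 a''0 Ks0 eI bsn al0 aa' a'a'' a''a Lf.
have n10 : n.+1%:R != 0 :> R by rewrite gt_eqF.
have dln : dl != 0 by rewrite gt_eqF.
apply: (@le_trans _ _ (dl ^+ n.+1 * (K * A ^+ n * n`!%:R / (alpha0 - a'') ^+ n *
  gen_const phi z alpha alpha0 / (a'' - a') * expR (L1norm f / a')))).
  by rewrite ler_wpM2l// exprn_ge0// ltW.
rewrite -/Mg a''1.
have -> : dl ^+ n.+1 * (K * A ^+ n * n`!%:R / (alpha0 - a'') ^+ n * Mg /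
    (dl / n.+1%:R) * expR (L1norm f / a')) =
    (dl ^+ n / (alpha0 - a'') ^+ n) *
    (K * A ^+ n * n`!%:R * Mg * n.+1%:R * expR (L1norm f / a')).
  rewrite exprS; field.
  by rewrite nat1r n10 dln gt_eqF.
apply: (@le_trans _ _ (expR 1 *
    (K * A ^+ n * n`!%:R * Mg * n.+1%:R * expR (L1norm f / a')))).
  rewrite ler_wpM2r//.
    by rewrite mulr_ge0 ?expR_ge0// mulr_ge0// mulr_ge0 ?KA// ltW.
  by rewrite ler_pdivrMr.
apply: le_eq.
rewrite [A ^+ n.+1]exprS factS natrM (_ : A * A ^+ n = expR 1 * Mg * A ^+ n)//; ring.
Qed.

Definition coef n : (X -> C) -> C := fun f => (n`!%:R^-1 : R)%:C * iterate n f.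

Lemma coef_bound n f : L1 f -> abs (coef n f) <= K * rho ^+ n * expR (L1norm f / beta).
Proof.
move=> Lf; rewrite /coef absM abs_real ger0_norm ?invr_ge0//.
have f0 : (0 : R) < n`!%:R by rewrite ltr0n fact_gt0.
have d0 : 0 < (alpha0 - beta) ^+ n by rewrite exprn_gt0// subr_gt0.
have := (iterate_bound n).2 beta f (ltW ab) (ltW ba) Lf.
rewrite mulrC -ler_pdivlMr// => h.
rewrite ler_pdivrMl//; apply: (le_trans h).
apply: le_eq.
by rewrite /rho expr_div_n; ring.
Qed.

Fixpoint psum n (w : C) : (X -> C) -> C :=
  match n with
  | 0 => fun=> 0
  | m.+1 => fun f => 1 * psum m w f + w ^+ m * coef m f
  end.

(** Both the derivative in [w] of [psum n.+1] and the image of [psum n] under [Ltilde]: the shift of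
    index is the evolution equation at the level of partial sums. *)
Fixpoint dpsum n (w : C) : (X -> C) -> C :=
  match n with
  | 0 => fun=> 0
  | m.+1 => fun f => 1 * dpsum m w f + (w ^+ m * (m`!%:R^-1 : R)%:C) * iterate m.+1 f
  end.

Lemma term_bound m w f : L1 f -> abs w <= 2 * T ->
  abs (w ^+ m * coef m f) <= K * expR (L1norm f / beta) / 2 ^+ m.
Proof.
move=> Lf wT; rewrite absM absX.
apply: (@le_trans _ _ ((2 * T) ^+ m * (K * rho ^+ m * expR (L1norm f / beta)))).
  apply: ler_pM; rewrite ?exprn_ge0 ?abs_ge0//; last exact: coef_bound.
  by case: m => [|m]; rewrite ?expr0// ler_pXn2r ?nnegrE ?abs_ge0// (le_trans (abs_ge0 w)).
apply: le_eq.
rewrite [LHS](_ : _ = K * expR (L1norm f / beta) * ((2 * T) * rho) ^+ m); last first.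
  rewrite [in RHS]exprMn; move: (2 * T) => c; ring.
have -> : 2 * T * rho = 2^-1.
  by rewrite /existence_time; field; rewrite gt_eqF// rho0.
by rewrite exprVn.
Qed.

Lemma psum_bound n w f : L1 f -> abs w <= 2 * T ->
  abs (psum n w f) <= 2 * (K * expR (L1norm f / beta)).
Proof.
move=> Lf wT; set M := K * _; have M0 : 0 <= M by rewrite mulr_ge0// expR_ge0.
(* The exact partial sum of the geometric majorant is what the induction carries. *)
suff h : abs (psum n w f) <= 2 * M - 2 * M / 2 ^+ n.
  rewrite (le_trans h)// lerBlDr lerDl divr_ge0 ?exprn_ge0// mulr_ge0//.
elim: n => [|n IH].
  by rewrite -[psum 0 w f]/(0 : C) abs0 expr0 divr1 subrr.
rewrite -[psum _ w f]/(1 * _ + _ * _) mul1r (le_trans (absD _ _))// (le_trans (lerD IH (term_bound n Lf wT)))//.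
rewrite -/M; apply: le_eq.
by rewrite exprS invfM; field; rewrite expf_neq0.
Qed.

Lemma psum_limit w f : L1 f -> abs w <= 2 * T -> exists l, forall n,
  abs (psum n w f - l) <= 4 * (K * expR (L1norm f / beta)) / 2 ^+ n.
Proof.
move=> Lf wT; apply: geometric_limit => n /=.
by rewrite mul1r addrAC subrr add0r; exact: term_bound.
Qed.

(** Specified by its rate of approximation rather than as a bare limit, so that the error stays
    explicit. Times are real here; complex times are used only for the partial sums. *)
Definition sol (t : R) : (X -> C) -> C := fun f => xget 0 [set l | forall n,
  abs (psum n t%:C f - l) <= 4 * (K * expR (L1norm f / beta)) / 2 ^+ n].

Lemma solP t f n : L1 f -> `|t| <= 2 * T ->
  abs (psum n t%:C f - sol t f) <= 4 * (K * expR (L1norm f / beta)) / 2 ^+ n.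
Proof.
move=> Lf tT; rewrite -abs_real in tT.
have [l lP] := psum_limit Lf tT; rewrite /sol; case: xgetP => [l' _ //|].
by move=> /(_ l); case.
Qed.

Lemma sol_clim t f : L1 f -> `|t| <= 2 * T -> clim (fun n => psum n t%:C f) (sol t f).
Proof. by move=> Lf tT; apply: clim_geometric => n; exact: solP. Qed.

Lemma sol_bound t : `|t| <= 2 * T -> expbound beta (4 * K) (sol t).
Proof.
move=> tT f Lf; have := solP 0 Lf tT; rewrite -[psum 0 _ f]/(0 : C) sub0r absN expr0 divr1.
by rewrite mulrA.
Qed.

Lemma psum_entire n w : entire (psum n w).
Proof.
elim: n => [|n IH].
  split => //=.
    by move=> f0 _; exists 1, 0; split => // f _ _; rewrite abs0.
  by move=> f h _ _; apply/holo_derivable; exact: holo_cst.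
have := entire_lin 1 (w ^+ n * (n`!%:R^-1 : R)%:C) IH (iterate_bound n).1.
apply: entire_ext => f _ /=; rewrite /coef; ring.
Qed.

Lemma psum_expbound n w : abs w <= 2 * T -> expbound beta (2 * K) (psum n w).
Proof. by move=> wT f Lf; rewrite -mulrA; exact: psum_bound. Qed.

Lemma sol_entire t : `|t| <= 2 * T -> entire (sol t).
Proof.
move=> tT; have tT' : abs (t%:C : C) <= 2 * T by rewrite abs_real.
split.
- move=> f g Lf Lg fg; apply: (clim_uniq (sol_clim Lf tT)).
  have -> : (fun n => psum n t%:C f) = (fun n => psum n t%:C g).
    by apply/funext => n; have [+ _ _] := psum_entire n t%:C; exact.
  exact: sol_clim.
- apply: (@locally_bounded_mono _ _ (fun r => 4 * K * expR (r / beta))); last exact: sol_bound.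
  by move=> r s _ rs; rewrite ler_wpM2l ?mulr_ge0// ler_expR ler_pM2r ?invr_gt0.
- move=> f h Lf Lh; apply/holo_derivable.
  apply: (@holo_clim _ (fun n => along (psum n t%:C) f h)).
  + by move=> n; exact: (along_holo (psum_entire n _) Lf Lh).
  + move=> r; exists (2 * K * expR ((L1norm f + r * L1norm h) / beta)) => n w wr.
    have K2 : 0 <= 2 * K by rewrite mulr_ge0.
    exact: (along_le be0 K2 (psum_expbound n tT') Lf Lh wr).
  + by move=> w; exact: (sol_clim (L1DZ w Lf Lh) tT).
Qed.

Lemma Ltilde_psum n w f : abs w <= 2 * T -> L1 f -> L (psum n w) f = dpsum n w f.
Proof.
move=> wT Lf; elim: n => [|n IH].
  have e0 := psum_entire 0 w; have b0 := psum_expbound 0 wT.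
  have K2 : 0 <= 2 * K by rewrite mulr_ge0.
  (* The zero functional written as a combination with zero coefficients, so that linearity yields
     the value 0. *)
  have E : psum 0 w = fun g => 0 * psum 0 w g + 0 * psum 0 w g.
    by apply/funext => g; rewrite !mul0r addr0.
  by rewrite E (Ltilde_lin z hphi 0 0 be0 K2 K2 e0 e0 b0 b0 Lf) !mul0r addr0.
have eI := (iterate_bound n).1.
have bI : expbound beta (K * rho ^+ n * n`!%:R) (iterate n).
  move=> g Lg; have := coef_bound n Lg; rewrite /coef absM abs_real ger0_norm ?invr_ge0//.
  rewrite ler_pdivrMl ?ltr0n ?fact_gt0// => /le_trans; apply.
  by apply: le_eq; ring.
have K2 : 0 <= 2 * K by rewrite mulr_ge0.
have KI : 0 <= K * rho ^+ n * n`!%:R by rewrite !mulr_ge0// exprn_ge0// ltW// rho0.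
have := Ltilde_lin z hphi 1 (w ^+ n * (n`!%:R^-1 : R)%:C) be0 K2 KI
  (psum_entire n w) eI (psum_expbound n wT) bI Lf.
rewrite IH -/(iterate n.+1) => h.
rewrite -[RHS]h; congr (L _ f); apply/funext => g /=; rewrite /coef; ring.
Qed.

Let Q := Mg / (beta - alpha).
Let Q0 : 0 <= Q. Proof. by rewrite divr_ge0 ?(ltW Mg0)// subr_ge0 ltW. Qed.

Lemma Ltilde_expbound_beta (B : (X -> C) -> C) K' : 0 <= K' -> entire B ->
  expbound beta K' B -> expbound alpha (K' * Q) (L B).
Proof.
move=> K'0 eB bB; rewrite /Q mulrA.
exact: (Ltilde_expbound hphi z0 be0 K'0 eB bB al0 (lexx _) ab (ltW ba)).
Qed.

Lemma Ltilde_sub (B B' : (X -> C) -> C) K1 K2 K' : 0 <= K1 -> 0 <= K2 -> 0 <= K' ->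
  entire B -> entire B' -> expbound beta K1 B -> expbound beta K2 B' ->
  expbound beta K' (fun f => B f - B' f) ->
  expbound alpha (K' * Q) (fun f => L B f - L B' f).
Proof.
move=> K10 K20 K'0 eB eB' bB bB' bD.
have E1 : (fun f => B f - B' f) = (fun f => 1 * B f + (-1) * B' f).
  by apply/funext => f; rewrite mul1r mulN1r.
have eD : entire (fun f => B f - B' f) by rewrite E1; exact: entire_lin.
apply: expbound_ext (Ltilde_expbound_beta K'0 eD bD) => f Lf.
by rewrite E1 (Ltilde_lin z hphi 1 (-1) be0 K10 K20 eB eB' bB bB' Lf) mul1r mulN1r.
Qed.

(** The partial sums approach [sol t] in [calE beta] at a geometric rate, and [Ltilde] is bounded
    from [calE beta] to [calE alpha], so it commutes with this limit. *)
Lemma Ltilde_sol_clim t f : L1 f -> `|t| <= 2 * T ->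
  clim (fun n => dpsum n t%:C f) (L (sol t) f).
Proof.
move=> Lf tT; have tT' : abs (t%:C : C) <= 2 * T by rewrite abs_real.
apply: (@clim_geometric _ _ _ (4 * K * Q * expR (L1norm f / alpha))) => n.
have b : expbound beta (4 * K / 2 ^+ n) (fun g => psum n t%:C g - sol t g).
  move=> g Lg; rewrite (le_trans (solP n Lg tT))//.
  by apply: le_eq; ring.
have K2 : 0 <= 2 * K by rewrite mulr_ge0.
have K4 : 0 <= 4 * K by rewrite mulr_ge0.
have Kn : 0 <= 4 * K / 2 ^+ n by rewrite divr_ge0// exprn_ge0.
have := Ltilde_sub K2 K4 Kn (psum_entire n t%:C) (sol_entire tT)
  (psum_expbound n tT') (sol_bound tT) b Lf.
rewrite Ltilde_psum// => /le_trans; apply.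
by apply: le_eq; ring.
Qed.

Lemma psum_holo n f : holo (fun w => psum n w f).
Proof.
elim: n => [|n IH] /=; first exact: holo_cst.
apply: holoD; first by apply: holoM => //; exact: holo_cst.
apply: holoM; last exact: holo_cst.
elim: n {IH} => [|n IH]; first exact: holo_cst.
under eq_fun do rewrite exprS.
by apply: holoM => //; exact: holo_id.
Qed.

Lemma cderivX n (a : C) : cderiv (fun w => w ^+ n.+1) a (n.+1%:R * a ^+ n).
Proof.
apply/is_derive_cderiv.
have h := @is_deriveX _ _ (id : C^o -> C^o) n.+1 a 1 1 (is_derive_id _ _).
move: h; rewrite /GRing.scale/= mulr1 /=.
by rewrite (_ : (id : C^o -> C^o) ^+ n.+1 = fun w => w ^+ n.+1)// exprfctE.
Qed.

Lemma cderiv_psum n w f : cderiv (fun w => psum n.+1 w f) w (dpsum n w f).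
Proof.
elim: n => [|n IH].
  rewrite (_ : (fun w => _) = fun=> coef 0 f); first exact: cderiv_cst.
  by apply/funext => v /=; rewrite mulr0 add0r expr0 mul1r.
have -> : (fun w => psum n.+2 w f) = fun w => psum n.+1 w f + coef n.+1 f * w ^+ n.+1.
  by apply/funext => v; rewrite /= !mul1r [coef _ _ * _]mulrC.
have -> : dpsum n.+1 w f = dpsum n w f + coef n.+1 f * (n.+1%:R * w ^+ n).
  rewrite /= mul1r; congr (_ + _); rewrite /coef factS natrM invfM.
  rewrite (rmorphM (@real_complex R)) /=.
  have -> : (n.+1%:R^-1 : R)%:C = n.+1%:R^-1 :> C.
    by rewrite (fmorphV (@real_complex R)) rmorph_nat.
  have n0 : n.+1%:R != 0 :> C by rewrite pnatr_eq0.
  rewrite -[RHS]/(_ * _ * iterate n.+1 f * _).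
  by field; rewrite nat1r n0 pnatr_eq0 -lt0n fact_gt0.
exact: (cderivD IH (cderivZ _ (@cderivX n w))).
Qed.

Lemma near_time_bound (t : R) f : L1 f -> `|t| <= T -> forall n w,
  abs (w - t%:C) <= T -> abs (psum n w f) <= 2 * (K * expR (L1norm f / beta)).
Proof.
move=> Lf tT n w wt; apply: psum_bound => //.
rewrite -[w](subrK t%:C) (le_trans (absD _ _))// abs_real.
by rewrite mulr_natl mulr2n lerD.
Qed.

Let T0 : 0 < T. Proof. exact: existence_time_gt0. Qed.

Lemma sol_lipschitz t s : `|t| <= T -> `|s| <= T / 2 ->
  expbound beta (32 * (2 * K) / T * `|s|) (fun f => sol (t + s) f - sol t f).
Proof.
move=> tT sT f Lf.
have t2 : `|t| <= 2 * T by rewrite (le_trans tT)// ler_peMl ?(ltW T0)// ler1n.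
have ts2 : `|t + s| <= 2 * T.
  rewrite (le_trans (ler_normD _ _))// mulr_natl mulr2n lerD// (le_trans sT)//.
  by rewrite ler_piMr ?(ltW T0)// invf_le1// ler1n.
apply: (clim_abs_le (climB (sol_clim Lf ts2) (sol_clim Lf t2))) => n.
have sC : abs (s%:C : C) <= T / 2 by rewrite abs_real.
have := lipschitz_estimate (psum_holo n f) T0 (near_time_bound Lf tT n) sC.
rewrite -(rmorphD (@real_complex R)) abs_real => /le_trans; apply.
by apply: le_eq; ring.
Qed.

(** The Taylor remainder is estimated for the partial sums, holomorphic in time and bounded
    uniformly in [n] on the disc of radius [T] about [t], and the inequality is passed to the
    limit. *)
Lemma sol_taylor t s : `|t| <= T -> `|s| <= T / 4 ->
  expbound beta (2048 * (2 * K) / T ^+ 2 * `|s| ^+ 2)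
    (fun f => sol (t + s) f - sol t f - s%:C * L (sol t) f).
Proof.
move=> tT sT f Lf.
have t2 : `|t| <= 2 * T by rewrite (le_trans tT)// ler_peMl ?(ltW T0)// ler1n.
have ts2 : `|t + s| <= 2 * T.
  rewrite (le_trans (ler_normD _ _))// mulr_natl mulr2n lerD// (le_trans sT)//.
  by rewrite ler_piMr ?(ltW T0)// invf_le1// ler1n.
(* The sequence is shifted by one because the derivative of [psum n.+1] is [dpsum n]. *)
have S1 (u : nat -> C) l : clim u l -> clim (fun n => u n.+1) l.
  move=> ul e e0; have [N HN] := ul e e0; exists N => n Nn.
  by apply: HN; exact: leqW.
apply: (clim_abs_le (climB (climB (S1 _ _ (sol_clim Lf ts2)) (S1 _ _ (sol_clim Lf t2)))
  (climZ s%:C (Ltilde_sol_clim Lf t2)))) => n.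
have sC : abs (s%:C : C) <= T / 4 by rewrite abs_real.
have := taylor2_estimate (psum_holo n.+1 f) T0 (near_time_bound Lf tT n.+1) sC
  (cderiv_psum n t%:C f).
rewrite -(rmorphD (@real_complex R)) abs_real => /le_trans; apply.
have mulE (c T' a b : R) : c * (2 * (K * a)) * T' * b = c * (2 * K) * T' * b * a by ring.
by rewrite mulE.
Qed.

Lemma sol_is_solution : is_solution z phi alpha T B0 sol.
Proof.
have small (t : R) : 0 <= t < T -> `|t| <= T.
  by move=> /andP[t0 /ltW tT]; rewrite ger0_norm.
have T2 (t : R) : `|t| <= T -> `|t| <= 2 * T.
  by move=> /le_trans; apply; rewrite ler_peMl ?(ltW T0)// ler1n.
have K4 : 0 <= 4 * K by rewrite mulr_ge0.
pose Lip := 32 * (2 * K) / T.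
have Lip0 : 0 <= Lip by rewrite divr_ge0 ?(ltW T0)// mulr_ge0// mulr_ge0.
have lip t s : `|t| <= T -> `|s - t| <= T / 2 ->
    expbound beta (Lip * `|s - t|) (fun f => sol s f - sol t f).
  by move=> tT st; have := sol_lipschitz tT st; rewrite [t + _]addrC subrK.
have small_near (t e c : R) : 0 < e -> 0 <= c ->
    \forall s \near t, `|s - t| <= T / 4 /\ c * `|s - t| <= e.
  move=> e0 c0; have c1 : 0 < c + 1 by rewrite ltr_pwDr.
  apply/nbhs_ballP; exists (Num.min (T / 4) (e / (c + 1))).
    by rewrite /= lt_min divr_gt0 ?T0// divr_gt0.
  move=> s; rewrite /ball/= lt_min distrC => /andP[/ltW h1 h2]; split => //.
  rewrite (@le_trans _ _ ((c + 1) * `|s - t|))//.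
    by rewrite ler_wpM2r// lerDl.
  by rewrite mulrC -ler_pdivlMr// ltW.
have T42 : T / 4 <= T / 2.
  by rewrite ler_wpM2l ?(ltW T0)// lef_pV2 ?posrE// ler_nat.
have calL (t : R) : `|t| <= T -> calE alpha (L (sol t)).
  move=> tT; have et := sol_entire (T2 t tT); have bt := sol_bound (T2 t tT).
  apply/calEP; split; first exact: (Ltilde_entire hphi z0 be0 K4 et bt).
  by exists (4 * K * Q); [rewrite mulr_ge0|exact: Ltilde_expbound_beta].
split.
- move=> t /small tT; split; last exact: calL.
  apply/calEP; split; first exact/sol_entire/T2.
  exists (4 * K) => //; apply: (expbound_weaken al0 (ltW ab) K4).
  exact/sol_bound/T2.
- move=> t /small tT; apply/Enorm_cvg0 => e e0; apply: cvg_within.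
  have := small_near t e Lip e0 Lip0; apply: filterS => s [h1 h2].
  have h := lip t s tT (le_trans h1 T42).
  apply: (expbound_le h2); apply: (expbound_weaken al0 (ltW ab) _ h).
  by rewrite mulr_ge0.
- exists (fun t => L (sol t)); split.
  + by move=> t /andP[t0 tT]; apply/calL/small; rewrite ltW.
  + move=> t /andP[t0 tT].
    have tT' : `|t| <= T by apply: small; rewrite ltW.
    apply/Enorm_cvg0 => e e0.
    pose c := 2048 * (2 * K) / T ^+ 2.
    have c0 : 0 <= c.
      apply: divr_ge0; last exact/exprn_ge0/ltW.
      by apply: mulr_ge0; [exact: ler0n|exact: mulr_ge0].
    have := small_near 0 e c e0 c0; apply: filterS => s; rewrite subr0 => -[h1 h2] s0.
    have b := sol_taylor tT' h1.
    move=> f Lf; have b1 := expbound_weaken al0 (ltW ab) _ b.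
    have {}b1 := b1 _ f Lf; rewrite -/c in b1.
    have cs0 : 0 <= c * `|s| ^+ 2 by rewrite mulr_ge0// exprn_ge0.
    have sC : (s%:C : C) != 0 by rewrite -abs_gt0 abs_real normr_gt0.
    have as0 : 0 < abs (s%:C : C) by rewrite abs_gt0.
    rewrite -(ler_pM2l as0) -absM.
    have -> : s%:C * ((s^-1)%:C * (sol (t + s) f - sol t f) - L (sol t) f) =
        sol (t + s) f - sol t f - s%:C * L (sol t) f.
      have -> : (s^-1)%:C = (s%:C)^-1 :> C by rewrite (fmorphV (@real_complex R)).
      by field.
    rewrite (le_trans (b1 cs0))// abs_real [leRHS]mulrA ler_wpM2r ?expR_ge0//.
    by rewrite expr2 [leLHS]mulrA [leLHS]mulrC ler_wpM2l.
  + move=> t /andP[t0 tT].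
    have tT' : `|t| <= T by apply: small; rewrite ltW.
    apply/Enorm_cvg0 => e e0.
    have LQ0 : 0 <= Lip * Q by rewrite mulr_ge0.
    have n1 := small_near t e (Lip * Q) e0 LQ0.
    have n2 : \forall s \near t, `|s| <= T.
      apply/nbhs_ballP; exists (Num.min t (T - t)).
        by rewrite /= lt_min t0 subr_gt0.
      move=> s; rewrite /ball/= lt_min => /andP[h1 h2].
      move: h1 h2; rewrite !ltr_norml => /andP[h1 h2] /andP[h3 h4].
      by rewrite ler_norml; apply/andP; split; lra.
    apply: filterS2 n1 n2 => s [h1 h2] sT.
    have h := lip t s tT' (le_trans h1 T42).
    have Ls0 : 0 <= Lip * `|s - t| by rewrite mulr_ge0.
    apply: (expbound_le h2); rewrite mulrAC.
    exact: (Ltilde_sub K4 K4 Ls0 (sol_entire (T2 s sT)) (sol_entire (T2 t tT'))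
      (sol_bound (T2 s sT)) (sol_bound (T2 t tT')) h).
  + by [].
- move=> f Lf; have z2 : `|(0 : R)| <= 2 * T.
    by rewrite normr0 mulr_ge0// ltW.
  apply: (clim_uniq (sol_clim Lf z2)).
  (* At time 0 all partial sums equal [B0 f] except the empty one, whose error [abs (B0 f)] fixes
     the constant of the rate. *)
  apply: (@clim_geometric _ _ _ (abs (B0 f))) => n.
  have p0 m : psum m.+1 0%:C f = B0 f.
    elim: m => [|m IH]; first by rewrite /= mulr0 add0r expr0 mul1r /coef invr1 mul1r.
    rewrite -[LHS]/(1 * psum m.+1 0%:C f + 0%:C ^+ m.+1 * coef m.+1 f) IH.
    by rewrite expr0n mul0r mul1r addr0.
  case: n => [|n]; first by rewrite /= sub0r absN expr0 divr1.
  by rewrite p0 subrr abs0 divr_ge0 ?abs_ge0// exprn_ge0.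
Qed.

End from_initial_datum.
End existence.

Theorem theorem3p1 (R : realType) (d : nat) (d_gt0 : (0 < d)%N)
    (z : R) (z_gt0 : 0 < z) (phi : Rd R d -> \bar R) (hphi : potential phi)
    (alpha0 : R) (alpha0_gt0 : 0 < alpha0)
    (alpha : R) (halpha : 0 < alpha < alpha0) :
  exists T : R, 0 < T /\
    forall B0 : (Rd R d -> R[i]) -> R[i], calE alpha0 B0 ->
      exists B : R -> (Rd R d -> R[i]) -> R[i],
        is_solution z phi alpha T B0 B /\
        forall B' : R -> (Rd R d -> R[i]) -> R[i],
          is_solution z phi alpha T B0 B' ->
          forall t, 0 <= t < T -> forall f, L1 f -> B' t f = B t f.
Proof.
have /andP[al0 al1] := halpha.
(* The time is fixed before [B0]: it depends on the ratio [rho] alone, while the size [K] of the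
   datum is a mere prefactor of the series. *)
exists (existence_time phi z alpha alpha0); split.
  exact: existence_time_gt0.
move=> B0 /calEP[eB0 [K K0 bB0]].
have s := sol_is_solution hphi z_gt0 al0 al1 K0 eB0 bB0.
exists (sol phi z alpha alpha0 B0 K); split => // B' s'.
exact: (solution_unique hphi z_gt0 al0 s s').
Qed.
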